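(* For every fixed integer $n\geq 2$, $$\lim_{d\to\infty}\frac{\#\{f\in\mathcal B_{d,n}: X_f\text{ is smooth}\}}{2^{N_{d,n}}}=1.$$ More precisely, for every fixed integer $n\geq 2$, $$\frac{\#\{f\in\mathcal B_{d,n}: X_f\text{ is smooth}\}}{2^{N_{d,n}}}=1+O_n(d^{-1/2})\qquad(d\to\infty),$$ where the implied constant depends only on $n$.
   Context: For integers $n\ge1$, $d\geq 3$, $\mathcal B_{d,n}$ is the set of all homogeneous polynomials $f=\sum_{|\alpha|=d}\varepsilon_\alpha x^\alpha$ of degree $d$ in $x_0,\ldots,x_n$ in which every coefficient $\varepsilon_\alpha$ lies in $\{-1,1\}$ (every degree-$d$ monomial occurs); here $\alpha=(\alpha_0,\ldots,\alpha_n)$ runs over tuples of nonnegative integers with $|\alpha|=\alpha_0+\cdots+\alpha_n=d$ and $x^\alpha=x_0^{\alpha_0}\cdots x_n^{\alpha_n}$. $N_{d,n}=\binom{n+d}{n}$, so $\#\mathcal B_{d,n}=2^{N_{d,n}}$. $X_f\subset\mathbb P^n_{\mathbb C}$ is the closed subscheme defined by $f=0$, with its scheme structure (including repeated factors); smooth means geometrically smooth. *)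

(* Defs.v *)
From HB Require Import structures.
From mathcomp Require Import all_boot all_order all_algebra.
From mathcomp Require Import finmap.
From mathcomp Require mpoly.

Set Implicit Arguments.
Unset Strict Implicit.
Unset Printing Implicit Defensive.

Import GRing.Theory.

(* The notations of mpoly conflict with those of mathcomp-analysis: mpoly is
   imported inside this module only. *)
Module Hypersurface.
Import mpoly.

Local Open Scope ring_scope.
Local Open Scope fset_scope.

(* 'X_{1..n.+1 < d.+1} is the finite type of multi-indices of degree at most d;
   the signs attached to those of degree less than d play no role. *)
Definition signed_form (C : comNzRingType) (d n : nat)
    (eps : {ffun 'X_{1..n.+1 < d.+1} -> bool}) : {mpoly C[n.+1]} :=
  \sum_(m : 'X_{1..n.+1 < d.+1} | mdeg m == d) (-1) ^+ eps m *: 'X_[m].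

Definition signed_forms (C : comNzRingType) (d n : nat) :
    {fset {mpoly C[n.+1]}} :=
  [fset signed_form C eps | eps : {ffun 'X_{1..n.+1 < d.+1} -> bool}].

(* Equation of the hypersurface in the chart D_+(x_i) ~ A^n: x_i becomes 1 and
   the remaining variables are renumbered in increasing order. *)
Definition dehomogenize (C : comNzRingType) (n : nat) (i : 'I_n.+1)
    (f : {mpoly C[n.+1]}) : {mpoly C[n]} :=
  f \mPo [tuple if unlift i k is Some j then 'X_j else 1 | k < n.+1].

(* Spec C[y_1, ..., y_n]/(g) is smooth of relative dimension n - 1 over C: the
   1 x n Jacobian matrix of g has rank 1 at every point.  Points are taken with
   values in arbitrary extension fields K of C, so as to cover all points of
   the scheme (not only the C-rational ones) and all its base changes. *)
Definition affine_smooth (C : fieldType) (n : nat) (g : {mpoly C[n]}) : Prop :=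
  forall (K : fieldType) (phi : {rmorphism C -> K}) (y : 'I_n -> K),
    mmap phi y g = 0 -> exists j : 'I_n, mmap phi y g^`M(j) != 0.

Definition projective_smooth (C : fieldType) (n : nat) (f : {mpoly C[n.+1]}) :
    Prop :=
  forall i : 'I_n.+1, affine_smooth (dehomogenize i f).

End Hypersurface.

From mathcomp Require Import all_classical all_reals.
From mathcomp Require Import complex.

Local Open Scope ring_scope.
Local Open Scope fset_scope.

Definition smooth_proportion (R : realType) (d n : nat) : R :=
  #|` [fset f in Hypersurface.signed_forms R[i] d n
         | `[< Hypersurface.projective_smooth f >] ] |%:R
  / 2 ^+ 'C(n + d, n).

(* Main.v *)
Require Import Defs.
From mathcomp Require Import all_boot all_order all_algebra all_field.
From mathcomp Require Import finmap.
From mathcomp Require mpoly.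
From mathcomp Require Import boolp classical_sets.
From mathcomp Require Import zify ring.

(* A singular point of X_f over a field of characteristic 0 specializes, along
   a place above a prime p, to a singular point z of the reduction of f over an
   algebraic closure of F_p; p is chosen with p^2 <= d <= 16 p^2, and the
   probability that such a z exists is bounded by O_n(1/p).

   Restricting f to the coordinate subspace where z is supported, one may take
   z = (1 : y_1 : ... : y_r) in the torus.  For r = 0, f(z) is a sign.  For
   r = 1, f and the derivative of f in a direction transverse to the line
   restrict to two independent random binary forms, of which y_1 is a common
   zero.  For r >= 2, as in Poonen's sieve, write
   f = f_0 + sum_i x_i g_i^p + g_0^p (signs are their own p-th powers): the
   derivatives are d_i f_0 + g_i^p, so that the g_i act independently.

   Points one of whose coordinates has degree more than C log d over F_p.
   The r polynomials d_i f_0 and one coordinate y_j are algebraically dependent,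
   Phi(y_j, d_1 f_0, ..., d_r f_0) = 0.  When the g_i run over signed polynomials
   in y_j alone, y_j is a root of Phi(X, -g_1^p, ..., -g_r^p), which by the
   Schwartz-Zippel lemma is nonzero with overwhelming probability.  This plays
   the role of Bezout's theorem: the derivatives have only poly(d) common zeros,
   and g_0, independent of them, makes f vanish at one of these with
   probability at most 2^(- C log d).

   Points of small degree.  If y generates F_(p^e), each of the r + 1
   conditions asks a signed sum of vectors of F_p^e, grouped into T bases, to
   take a prescribed value; by Fourier analysis and Hoelder's inequality this
   has probability at most (p^-1 sum_s |cos (2 pi s / p)|^T)^e, and
   T >= c p^2 / h^2 (h bounding the degrees of the coordinates) gives
   (O(h) / p)^e.  Summing over the at most p^(r e) points y leaves O(1/p). *)

Set Implicit Arguments.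
Unset Strict Implicit.
Unset Printing Implicit Defensive.

(** * A prime between x and 4x *)

(** Why p is of order sqrt d. A signed sum of T terms spreads over a scale sqrt T, so it
    equidistributes modulo p up to a constant factor only if T is of order p^2. For r >= 2, writing
    monomials as p-th powers leaves exponents up to d / p, about p, and two coordinates provide p^2
    of them. For r = 1 there would be only about p: this is why the line is treated apart, with all
    the coefficients of two forms instead of those of p-th powers only; the second form exists
    because n >= 2 leaves a transverse direction. Conversely, O(1/p) is worth O(d^(-1/2)) only if p
    is at least of order sqrt d.

    The degree threshold is a multiple of log p: 2 to this threshold must beat a fixed power of p,
    while fixed powers of the threshold must stay below p. The points over F_p, the only small ones
    whose contribution really is of order 1/p, are treated with h = 1, so that no power of log d is
    lost. *)

Lemma dvdn_prod_primes (a b N : nat) :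
  (forall p, a <= p < b -> prime p -> p %| N) ->
  \prod_(a <= p < b | prime p) p %| N.
Proof.
elim: b => [|b IHb] H; first by rewrite big_geq // dvd1n.
have [ab|ba] := leqP a b; last by rewrite big_geq // dvd1n.
have Hb : \prod_(a <= p < b | prime p) p %| N.
  by apply: IHb => p /andP[ap pb]; apply: H; rewrite ap ltnW.
rewrite big_mkcond big_nat_recr //= -big_mkcond /=.
case: ifP => pb; last by rewrite muln1.
rewrite Gauss_dvd; first by rewrite Hb /= H // ab leqnn.
rewrite coprime_sym prime_coprime //.
rewrite big_seq_cond; elim/big_ind: _ => [||i].
- by rewrite Euclid_dvd1.
- by move=> x y; rewrite Euclid_dvdM // negb_or => -> ->.
rewrite mem_index_iota => /andP[/andP[ai ib] pi]; rewrite dvdn_prime2 //.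
by apply: contraTneq ib => ->; rewrite ltnn.
Qed.

(** The two middle coefficients of row 2m+1 are equal, and both occur in the expansion of (1 +
    1)^(2m+1). *)
Lemma bin_odd_middle m : 'C(m.*2.+1, m) <= 4 ^ m.
Proof.
have : 'C(m.*2.+1, m) + 'C(m.*2.+1, m.+1) <= 2 ^ m.*2.+1.
  rewrite -[X in _ <= X ^ _]/(1 + 1) expnDn.
  rewrite (eq_bigr (fun i : 'I_(m.*2.+2) => 'C(m.*2.+1, i))); last first.
    by move=> i _; rewrite !exp1n !muln1.
  have h1 : m < m.*2.+2 by lia.
  have h2 : m.+1 < m.*2.+2 by lia.
  rewrite (bigD1 (Ordinal h1)) //= (bigD1 (Ordinal h2)) /=; last first.
    by rewrite -val_eqE /=; lia.
  by rewrite addnA leq_addr.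
have -> : 'C(m.*2.+1, m.+1) = 'C(m.*2.+1, m).
  by rewrite -bin_sub; [congr 'C(_, _)|]; lia.
rewrite addnn expnS -mul2n leq_pmul2l // -(expnM 2 2) mul2n.
by [].
Qed.

Lemma prime_dvd_fact p k : prime p -> p %| k`! -> p <= k.
Proof.
move=> pp; elim: k => [|k IHk]; first by rewrite fact0 Euclid_dvd1.
rewrite factS Euclid_dvdM // => /orP[/dvdn_leq->//|/IHk]; exact: leqW.
Qed.

(** Argument of Erdos: when [n.+1] = 2m+1 is prime, the primes in (m+1, 2m+1] all divide C(2m+1, m)
    <= 4^m, and those up to m+1 are left to the induction. *)
Lemma primorial_le n : \prod_(0 <= p < n.+1 | prime p) p <= 4 ^ n.
Proof.
elim/ltn_ind: n => n IHn.
have step k : 0 < k -> ~~ prime k -> \prod_(0 <= p < k.+1 | prime p) p = \prod_(0 <= p <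
    k | prime p) p.
  by move=> k0 pk; rewrite big_mkcond big_nat_recr //= -big_mkcond /= (negPf pk) muln1.
case: n IHn => [|n] IHn; first by rewrite big_mkcond /= big_nat1.
have [pn|pn] := boolP (~~ prime n.+1).
  rewrite step //.
  by apply: leq_trans (IHn n _) _ => //; rewrite leq_exp2l.
rewrite negbK in pn; have [n2|n2] := leqP n 1.
  by case: n n2 pn {IHn} => [|[|//]] _ // _; rewrite unlock.
have on : odd n.+1 by case: (even_prime pn) => [|//]; lia.
have [m nm] : exists m, n = m.*2 by exists n./2; lia.
rewrite nm (@big_cat_nat _ _ _ m.+2) //=; last lia.
have -> : 4 ^ m.*2.+1 = 4 ^ m.+1 * 4 ^ m by rewrite -expnD; congr (4 ^ _); lia.
apply: leq_mul; first by apply: IHn; lia.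
apply: leq_trans (bin_odd_middle m); apply: dvdn_leq; first by rewrite bin_gt0; lia.
apply: dvdn_prod_primes => p /andP[mp pm] pp.
have : p %| (m.*2.+1)`! by rewrite dvdn_fact // prime_gt0 // -ltnS.
rewrite -(@bin_fact m.*2.+1 m); last lia.
rewrite !Euclid_dvdM // => /or3P[//|/prime_dvd_fact|/prime_dvd_fact]; lia.
Qed.

(** Legendre's formula: the k-th term is floor (2m / p^k) - 2 floor (m / p^k), which is at most 1,
    and it vanishes when p^k > 2m. *)
Lemma logn_binD m p : prime p -> 0 < m ->
  logn p 'C(m.*2, m) <= trunc_log p m.*2.
Proof.
move=> pp m0; have p1 := prime_gt1 pp.
have H : logn p 'C(m.*2, m) + (logn p m`! + logn p m`!) = logn p (m.*2)`!.
  rewrite -(@bin_fact m.*2 m); last lia.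
  have -> : m.*2 - m = m by lia.
  by rewrite !lognM ?muln_gt0 ?fact_gt0 // bin_gt0; lia.
set t := trunc_log p m.*2.
have lt_p k : t < k -> m.*2 < p ^ k.
  move=> tk; apply: leq_trans (trunc_log_ltn _ p1) _.
  by rewrite leq_exp2l.
have S N : N <= m.*2 -> logn p N`! = \sum_(1 <= k < t.+1) N %/ p ^ k.
  move=> Nm; rewrite logn_fact //.
  have [tN|Nt] := leqP t N.
    rewrite (@big_cat_nat _ _ _ t.+1) //= [X in _ + X]big1_seq ?addn0 // => k.
    rewrite mem_index_iota => /andP[_ /andP[tk _]].
    by rewrite divn_small // (leq_ltn_trans Nm) // lt_p.
  rewrite [RHS](@big_cat_nat _ _ _ N.+1) //=; last exact: ltnW.
  rewrite [X in _ = _ + X]big1_seq ?addn0 // => k.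
  rewrite mem_index_iota => /andP[_ /andP[Nk _]].
  by rewrite divn_small // (ltn_trans Nk) // ltn_expl.
rewrite -(leq_add2r (logn p m`! + logn p m`!)) H !S //; last lia.
rewrite -!big_split /=; have {2}-> : t = \sum_(1 <= k < t.+1) 1.
  by rewrite sum_nat_const_nat; lia.
rewrite -big_split /=; apply: leq_sum => k _.
have q0 : 0 < p ^ k by rewrite expn_gt0 prime_gt0.
rewrite -ltnS ltn_divLR //; have := ltn_ceil m q0.
move: (m %/ p ^ k) (p ^ k) => a b; nia.
Qed.

Lemma pow_logn_bin_le m p : prime p -> 0 < m -> p ^ logn p 'C(m.*2, m) <= m.*2.
Proof.
move=> pp m0; apply: leq_trans (trunc_logP (prime_gt1 pp) _); last lia.
by rewrite leq_exp2l ?prime_gt1 ?logn_binD.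
Qed.

Lemma central_bin_ge m : 4 ^ m <= (m.*2.+1) * 'C(m.*2, m).
Proof.
have -> : 4 ^ m = 2 ^ m.*2 by rewrite -mul2n expnM.
rewrite -[X in X ^ _]/(1 + 1) expnDn.
rewrite (eq_bigr (fun i : 'I_(m.*2.+1) => 'C(m.*2, i))); last first.
  by move=> i _; rewrite !exp1n !muln1.
rewrite -[X in _ <= X * _](card_ord m.*2.+1) -sum_nat_const; apply: leq_sum => i _.
have H : forall j, j <= m -> 'C(m.*2, j) <= 'C(m.*2, m).
  move=> j; move: {2}(m - j) (erefl (m - j)) => k; elim: k j => [|k IHk] j mj jm.
    by have -> : j = m by lia.
  have jm' : j < m by lia.
  apply: leq_trans (IHk j.+1 _ jm'); last lia.
  have := mul_bin_left m.*2 j; nia.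
have [im|mi] := leqP i m; first exact: H.
rewrite -bin_sub; last by rewrite -ltnS.
by apply: H; lia.
Qed.

(** Without a prime in (x, 4x], only primes up to x divide C(4x, 2x). Those below s contribute at
    most 4x each; the others have p^2 > 4x, hence exponent at most 1, and their product is at most
    the primorial of x. *)
Lemma no_prime_central_bin x s : 0 < x -> 4 * x < s ^ 2 ->
  (forall p, x < p <= 4 * x -> ~~ prime p) ->
  'C(x.*2.*2, x.*2) <= (4 * x) ^ s * 4 ^ x.
Proof.
move=> x0 xs nop; set N := 'C(_, _).
have N0 : 0 < N by rewrite bin_gt0; lia.
have log0 p : x < p -> p ^ logn p N = 1.
  move=> xp; have [pp|/negPf pp] := boolP (prime p); last by rewrite lognE pp.
  have [px|px] := leqP p (4 * x); first by have := nop p; rewrite xp px pp => /(_ isT).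
  suff -> : logn p N = 0 by [].
  apply/eqP; rewrite -leqn0; apply: leq_trans (logn_binD pp _) _; first lia.
  by rewrite leqn0 trunc_log_eq0; apply/orP; right; lia.
rewrite -[N](partnT N0) (widen_partn predT (leq_addr x N)).
rewrite (@big_cat_nat _ _ _ x.+1) //=; last lia.
rewrite [X in _ * X]big1_seq ?muln1; last first.
  by move=> p; rewrite mem_index_iota => /andP[_ /andP[xp _]]; exact: log0.
have -> : (4 * x) ^ s = \prod_(0 <= p < s) (4 * x) by rewrite prod_nat_const_nat subn0.
apply: leq_trans (_ : \prod_(0 <= p < x.+1) ((if p < s then 4 * x else 1) * (if prime p
    then p else 1)) <= _).
  apply: leq_prod => p _; have [pp|/negPf pp] := boolP (prime p); last first.
    by rewrite lognE pp /=; case: ifP; lia.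
  have p0 := prime_gt0 pp; have x2 : 0 < x.*2 by lia.
  case: ifP => ps.
    apply: leq_trans (pow_logn_bin_le pp x2) _; nia.
  rewrite mul1n -[leqRHS]expn1 leq_exp2l ?prime_gt1 //.
  apply: leq_trans (logn_binD pp x2) _; rewrite -ltnS.
  have p1 := prime_gt1 pp.
  rewrite -(ltn_exp2l _ _ p1); apply: leq_ltn_trans (trunc_logP p1 _) _; first lia.
  apply: (@leq_trans (s ^ 2)); first lia.
  by rewrite leq_exp2r // leqNgt ps.
rewrite big_split /=; apply: leq_mul; last first.
  by rewrite -big_mkcond; exact: primorial_le.
have [sx|xs'] := leqP s x.+1.
  rewrite (@big_cat_nat _ _ _ s) //= [X in _ * X]big1_seq ?muln1; last first.
    by move=> p; rewrite mem_index_iota => /andP[_ /andP[sp _]]; rewrite ltnNge sp.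
  rewrite big_nat_cond [leqRHS]big_nat_cond; apply: leq_prod => p.
  by rewrite andbT => /andP[_ ->].
rewrite [leqRHS](@big_cat_nat _ _ _ x.+1) //=; last exact: ltnW.
rewrite -[leqLHS]muln1; apply: leq_mul.
  by apply: leq_prod => p _; case: ifP; lia.
by rewrite prod_nat_const_nat expn_gt0; lia.
Qed.

(** The interval is wider than in Bertrand's postulate so that the primorial bound 4^x already loses
    against the central binomial, which is about 4^(2x); the remaining factor is only exp (O(sqrt x
    log x)). *)
Lemma exists_prime_between : exists x0, forall x, x0 <= x ->
  exists p, [/\ prime p, x < p & p <= 4 * x].
Proof.
have pow j : 9 <= j -> 32 * j < 2 ^ j.
  elim: j => // j IHj; rewrite leq_eqVlt => /predU1P[<- //|]; rewrite ltnS => j9.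
  by rewrite expnS; have := IHj j9; lia.
exists (2 ^ 20) => x x20; have x0 : 0 < x by apply: leq_trans x20; rewrite expn_gt0.
have [/existsP[p /andP[xp pp]]|] := boolP [exists p : 'I_(4 * x).+1, (x < p) && prime p].
  by exists p; rewrite pp xp -ltnS ltn_ord.
rewrite negb_exists => /forallP nop; exfalso.
have {}nop p : x < p <= 4 * x -> ~~ prime p.
  move=> /andP[xp p4]; have p4' : p < (4 * x).+1 by [].
  by have := nop (Ordinal p4'); rewrite /= xp.
(* [2 ^ k] is the power of 2 in (4x, 8x]; the role of s is played by [2 ^ j], the least power of 2
   whose square is at least [2 ^ k]. *)
set k := (trunc_log 2 (4 * x)).+1; set j := uphalf k.
have k1 : 4 * x < 2 ^ k by rewrite trunc_log_ltn.
have k2 : 2 ^ k <= 8 * x.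
  by rewrite expnS; have := @trunc_logP 2 (4 * x) isT; lia.
have jk : k <= j + j /\ j + j <= k.+1.
  by rewrite /j uphalf_half; move: (odd_double_half k); case: (odd k); lia.
have k20 : 20 <= k.
  rewrite -(leq_exp2l _ _ (isT : 1 < 2)); apply: leq_trans x20 _.
  by apply: leq_trans (ltnW k1); lia.
clear x20.
have xs : 4 * x < (2 ^ j) ^ 2.
  rewrite -expnM; apply: leq_trans k1 _; rewrite leq_exp2l //.
  by rewrite /j uphalf_half; lia.
have B1 := no_prime_central_bin x0 xs nop; have B2 := central_bin_ge x.*2.
have B3 : 4 ^ x * 4 ^ x <= (8 * x) ^ (2 ^ j).+1 * 4 ^ x.
  rewrite -expnD addnn; apply: leq_trans B2 _.
  apply: (@leq_trans (8 * x * ((4 * x) ^ 2 ^ j * 4 ^ x))); first by apply: leq_mul; lia.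
  rewrite mulnA leq_mul2r expnS leq_mul2l; apply/orP; right; apply/orP; right.
  by rewrite leq_exp2r ?expn_gt0 //; lia.
have B4 : 4 ^ x <= (2 ^ k.+1) ^ (2 ^ j).+1.
  move: B3; rewrite leq_pmul2r ?expn_gt0 // => /leq_trans; apply.
  by rewrite leq_exp2r // expnS; lia.
have B5 : 2 * x <= k.+1 * (2 ^ j).+1.
  by move: B4; rewrite -expnM -(expnM 2 2) leq_exp2l.
have j9 : 9 <= j by rewrite /j uphalf_half; lia.
have B6 := pow j j9.
have B7 : 2 ^ k.+1 >= 2 ^ (j + j).
  by rewrite leq_exp2l //; lia.
have B8 : k <= 2 * j by lia.
move: B7; rewrite expnD expnS => B7.
have B9 : 2 ^ k <= 4 * k.+1 * (2 ^ j).+1 by nia.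
have : 2 ^ j * 2 ^ j <= 8 * (2 * j).+1 * (2 ^ j).+1 by nia.
move: (2 ^ j) B6 j9 => w; nia.
Qed.

Import Order.TTheory GRing.Theory Num.Theory.
Local Open Scope ring_scope.

(** * Places of a field of characteristic 0 *)

Section PartialMorphisms.
Variables (K L : fieldType).

(** A ring morphism from a subring of K to L. The function is total, but its values off the domain
    carry no information. *)
Record pmorph := PMorph {
  pm_dom : K -> Prop;
  pm_fun : K -> L;
  pm_dom1 : pm_dom 1;
  pm_domB : forall x y, pm_dom x -> pm_dom y -> pm_dom (x - y);
  pm_domM : forall x y, pm_dom x -> pm_dom y -> pm_dom (x * y);
  pm_fun1 : pm_fun 1 = 1;
  pm_funB : forall x y, pm_dom x -> pm_dom y ->
    pm_fun (x - y) = pm_fun x - pm_fun y;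
  pm_funM : forall x y, pm_dom x -> pm_dom y ->
    pm_fun (x * y) = pm_fun x * pm_fun y }.

Section Theory.
Variable f : pmorph.
Local Notation A := (pm_dom f).
Local Notation "f @p P" := (map_poly (pm_fun f) P) (at level 10).

Lemma pm_dom0 : A 0.
Proof. by rewrite -(subrr 1); apply: pm_domB; apply: pm_dom1. Qed.

Lemma pm_fun0 : pm_fun f 0 = 0.
Proof. by rewrite -(subrr 1) pm_funB ?subrr; try exact: pm_dom1. Qed.

Lemma pm_domN x : A x -> A (- x).
Proof. by move=> Ax; rewrite -sub0r; apply: pm_domB => //; apply: pm_dom0. Qed.

Lemma pm_funN x : A x -> pm_fun f (- x) = - pm_fun f x.
Proof.
by move=> Ax; rewrite -sub0r pm_funB ?pm_fun0 ?sub0r//; exact: pm_dom0.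
Qed.

Lemma pm_domD x y : A x -> A y -> A (x + y).
Proof. by move=> Ax Ay; rewrite -(opprK y); apply: pm_domB => //; apply: pm_domN. Qed.

Lemma pm_funD x y : A x -> A y -> pm_fun f (x + y) = pm_fun f x + pm_fun f y.
Proof.
by move=> Ax Ay; rewrite -{1}(opprK y) pm_funB ?pm_funN ?opprK//; exact: pm_domN.
Qed.

Lemma pm_sum (I : Type) (s : seq I) (P : pred I) (F : I -> K) :
  (forall i, P i -> A (F i)) ->
  A (\sum_(i <- s | P i) F i) /\
  pm_fun f (\sum_(i <- s | P i) F i) = \sum_(i <- s | P i) pm_fun f (F i).
Proof.
move=> AF; elim: s => [|i s [IHA IHf]].
  by rewrite !big_nil pm_fun0; split=> //; exact: pm_dom0.
rewrite !big_cons; case: ifP => // Pi; split; first by apply: pm_domD => //; apply: AF.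
by rewrite pm_funD ?IHf//; apply: AF.
Qed.

Lemma pm_prod (I : Type) (s : seq I) (P : pred I) (F : I -> K) :
  (forall i, P i -> A (F i)) ->
  A (\prod_(i <- s | P i) F i) /\
  pm_fun f (\prod_(i <- s | P i) F i) = \prod_(i <- s | P i) pm_fun f (F i).
Proof.
move=> AF; elim: s => [|i s [IHA IHf]].
  by rewrite !big_nil pm_fun1; split=> //; exact: pm_dom1.
rewrite !big_cons; case: ifP => // Pi; split; first by apply: pm_domM => //; apply: AF.
by rewrite pm_funM ?IHf//; apply: AF.
Qed.

Lemma pm_exp x k : A x -> A (x ^+ k) /\ pm_fun f (x ^+ k) = pm_fun f x ^+ k.
Proof.
move=> Ax; have := @pm_prod 'I_k (index_enum _) predT (fun=> x) (fun _ _ => Ax).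
by rewrite !prodr_const card_ord.
Qed.

Lemma pm_nat k : A k%:R /\ pm_fun f k%:R = k%:R.
Proof.
elim: k => [|k [IHA IHf]]; first by rewrite pm_fun0; split=> //; exact: pm_dom0.
rewrite -!natr1; split; first by apply: pm_domD => //; exact: pm_dom1.
by rewrite pm_funD ?IHf ?pm_fun1//; exact: pm_dom1.
Qed.

Definition pm_poly (P : {poly K}) := forall i, A P`_i.

Lemma pm_coef P i : (f @p P)`_i = pm_fun f P`_i.
Proof. by rewrite coef_map_id0 // pm_fun0. Qed.

Lemma pm_polyB P Q : pm_poly P -> pm_poly Q ->
  pm_poly (P - Q) /\ f @p (P - Q) = f @p P - f @p Q.
Proof.
move=> AP AQ; split=> [i|]; first by rewrite coefB; apply: pm_domB.
by apply/polyP=> i; rewrite coefB !pm_coef coefB pm_funB.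
Qed.

Lemma pm_polyM P Q : pm_poly P -> pm_poly Q ->
  pm_poly (P * Q) /\ f @p (P * Q) = f @p P * f @p Q.
Proof.
move=> AP AQ; have H i := @pm_sum _ (index_enum 'I_i.+1) predT
   (fun j : 'I_i.+1 => P`_j * Q`_(i - j)) (fun j _ => pm_domM (AP _) (AQ _)).
split=> [i|]; first by rewrite coefM; case: (H i).
apply/polyP=> i; rewrite pm_coef !coefM; have [_ ->] := H i.
by apply: eq_bigr => j _; rewrite pm_funM // !pm_coef.
Qed.

Lemma pm_polyC c : A c -> pm_poly c%:P /\ f @p c%:P = (pm_fun f c)%:P.
Proof.
move=> Ac; split=> [i|]; first by rewrite coefC; case: eqP => // _; exact: pm_dom0.
by apply/polyP=> i; rewrite pm_coef !coefC; case: eqP => // _; rewrite pm_fun0.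
Qed.

Lemma pm_polyXn k : pm_poly 'X^k /\ f @p 'X^k = 'X^k.
Proof.
split=> [i|]; first by rewrite coefXn; case: eqP => _; [exact: pm_dom1|exact: pm_dom0].
apply/polyP=> i; rewrite pm_coef !coefXn; case: eqP => _ //=.
  exact: pm_fun1.
exact: pm_fun0.
Qed.

(* Such a P puts an element of the domain A with nonzero image into m A[x], where
   m is the kernel of f: then f does not extend to A[x]. *)
Definition pm_obstruction x P := [/\ pm_poly P, P.[x] = 0, pm_fun f P`_0 != 0 &
  forall i, (0 < i)%N -> pm_fun f P`_i = 0].

Definition pm_obstructed x := exists P, pm_obstruction x P.
End Theory.

Definition pm_le (f g : pmorph) :=
  forall x, pm_dom f x -> pm_dom g x /\ pm_fun g x = pm_fun f x.

Lemma pm_le_trans f g h : pm_le f g -> pm_le g h -> pm_le f h.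
Proof.
by move=> fg gh x fx; have [gx <-] := fg x fx; exact: gh.
Qed.

Lemma pm_chain (f0 : pmorph) (C : set pmorph) :
  (forall f g, C f -> C g -> pm_le f g \/ pm_le g f) ->
  exists g, forall f, C f -> pm_le f g.
Proof.
move=> totC; have [[f1 Cf1]|C0] := pselect (exists f, C f); last first.
  by exists f0 => f Cf; case: C0; exists f.
pose D x := exists2 f, C f & pm_dom f x.
have D2 x y : D x -> D y -> exists f, [/\ C f, pm_dom f x & pm_dom f y].
  move=> [f Cf fx] [g Cg gy]; have [fg|gf] := totC _ _ Cf Cg.
    by exists g; split=> //; case: (fg _ fx).
  by exists f; split=> //; case: (gf _ gy).
pose F x := if pselect (D x) is left dx then
  pm_fun (projT1 (cid2 dx)) x else 0.
have FE f x : C f -> pm_dom f x -> F x = pm_fun f x.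
  move=> Cf fx; rewrite /F; case: pselect => [dx|[]]; last by exists f.
  case: cid2 => g /= Cg gx; have [fg|gf] := totC _ _ Cf Cg.
    by case: (fg _ fx).
  by case: (gf _ gx).
unshelve eexists (@PMorph D F _ _ _ _ _ _).
- by exists f1 => //; exact: pm_dom1.
- by move=> x y Dx Dy; have [f [Cf fx fy]] := D2 _ _ Dx Dy; exists f => //; exact: pm_domB.
- by move=> x y Dx Dy; have [f [Cf fx fy]] := D2 _ _ Dx Dy; exists f => //; exact: pm_domM.
- by rewrite (FE f1) ?pm_fun1//; exact: pm_dom1.
- move=> x y Dx Dy; have [f [Cf fx fy]] := D2 _ _ Dx Dy.
  by rewrite !(FE f) ?pm_funB//; exact: pm_domB.
- move=> x y Dx Dy; have [f [Cf fx fy]] := D2 _ _ Dx Dy.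
  by rewrite !(FE f) ?pm_funM//; exact: pm_domM.
by move=> f Cf x fx /=; split; [exists f|exact: FE].
Qed.

(** Zorn's lemma in its preorder form: [pm_le] is not antisymmetric, since morphisms that agree on a
    common domain may differ elsewhere. *)
Lemma pm_maximal (f0 : pmorph) :
  exists f, forall g, pm_le f g -> pm_le g f.
Proof.
have [||C totC|f maxf] := @ZL_preorder pmorph f0 (fun f g => `[< pm_le f g >]).
- by move=> f; apply/asboolP.
- by move=> f g h /asboolP fg /asboolP gh; apply/asboolP; exact: pm_le_trans gh.
- have [f g Cf Cg|g gP] := @pm_chain f0 C.
    by have [/asboolP|/asboolP] := totC f g Cf Cg; [left|right].
  by exists g => f Cf; apply/asboolP; exact: gP.
by exists f => g /asboolP/maxf/asboolP.
Qed.
End PartialMorphisms.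

(** * The domain of a maximal partial morphism is a valuation ring *)

Section Extension.
Variables (K L : fieldType) (f : pmorph K L).
Hypothesis closedL : forall P : {poly L}, size P != 1 -> exists w, root P w.
Hypothesis maxf : forall g, pm_le f g -> pm_le g f.
Local Notation A := (pm_dom f).
Local Notation "f @p P" := (map_poly (pm_fun f) P) (at level 10).

Lemma pm_relations_common_root x : ~ pm_obstructed f x ->
  exists w : L, forall P, pm_poly f P -> P.[x] = 0 -> (f @p P).[w] = 0.
Proof.
move=> nobs.
(* A relation whose image in L[X] is nonzero of minimal size divides the images
   of all the others, by pseudo-division in A[X]. *)
pose J k := `[< exists P, [/\ pm_poly f P, P.[x] = 0, f @p P != 0 & size (f @p P) = k] >].
have [[k Jk]|J0] := pselect (exists k, J k); last first.
  exists 0 => P AP Px; apply: contra_notP J0 => /eqP Pw.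
  exists (size (f @p P)); apply/asboolP; exists P; split=> //.
  by apply: contraNneq Pw => ->; rewrite horner0.
have [s /asboolP[P [AP Px Pn0 Ps]] smin] := ex_minnP (ex_intro J k Jk).
have s1 : s != 1.
  apply/eqP => s1; apply: nobs; exists P; split=> //.
    move/eqP: Ps; rewrite s1 => /size_poly1P[c cn0 Pc].
    by rewrite -pm_coef Pc coefC.
  by move=> i i0; rewrite -pm_coef nth_default// Ps s1.
have [w Pw] : exists w, root (f @p P) w.
  by apply: closedL; rewrite Ps.
exists w => Q; move: {2}(size (f @p Q)) (leqnn (size (f @p Q))) => m.
elim: m Q => [|m IHm] Q sQ AQ Qx.
  by move: sQ; rewrite leqn0 size_poly_eq0 => /eqP ->; rewrite horner0.
have [Q0|Qn0] := eqVneq (f @p Q) 0; first by rewrite Q0 horner0.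
have sPQ : (s <= size (f @p Q))%N.
  by apply: smin; apply/asboolP; exists Q.
have [t st] : exists t, s = t.+1.
  by exists s.-1; rewrite prednK// -Ps size_poly_gt0.
pose u := (size (f @p Q) - s)%N; pose c := P`_t; pose c' := Q`_(u + t).
have fc : pm_fun f c = lead_coef (f @p P) by rewrite lead_coefE Ps st -pm_coef.
have fc' : pm_fun f c' = lead_coef (f @p Q).
  by rewrite lead_coefE -pm_coef -(subnK sPQ) -/u st addnS.
pose R := c%:P * Q - (c'%:P * 'X^u) * P.
have [Ac fcP] := pm_polyC (AP t : A c); have [Ac' fcP'] := pm_polyC (AQ (u + t)%N : A c').
have [Au fu] := pm_polyXn f u.
have [A1 f1] := pm_polyM Ac AQ; have [A2 f2] := pm_polyM Ac' Au.
have [A3 f3] := pm_polyM A2 AP; have [A4 f4] := pm_polyB A1 A3.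
have Rx : R.[x] = 0 by rewrite !hornerE Qx Px !mulr0 subrr.
have fR : f @p R = (pm_fun f c)%:P * f @p Q - (pm_fun f c')%:P * 'X^u * f @p P.
  by rewrite f4 f1 f3 f2 fcP fcP' fu.
have sR : (size (f @p R) <= m)%N.
  rewrite -ltnS; apply: leq_trans sQ.
  have lt0 : (0 < size (f @p Q))%N by rewrite size_poly_gt0.
  rewrite fR -(prednK lt0) ltnS; apply/leq_sizeP => j; rewrite leq_eqVlt => /orP[/eqP <-|].
    rewrite coefB -mulrA !coefCM coefXnM.
    have -> : ((size (f @p Q)).-1 < u)%N = false.
      by apply/negbTE; rewrite -leqNgt /u st -subn1 leq_sub2l.
    have -> : ((size (f @p Q)).-1 - u)%N = t.
      by rewrite -(subnK sPQ) -/u st addnS /= addKn.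
    by rewrite (pm_coef f P) -/c -lead_coefE -fc' mulrC subrr.
  rewrite prednK // => sj.
  rewrite coefB -mulrA !coefCM coefXnM (nth_default _ sj) mulr0 sub0r.
  case: ifP => [_|/negbT]; first by rewrite mulr0 oppr0.
  rewrite -leqNgt => uj; rewrite nth_default ?mulr0 ?oppr0 // Ps.
  by rewrite -(leq_add2r u) subnK // addnC /u subnK.
have := IHm R sR A4 Rx.
rewrite fR !(hornerE, hornerXn) (eqP (Pw : _ == 0)) mulr0 subr0.
by move/eqP; rewrite mulf_eq0 fc lead_coef_eq0 (negPf Pn0) => /eqP.
Qed.

(** Sending x to the common root w is well defined on A[x], because two expressions of the same
    element differ by a relation. This extends f, so x is in A by maximality. *)
Lemma pm_unobstructed_dom x : ~ pm_obstructed f x -> A x.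
Proof.
move=> nobs; have [w wP] := pm_relations_common_root nobs.
pose D y := exists2 P, pm_poly f P & y = P.[x].
pose F y := if pselect (D y) is left dy then (f @p (projT1 (cid2 dy))).[w] else 0.
have FE P : pm_poly f P -> F P.[x] = (f @p P).[w].
  move=> AP; rewrite /F; case: pselect => [dy|[]]; last by exists P.
  case: cid2 => Q /= AQ /esym/eqP; rewrite -subr_eq0 -hornerN -hornerD => /eqP QP.
  have [A1 f1] := pm_polyB AQ AP; have := wP _ A1 QP.
  by rewrite f1 !hornerE => /subr0_eq.
have C1 := pm_polyC (pm_dom1 f).
have F1 : F 1 = 1.
  by rewrite -[X in F X](hornerC 1 x) FE ?C1.2 ?hornerC ?pm_fun1 //; exact: C1.1.
have D1 : D 1 by exists 1%:P; [exact: C1.1|rewrite hornerC].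
have DB y z : D y -> D z -> D (y - z).
  move=> [P AP ->] [Q AQ ->]; exists (P - Q); rewrite ?hornerE//.
  by have [] := pm_polyB AP AQ.
have DM y z : D y -> D z -> D (y * z).
  move=> [P AP ->] [Q AQ ->]; exists (P * Q); rewrite ?hornerE//.
  by have [] := pm_polyM AP AQ.
have FB y z : D y -> D z -> F (y - z) = F y - F z.
  move=> [P AP ->] [Q AQ ->]; have [A1 f1] := pm_polyB AP AQ.
  by rewrite -hornerN -hornerD !FE // f1 !hornerE.
have FM y z : D y -> D z -> F (y * z) = F y * F z.
  move=> [P AP ->] [Q AQ ->]; have [A1 f1] := pm_polyM AP AQ.
  by rewrite -hornerM !FE // f1 !hornerE.
pose g := PMorph D1 DB DM F1 FB FM.
have fg : pm_le f g.
  move=> y Ay; have [A1 f1] := pm_polyC Ay.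
  split; first by exists y%:P => //; rewrite hornerC.
  have -> : pm_fun g y = F y%:P.[x] by rewrite hornerC.
  by rewrite FE // f1; exact: hornerC.
apply: (proj1 (maxf fg (x := x) _)).
exists 'X; last by rewrite hornerX.
by have [] := pm_polyXn f 1; rewrite expr1.
Qed.

Lemma pm_obstruction_size x P : pm_obstruction f x P -> (1 < size P)%N.
Proof.
move=> [AP Px P0 _]; rewrite ltnNge; apply: contra_neqN P0 => sP.
have <- : P.[x] = P`_0 by rewrite {1}(size1_polyC sP) hornerC.
by rewrite Px pm_fun0.
Qed.

(** Let R be Q reversed: x is a root of R, whose top coefficient is Q_0. Subtracting P_n X^(n-q) R
    from Q_0 P cancels the term of degree n. Since f kills P_n, the result still maps to a nonzero
    constant. *)
Lemma pm_obstruction_reduce x P Q : x != 0 ->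
  pm_obstruction f x P -> pm_obstruction f x^-1 Q -> (size Q <= size P)%N ->
  exists2 P', pm_obstruction f x P' & (size P' < size P)%N.
Proof.
move=> xn0 oP oQ; have s1 := pm_obstruction_size oP; have s2 := pm_obstruction_size oQ.
case: oP => AP Px P0 Pi; case: oQ => AQ Qx Q0 Qi.
have [n sP] : exists n, size P = n.+1 by exists (size P).-1; rewrite prednK // ltnW.
have [q sQ] : exists q, size Q = q.+1 by exists (size Q).-1; rewrite prednK // ltnW.
rewrite sP sQ ltnS => qn.
have n0 : (0 < n)%N by rewrite sP in s1.
pose R := \poly_(i < q.+1) Q`_(q - i).
have AR : pm_poly f R.
  by move=> i; rewrite coef_poly; case: ifP => _; [exact: AQ|exact: pm_dom0].
have Rx : R.[x] = 0.
  transitivity (x ^+ q * Q.[x^-1]); last by rewrite Qx mulr0.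
  rewrite horner_poly horner_coef sQ mulr_sumr.
  rewrite (reindex_inj rev_ord_inj) /=. apply: eq_bigr => i _.
  rewrite subSS subKn -1?ltnS // mulrCA; congr (_ * _).
  have iq : (i <= q)%N by rewrite -ltnS.
  have -> : x ^+ q = x ^+ (q - i) * x ^+ i by rewrite -exprD subnK.
  by rewrite exprVn mulfK // expf_neq0.
have [A1 _] := pm_polyM (pm_polyC (AQ 0)).1 AP.
have [A2 _] := pm_polyM (pm_polyC (AP n)).1 (pm_polyXn f (n - q)).1.
have [A3 _] := pm_polyM A2 AR; have [A4 f4] := pm_polyB A1 A3.
exists ((Q`_0)%:P * P - (P`_n)%:P * 'X^(n - q) * R).
  have fn i : pm_fun f ((P`_n)%:P * 'X^(n - q) * R)`_i = 0.
    rewrite -mulrA coefCM pm_funM ?Pi ?mul0r//.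
    by have [A5 _] := pm_polyM (pm_polyXn f (n - q)).1 AR; apply: A5.
  split=> // [||i i0].
  - by rewrite !hornerE Px Rx !mulr0 subrr.
  - by rewrite coefB pm_funB ?fn ?subr0 // coefCM pm_funM // mulf_neq0.
  - by rewrite coefB pm_funB ?fn ?subr0 // coefCM pm_funM // Pi // mulr0.
rewrite ltnS; apply/leq_sizeP => j; rewrite leq_eqVlt => /orP[/eqP <-|nj].
  rewrite coefB -mulrA !coefCM coefXnM ltnNge leq_subr /= subKn // coef_poly ltnSn subnn.
  by rewrite mulrC subrr.
have Pj : P`_j = 0 by rewrite nth_default // sP.
rewrite coefB -mulrA !coefCM Pj mulr0 sub0r coefXnM.
case: ifP => _; first by rewrite mulr0 oppr0.
rewrite coef_poly ifF ?mulr0 ?oppr0//; apply/negbTE; rewrite -leqNgt ltn_subRL.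
by rewrite subnK.
Qed.

(** Descent on the sum of the sizes: the longer obstruction can be shortened, and x and x^-1 play
    symmetric roles. *)
Lemma pm_not_both_obstructed x P Q : x != 0 ->
  pm_obstruction f x P -> pm_obstruction f x^-1 Q -> False.
Proof.
move: {2}(size P + size Q)%N (leqnn (size P + size Q)) => N.
elim: N x P Q => [|N IHN] x P Q sPQ xn0 oP oQ.
  by have := pm_obstruction_size oP; move: sPQ; rewrite leqn0 addn_eq0 => /andP[/eqP ->].
case: (leqP (size Q) (size P)) => [sQP|/ltnW sPQ'].
  have [P' oP' sP'] := pm_obstruction_reduce xn0 oP oQ sQP.
  by apply: (IHN x P' Q) => //; rewrite -ltnS (leq_trans _ sPQ)// ltn_add2r.
have xVn0 : x^-1 != 0 by rewrite invr_eq0.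
have oP' : pm_obstruction f x^-1^-1 P by rewrite invrK.
have [Q' oQ' sQ'] := pm_obstruction_reduce xVn0 oQ oP' sPQ'.
by apply: (IHN x P Q') => //; rewrite -ltnS (leq_trans _ sPQ)// ltn_add2l.
Qed.

Lemma pm_dom_or_inv x : x != 0 -> A x \/ A x^-1.
Proof.
move=> xn0.
have [[P oP]|/pm_unobstructed_dom] := pselect (pm_obstructed f x); last by left.
have [[Q oQ]|/pm_unobstructed_dom] := pselect (pm_obstructed f x^-1); last by right.
by case: (@pm_not_both_obstructed x P Q).
Qed.

(** The index s is one where y is largest for the valuation of A, found by comparing the coordinates
    one after the other. *)
Lemma pm_normalize (I : finType) (y : I -> K) : (exists i, y i != 0) ->
  exists2 s, y s != 0 & forall i, A (y i / y s).
Proof.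
move=> [i0 yi0].
suff [s ys sP] : exists2 s, y s != 0 & forall i, i \in enum I -> A (y i / y s).
  by exists s => // i; apply: sP; rewrite mem_enum.
elim: (enum I) => [|j l [s ys sP]]; first by exists i0.
have [yj|yj] := eqVneq (y j) 0.
  exists s => // i; rewrite inE => /predU1P[->|/sP//].
  by rewrite yj mul0r; exact: pm_dom0.
have [||Aj] := @pm_dom_or_inv (y j / y s); first by rewrite mulf_neq0 ?invr_eq0.
  by move=> Aj; exists s => // i; rewrite inE => /predU1P[->|/sP//].
exists j => // i; rewrite inE => /predU1P[->|/sP Ai].
  by rewrite divff //; exact: pm_dom1.
suff -> : y i / y j = y i / y s * (y j / y s)^-1 by exact: pm_domM.
by rewrite invf_div mulrA mulfVK.
Qed.
End Extension.

(** The starting point of the place. An integer can be recovered from its image in K, so reduction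
    to L is well defined on these images whatever the characteristic of L. *)
Lemma pm_characteristic0 (K L : fieldType) :
  [pchar K] =i pred0 -> exists f : pmorph K L, forall z : int, pm_dom f z%:~R.
Proof.
move=> K0.
have inj (z z' : int) : z%:~R = z'%:~R :> K -> z = z'.
  move=> /eqP; rewrite -subr_eq0 -rmorphB /= => /eqP zz.
  apply/eqP; rewrite -subr_eq0; apply/eqP; case: (z - z') zz => n.
    by move/eqP; rewrite -pmulrn ((pcharf0P _).1 K0) => /eqP ->.
  by rewrite NegzE rmorphN /= => /eqP; rewrite oppr_eq0 -pmulrn ((pcharf0P _).1 K0).
pose D (x : K) := exists z : int, x = z%:~R.
pose F (x : K) : L := if pselect (D x) is left e then (projT1 (cid e))%:~R else 0.
have FE z : F z%:~R = z%:~R.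
  rewrite /F; case: pselect => [e|[]]; last by exists z.
  by case: cid => z' /= /inj ->.
have D1 : D 1 by exists 1.
have DB x y : D x -> D y -> D (x - y).
  by move=> [z ->] [z' ->]; exists (z - z'); rewrite rmorphB.
have DM x y : D x -> D y -> D (x * y).
  by move=> [z ->] [z' ->]; exists (z * z'); rewrite rmorphM.
have F1 : F 1 = 1 by rewrite (FE 1).
have FB x y : D x -> D y -> F (x - y) = F x - F y.
  by move=> [z ->] [z' ->]; rewrite -rmorphB !FE rmorphB.
have FM x y : D x -> D y -> F (x * y) = F x * F y.
  by move=> [z ->] [z' ->]; rewrite -rmorphM !FE rmorphM.
by exists (PMorph D1 DB DM F1 FB FM) => z; exists z.
Qed.

(** By homogeneity the point can be rescaled until its coordinates lie in the domain of a maximal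
    partial morphism and one of them is 1; the morphism then carries the equations to L. The index t
    allows equations of different degrees, here a form and its derivatives. *)
Lemma integer_point_reduction (K L : fieldType) (I J : finType) (T : Type)
    (c : T -> J -> int) (M : T -> J -> I -> nat) (dg : T -> nat) (y : I -> K) :
  [pchar K] =i pred0 ->
  (forall P : {poly L}, size P != 1 -> exists w, root P w) ->
  (exists i, y i != 0) ->
  (forall t j, c t j != 0 -> \sum_i M t j i = dg t)%N ->
  (forall t, \sum_j (c t j)%:~R * \prod_i y i ^+ M t j i = 0) ->
  exists z : I -> L, (exists i, z i = 1) /\
   forall t, \sum_j (c t j)%:~R * \prod_i z i ^+ M t j i = 0.
Proof.
move=> K0 closedL y0 Mdg yz.
have [f0 _] := pm_characteristic0 L K0.
have [f maxf] := pm_maximal f0.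
have [s ys sP] := pm_normalize closedL maxf y0.
exists (fun i => pm_fun f (y i / y s)); split.
  by exists s; rewrite divff // pm_fun1.
move=> t.
have dint (z : int) : pm_dom f z%:~R /\ pm_fun f z%:~R = z%:~R.
  case: z => n; first by rewrite -!pmulrn; exact: pm_nat.
  rewrite NegzE !rmorphN /= -!pmulrn; have [A1 f1] := pm_nat f n.+1.
  by rewrite pm_funN // f1; split=> //; exact: pm_domN.
have Aj j : pm_dom f (\prod_i (y i / y s) ^+ M t j i) /\
   pm_fun f (\prod_i (y i / y s) ^+ M t j i) = \prod_i pm_fun f (y i / y s) ^+ M t j i.
  have [|A1 ->] := @pm_prod K L f I (index_enum _) predT (fun i => (y i / y s) ^+ M t j i).
    by move=> i _; exact: (pm_exp _ (sP i)).1.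
  by split=> //; apply: eq_bigr => i _; rewrite (pm_exp _ (sP i)).2.
have [|A1 f1] := @pm_sum K L f J (index_enum _) predT
   (fun j => (c t j)%:~R * \prod_i (y i / y s) ^+ M t j i).
  by move=> j _; apply: pm_domM; [exact: (dint _).1|exact: (Aj _).1].
transitivity (pm_fun f (\sum_j (c t j)%:~R * \prod_i (y i / y s) ^+ M t j i)).
  rewrite f1; apply: eq_bigr => j _.
  by rewrite pm_funM ?(dint _).2 ?(Aj _).2//; [exact: (dint _).1|exact: (Aj _).1].
suff -> : \sum_j (c t j)%:~R * \prod_i (y i / y s) ^+ M t j i = 0 by exact: pm_fun0.
transitivity ((y s)^-1 ^+ dg t * (\sum_j (c t j)%:~R * \prod_i y i ^+ M t j i)); last first.
  by rewrite yz mulr0.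
rewrite mulr_sumr; apply: eq_bigr => j _; have [->|cn0] := eqVneq (c t j) 0.
  by rewrite !mul0r mulr0.
rewrite mulrCA; congr (_ * _); rewrite -(Mdg t j cn0) -prodrXr -big_split /=.
by apply: eq_bigr => i _; rewrite exprMn mulrC.
Qed.

(** * Random signs *)

Section SignProbability.
Variable R : realFieldType.

Definition Pr (I : finType) (P : {ffun I -> bool} -> Prop) : R :=
  #|[pred e | `[< P e >]]|%:R / 2 ^+ #|I|.

Lemma PrE (I : finType) (P : {ffun I -> bool} -> Prop) :
  Pr P = (\sum_e (`[< P e >] : nat)%:R) / 2 ^+ #|I|.
Proof.
rewrite /Pr -sum1_card natr_sum big_mkcond; congr (_ / _).
by apply: eq_bigr => e _; rewrite inE; case: ifP.
Qed.

Lemma exp2_gt0 k : 0 < 2 ^+ k :> R. Proof. by rewrite exprn_gt0 ?ltr0n. Qed.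

Lemma Pr_ge0 (I : finType) (P : {ffun I -> bool} -> Prop) : 0 <= Pr P.
Proof. by rewrite divr_ge0 ?ler0n // ltW ?exp2_gt0. Qed.

Lemma Pr_le (I : finType) (P Q : {ffun I -> bool} -> Prop) :
  (forall e, P e -> Q e) -> Pr P <= Pr Q.
Proof.
move=> PQ; rewrite ler_pM2r ?invr_gt0 ?exp2_gt0 // ler_nat.
apply: subset_leq_card; apply/fintype.subsetP => e; rewrite !inE; exact: PQ.
Qed.

Lemma Pr_True (I : finType) : Pr (fun _ : {ffun I -> bool} => True) = 1.
Proof.
rewrite /Pr (eq_card (B := predT)); last by move=> e; rewrite !inE; apply/asboolP.
by rewrite cardT -cardE card_ffun card_bool natrX divff // gt_eqF ?exp2_gt0.
Qed.

Lemma Pr_le1 (I : finType) (P : {ffun I -> bool} -> Prop) : Pr P <= 1.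
Proof. by rewrite -(Pr_True I); exact: Pr_le. Qed.

Lemma Pr_or (I : finType) (P Q : {ffun I -> bool} -> Prop) :
  Pr (fun e => P e \/ Q e) <= Pr P + Pr Q.
Proof.
rewrite !PrE -mulrDl ler_pM2r ?invr_gt0 ?exp2_gt0 // -big_split /=.
apply: ler_sum => e _; rewrite -natrD ler_nat.
case: (asboolP (P e)) => Pe; case: (asboolP (Q e)) => Qe //=; case: asboolP => //.
by case.
Qed.

Lemma Pr_exists (I : finType) (K : finType) (P : K -> {ffun I -> bool} -> Prop) :
  Pr (fun e => exists k, P k e) <= \sum_k Pr (P k).
Proof.
rewrite PrE (eq_bigr _ (fun k _ => PrE (P k))) -mulr_suml.
rewrite ler_pM2r ?invr_gt0 ?exp2_gt0 // exchange_big /=.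
apply: ler_sum => e _; case: asboolP => [[k Pk]|_]; last by rewrite sumr_ge0.
rewrite (bigD1 k) //= (asboolT Pk) lerDl sumr_ge0 //.
Qed.

Lemma Pr_exists_const (I : finType) (K : finType) (P : K -> {ffun I -> bool} -> Prop) (q
    : R) :
  (forall k, Pr (P k) <= q) -> Pr (fun e => exists k, P k e) <= #|K|%:R * q.
Proof.
move=> Pq; apply: le_trans (Pr_exists _) _; rewrite mulr_natl -sumr_const.
by apply: ler_sum.
Qed.

Lemma Pr_exists_ord (I : finType) k (P : 'I_k -> {ffun I -> bool} -> Prop) (q : R) :
  (forall i, Pr (P i) <= q) -> Pr (fun e => exists i, P i e) <= k%:R * q.
Proof. by rewrite -[X in X%:R](card_ord k); exact: Pr_exists_const. Qed.

Lemma Pr_mem_const (I : finType) (T : eqType) (s : seq T) (P : T -> {ffun I -> bool} ->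
    Prop) (q : R) :
  (forall k, k \in s -> Pr (P k) <= q) ->
  Pr (fun e => exists2 k, k \in s & P k e) <= (size s)%:R * q.
Proof.
move=> Pq; apply: le_trans (_ : Pr (fun e => exists i : 'I_(size s), P (tnth (in_tuple s)
    i) e) <= _).
  apply: Pr_le => e [k ks Pk]; have si : (index k s < size s)%N by rewrite index_mem.
  by exists (Ordinal si); rewrite (tnth_nth k) /= nth_index.
apply: Pr_exists_ord => i.
by apply: Pq; exact: mem_tnth.
Qed.

(** * Conditioning on the signs outside a block *)

Section Conditioning.
Variables (I J : finType) (h : J -> I).
Hypothesis h_inj : injective h.

(** The signs at the indices in the image of h are replaced by d; averaging over d is then the
    conditional expectation given the other signs. *)
Definition resample (e : {ffun I -> bool}) (d : {ffun J -> bool}) : {ffun I -> bool} :=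
  [ffun i => if [pick j | h j == i] is Some j then d j else e i].

Lemma resample_in e d j : resample e d (h j) = d j.
Proof.
rewrite ffunE; case: pickP => [j' /eqP/h_inj ->//|/(_ j)].
by rewrite eqxx.
Qed.

Lemma resample_out e d i : (forall j, h j != i) -> resample e d i = e i.
Proof. by move=> hi; rewrite ffunE; case: pickP => // j; rewrite (negPf (hi j)). Qed.

Lemma sum_resample_split (V : nmodType) (G : bool -> I -> V) e d :
  \sum_i G (resample e d i) i =
  \sum_(i | i \notin codom h) G (e i) i + \sum_j G (d j) (h j).
Proof.
rewrite (bigID (fun i => i \notin codom h)) /=; congr (_ + _).
  apply: eq_bigr => i ih; rewrite resample_out // => j.
  by apply: contraNneq ih => <-; exact: codom_f.
rewrite (eq_bigl (fun i => i \in (h @: finset (fun=> true)))) => [|i]; last first.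
  rewrite negbK; apply/codomP/imsetP => [[j ->]|[j _ ->]]; first by exists j; rewrite
      ?finset.in_set.
  by exists j.
rewrite big_imset /=; last by move=> i j _ _; exact: h_inj.
by apply: eq_big => [j|j _]; [rewrite finset.in_set|rewrite resample_in].
Qed.

(** Exchanging the block of e with d is an involution of the pairs (e, d), and it turns
    [resample e d] into e. *)
Lemma sum_resample (G : {ffun I -> bool} -> R) :
  \sum_e \sum_d G (resample e d) = 2 ^+ #|J| * \sum_e G e.
Proof.
pose s (p : {ffun I -> bool} * {ffun J -> bool}) :=
  (resample p.1 p.2, [ffun j => p.1 (h j)]) : {ffun I -> bool} * {ffun J -> bool}.
have sK : involutive s.
  move=> [e d]; rewrite /s /=; congr (_, _); apply/ffunP.
    move=> i; rewrite ffunE; case: pickP => [j /eqP <-|hi]; first by rewrite ffunE.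
    by rewrite resample_out // => j; rewrite hi.
  by move=> j; rewrite ffunE resample_in.
rewrite (pair_big xpredT xpredT (fun e d => G (resample e d))) /=.
rewrite (reindex_inj (inv_inj sK)) /=.
rewrite -(pair_big xpredT xpredT (fun e d => G (resample (resample e d) [ffun j => e (h
    j)]))) /=.
rewrite mulr_sumr; apply: eq_bigr => e _.
rewrite (eq_bigr (fun=> G e)) => [|d _].
  by rewrite sumr_const card_ffun card_bool -[LHS]mulr_natl natrX.
by have := sK (e, d); rewrite /s /= => -[-> _].
Qed.

(** Q is what P imposes on the signs outside the block. When blocks are treated successively, the
    bounds multiply as for independent events. *)
Lemma Pr_conditioning (P Q : {ffun I -> bool} -> Prop) (q : R) : 0 <= q ->
  (forall e d, P (resample e d) -> Q e) ->
  (forall e, Q e -> Pr (fun d => P (resample e d)) <= q) ->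
  Pr P <= q * Pr Q.
Proof.
move=> q0 PQ Qq; rewrite !PrE mulrA ler_pM2r ?invr_gt0 ?exp2_gt0 //.
rewrite -(ler_pM2l (exp2_gt0 #|J|)) -sum_resample mulrCA !mulr_sumr.
apply: ler_sum => e _; case: (asboolP (Q e)) => Qe.
  have := Qq e Qe; rewrite PrE ler_pdivrMr ?exp2_gt0 // => /le_trans; apply.
  by rewrite mulr1 mulrC.
rewrite mulr0n !mulr0 big1 // => d _.
by case: asboolP => // Pe; case: Qe; exact: PQ Pe.
Qed.

Lemma Pr_pullback (P : {ffun J -> bool} -> Prop) :
  Pr (fun e : {ffun I -> bool} => P [ffun j => e (h j)]) <= Pr P.
Proof.
rewrite -[leRHS]mulr1 -(Pr_True I); apply: Pr_conditioning => //; first exact: Pr_ge0.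
move=> e _; apply: Pr_le => d; congr (P _).
by apply/ffunP => j; rewrite ffunE resample_in.
Qed.
End Conditioning.

Lemma Pr_card (I : finType) (P : {ffun I -> bool} -> Prop) (k : nat) (q : R) :
  (#|[pred e | `[< P e >]]| <= k)%N -> k%:R <= q * 2 ^+ #|I| -> Pr P <= q.
Proof.
by move=> Pk kq; rewrite ler_pdivrMr ?exp2_gt0 //; apply: le_trans kq; rewrite ler_nat.
Qed.
End SignProbability.

(** * Anticoncentration of signed sums in F_p^e *)

Section CentralBinomial.
Local Open Scope nat_scope.

(** This is C(2m, m) <= 4^m / sqrt (2m + 1), squared to stay in the integers; the induction rests on
    (2m + 1)(2m + 3) <= (2m + 2)^2. *)
Lemma central_bin_sqr m : 'C(m.*2, m) ^ 2 * (m.*2.+1) <= 16 ^ m.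
Proof.
elim: m => [|m IHm] //.
have E : 'C(m.+1.*2, m.+1) * m.+1 = 'C(m.*2, m) * (2 * m.*2.+1).
  have := mul_bin_diag m.+1.*2 m; have := mul_bin_down m.*2.+1 m.
  have -> : m.+1.*2 = m.*2.+2 by lia.
  have -> : m.*2.+1 - m = m.+1 by lia.
  by rewrite /=; nia.
have {}IHm : 'C(m.*2, m) ^ 2 * (m.*2.+1) * 4 * (m.*2.+1 * m.*2.+3) <= 16 ^ m * 4 * (4 *
    m.+1 ^ 2).
  by apply: leq_mul; [rewrite leq_mul2r IHm orbT|rewrite expnS expn1; nia].
rewrite -(@leq_pmul2r (m.+1 ^ 2)) ?expn_gt0 //.
have -> : m.+1.*2.+1 = m.*2.+3 by lia.
rewrite mulnAC -expnMn E (expnS 16).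
move: ('C(m.*2, m)) (16 ^ m) IHm => c w; move: (m.*2.+1) (m.*2.+3) (m.+1) => x y t IHm.
apply: leq_trans (_ : w * 4 * (4 * t ^ 2) <= _); last by apply/eq_leq; rewrite -!mulnn;
    ring.
by apply: leq_trans IHm; rewrite -!mulnn; apply/eq_leq; ring.
Qed.

(* The second summand makes the induction on N go through. *)
Lemma sum_multiples_le (a : nat -> nat) (p N : nat) : 0 < p ->
  (forall l, a l.+1 <= a l) ->
  p * (\sum_(1 <= l < N.+1) (p %| l) * a l) + (N %% p) * a N
    <= \sum_(1 <= l < N.+1) a l.
Proof.
move=> p0 amon; elim: N => [|N IHN]; first by rewrite !big_geq // mod0n muln0.
rewrite !(big_nat_recr N.+1) //= mulnDr.
have aN := amon N; have [dv|ndv] := boolP (p %| N.+1).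
  have dv' := dv; rewrite mul1n; have -> : N.+1 %% p = 0 by apply/eqP.
  have pN : p = (N %% p).+1.
    case/dvdnP: dv' => -[|k] // Nk; have -> : N = k * p + p.-1 by lia.
    by rewrite modnMDl modn_small; lia.
  rewrite mul0n addn0.
  apply: (@leq_trans (p * (\sum_(1 <= l < N.+1) (p %| l) * a l) + N %% p * a N + a N.+1)).
    rewrite -addnA leq_add2l {1}pN mulSn addnC leq_add2r leq_mul2l aN orbT //.
  by rewrite leq_add2r.
have -> : N.+1 %% p = (N %% p).+1.
  by have := modn_def; move: ndv; rewrite /dvdn modnS; case: ifP => //; rewrite /dvdn => ->.
rewrite mul0n muln0 addn0 mulSn [a N.+1 + _]addnC addnA leq_add2r.
by apply: leq_trans IHN; rewrite leq_add2l leq_mul2l aN orbT.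
Qed.

(** The indices counted are those congruent to m modulo p. Binomials decrease away from the middle,
    so on each side these take at most 1/p of the total; the middle term is the excess. *)
Lemma sum_bin_multiples_le (p m : nat) : 0 < p ->
  p * (\sum_(j < m.*2.+1) (p %| (if j <= m then m - j else j - m)) * 'C(m.*2, j))
    <= 4 ^ m + p * 'C(m.*2, m).
Proof.
move=> p0; pose a l := 'C(m.*2, m + l).
have amon l : a l.+1 <= a l.
  rewrite /a addnS; have := mul_bin_left m.*2 (m + l).
  by case: ('C(m.*2, (m + l).+1)) => // c; nia.
have key := sum_multiples_le m p0 amon.
pose F j := (p %| (if j <= m then m - j else j - m)) * 'C(m.*2, j).
have split (G : nat -> nat) : \sum_(j < m.*2.+1) G j =
    G m + \sum_(1 <= l < m.+1) G (m - l) + \sum_(1 <= l < m.+1) G (m + l).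
  rewrite -(big_mkord xpredT) (@big_cat_nat _ _ _ m.+1) //=; last lia.
  congr (_ + _).
    rewrite big_nat_rev big_nat_recl //= add0n subn1 /= big_add1 /=.
    by congr (_ + _); apply: eq_big_nat => i im; congr G; lia.
  rewrite -[LHS]/(\sum_(1 + m <= i < m.*2.+1) G i) big_addn.
  have -> : m.*2.+1 - m = m.+1 by lia.
  by apply: eq_bigr => i _; rewrite addnC.
rewrite (split F) [4 ^ m](_ : _ = \sum_(j < m.*2.+1) 'C(m.*2, j)); last first.
  have -> : 4 ^ m = 2 ^ m.*2 by rewrite -mul2n expnM.
  rewrite -[X in X ^ _]/(1 + 1) expnDn.
  by apply: eq_bigr => i _; rewrite !exp1n !muln1.
rewrite (split (fun j => 'C(m.*2, j))).
have F1 : \sum_(1 <= l < m.+1) F (m - l) = \sum_(1 <= l < m.+1) (p %| l) * a l.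
  apply: eq_big_nat => l /andP[l0 lm]; rewrite /F leq_subr /a -bin_sub; last lia.
  by congr (_ * 'C(_, _)); [congr (nat_of_bool (_ %| _))|]; lia.
have F2 : \sum_(1 <= l < m.+1) F (m + l) = \sum_(1 <= l < m.+1) (p %| l) * a l.
  apply: eq_big_nat => l /andP[l0 lm]; rewrite /F /a ifF; last lia.
  by congr (nat_of_bool (_ %| _) * _); lia.
have C1 : \sum_(1 <= l < m.+1) 'C(m.*2, m - l) = \sum_(1 <= l < m.+1) a l.
  by apply: eq_big_nat => l /andP[l0 lm]; rewrite /a -bin_sub; [congr 'C(_, _)|]; lia.
rewrite F1 F2 C1 -/(a _) /F leqnn subnn dvdn0 mul1n -[\sum_(_ <= l < _) 'C(_,
    _)]/(\sum_(1 <= l < m.+1) a l).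
move: key; set x := \sum_(_ <= l < _) _ * _; set y := \sum_(_ <= l < _) a _.
rewrite !mulnDr; lia.
Qed.
End CentralBinomial.

(** * Additive characters of F_p *)

Section Characters.
Local Open Scope ring_scope.
Variables (p : nat) (p_pr : prime p) (p_odd : odd p).
Variable z : algC.
Hypothesis z_prim : p.-primitive_root z.

Let psi (x : 'F_p) : algC := z ^+ x.

Lemma Fp_modulus : (Zp_trunc (pdiv p)).+2 = p.
Proof. exact: Fp_cast. Qed.

Lemma psiD x y : psi (x + y) = psi x * psi y.
Proof.
rewrite /psi -exprD /= -[RHS](prim_expr_mod z_prim); congr (z ^+ (_ %% _)%N).
exact: Fp_modulus.
Qed.

Lemma psi0 : psi 0 = 1. Proof. by rewrite /psi expr0. Qed.

Lemma psi_nat k : psi k%:R = z ^+ k.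
Proof.
rewrite /psi Zp_nat /= -[RHS](prim_expr_mod z_prim); congr (z ^+ (_ %% _)%N).
exact: Fp_modulus.
Qed.

Lemma psi_neq0 x : psi x != 0.
Proof. by rewrite expf_neq0 // (prim_root_eq0 z_prim) -lt0n prime_gt0. Qed.

Lemma psiN x : psi (- x) = (psi x)^-1.
Proof.
by apply: (mulfI (psi_neq0 x)); rewrite -psiD subrr psi0 divff // psi_neq0.
Qed.

Lemma psi_norm x : `|psi x| = 1.
Proof.
rewrite normrX; suff -> : `|z| = 1 by rewrite expr1n.
apply/eqP; rewrite -(@pexpr_eq1 _ _ p) ?prime_gt0 ?normr_ge0 // -normrX.
by rewrite (prim_expr_order z_prim) normr1.
Qed.

Lemma psi_sum (I : finType) (F : I -> 'F_p) :
  psi (\sum_i F i) = \prod_i psi (F i).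
Proof. by apply: (big_morph psi psiD psi0). Qed.

Lemma psi1_neq1 : psi 1 != 1.
Proof.
rewrite -[1]/(1%:R) psi_nat -(prim_order_dvd z_prim) dvdn1.
by case: (p) p_pr => [|[|]].
Qed.

Lemma psi_orthogonality e (v : 'rV['F_p]_e) :
  \sum_(u : 'cV['F_p]_e) psi ((v *m u) 0 0) = (p ^ e)%:R *+ (v == 0).
Proof.
have [->|vn0] := eqVneq v 0.
  rewrite (eq_bigr (fun=> 1)) => [|u _]; last by rewrite mul0mx mxE psi0.
  by rewrite sumr_const card_mx card_Fp // muln1.
have [k vk] : exists k, v 0 k != 0.
  apply/existsP; rewrite -negb_forall; apply: contraNN vn0 => /forallP v0.
  by apply/eqP/rowP => k; rewrite mxE; apply/eqP/v0.
pose u0 : 'cV['F_p]_e := (v 0 k)^-1 *: delta_mx k 0.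
have vu0 : (v *m u0) 0 0 = 1.
  by rewrite -scalemxAr -colE !mxE mulVf.
have : psi 1 * \sum_(u : 'cV['F_p]_e) psi ((v *m u) 0 0) = \sum_(u : 'cV['F_p]_e) psi ((v
    *m u) 0 0).
  rewrite mulr_sumr [RHS](reindex_inj (addrI u0)) /=; apply: eq_bigr => u _.
  have -> : (v *m (u0 + u)) 0 0 = (v *m u0) 0 0 + (v *m u) 0 0 by rewrite mulmxDr mxE.
  by rewrite psiD vu0.
move=> /eqP; rewrite -subr_eq0 -{2}[\sum_u _]mul1r -mulrBl mulf_eq0 subr_eq0.
by rewrite (negPf psi1_neq1) => /eqP ->; rewrite mulr0n.
Qed.

(** This is 2 |cos t| if psi x = exp (i t): the modulus of the sum of psi over the two signs of
    x. *)
Let g x : algC := `|psi x + psi (- x)|.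

Lemma psi_orthogonality1 (a : 'F_p) : \sum_x psi (a * x) = p%:R *+ (a == 0).
Proof.
have [->|an0] := eqVneq a 0.
  rewrite (eq_bigr (fun=> 1)) => [|u _]; last by rewrite mul0r psi0.
  by rewrite sumr_const card_Fp.
have : psi 1 * \sum_x psi (a * x) = \sum_x psi (a * x).
  rewrite mulr_sumr [RHS](reindex_inj (addrI a^-1)) /=; apply: eq_bigr => u _.
  by rewrite mulrDr psiD divff.
move=> /eqP; rewrite -subr_eq0 -{2}[\sum_u _]mul1r -mulrBl mulf_eq0 subr_eq0.
by rewrite (negPf psi1_neq1) => /eqP ->; rewrite mulr0n.
Qed.

Lemma psi_real x : `|psi x + psi (- x)| ^+ 2 = (psi x + psi (- x)) ^+ 2.
Proof.
have conjpsi y : (psi y)^* = psi (- y).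
  by rewrite psiN invC_norm psi_norm expr1n invr1 mul1r.
by rewrite normCK rmorphD /= !conjpsi opprK expr2 [psi (- x) + _]addrC.
Qed.

Lemma psi_moment m : \sum_x g x ^+ m.*2 =
  (p * (\sum_(j < m.*2.+1) (p %| (if (j <= m)%N then m - j else j - m)) * 'C(m.*2, j)))%:R.
Proof.
pose a (j : nat) : 'F_p := (m.*2 - j)%:R - j%:R.
transitivity (\sum_(j < m.*2.+1) \sum_x psi (a j * x) *+ 'C(m.*2, j)).
  rewrite exchange_big; apply: eq_bigr => x _.
  rewrite -mul2n exprM psi_real -exprM mul2n exprDn; apply: eq_bigr => j _.
  congr (_ *+ _).
  have psiX y k : psi y ^+ k = psi (y *+ k).
    by elim: k => [|k IHk]; rewrite ?expr0 ?mulr0n ?psi0 // exprS IHk mulrS psiD.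
  by rewrite !psiX -psiD mulNrn -[x *+ (_ - _)]mulr_natr -[x *+ j]mulr_natr -mulrBr mulrC.
rewrite natrM natr_sum mulr_sumr; apply: eq_bigr => -[j /= jm] _.
rewrite sumrMnl psi_orthogonality1 -mulrnA -[LHS]mulr_natr.
congr (_ * (nat_of_bool _ * _)%:R).
have a0 k : (k.*2%:R == 0 :> 'F_p) = (p %| k)%N.
  rewrite -(dvdn_pcharf (pchar_Fp p_pr)) -mul2n Gauss_dvdr //.
  by rewrite coprimen2.
case: ifP => jm'.
  by rewrite /a -natrB; [rewrite -a0; congr (_%:R == _)|]; lia.
rewrite /a -opprB oppr_eq0 -natrB; [rewrite -a0; congr (_%:R == _)|]; lia.
Qed.

(** [kappa] bounds p / sqrt (2m + 1), so that the excess p C(2m, m) of the middle term is at most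
    kappa 4^m. *)
Lemma psi_moment_le m kappa : (p ^ 2 <= kappa ^ 2 * m.*2.+1)%N ->
  \sum_x g x ^+ m.*2 <= ((kappa.+1) * 4 ^ m)%:R.
Proof.
move=> pm; rewrite psi_moment ler_nat; apply: leq_trans (sum_bin_multiples_le m
    (prime_gt0 p_pr)) _.
rewrite mulSn leq_add2l; set C := 'C(_, _).
rewrite -(@leq_exp2r _ _ 2) // -(@leq_pmul2r m.*2.+1) //.
have : (p ^ 2 * (C ^ 2 * m.*2.+1) <= (kappa ^ 2 * m.*2.+1) * 16 ^ m)%N.
  by apply: leq_mul => //; exact: central_bin_sqr.
have -> : (16 ^ m = (4 ^ m) ^ 2)%N by rewrite -expnM mulnC expnM.
by move=> H; rewrite !expnMn -mulnA; apply: leq_trans H _; rewrite mulnAC.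
Qed.

(** The indicator of the value c is expanded in characters, and the sum over the signs factors into
    a product over the terms. *)
Lemma sign_sums_psi (T e : nat) (M : 'I_T -> 'M['F_p]_e) (c : 'rV['F_p]_e) :
  (#|[pred dl : {ffun 'I_T * 'I_e -> bool} |
      \sum_(tk : 'I_T * 'I_e) (-1) ^+ dl tk *: row tk.2 (M tk.1) == c]|%:R * (p ^ e)%:R :
          algC)
  <= \sum_(u : 'cV['F_p]_e) \prod_t \prod_k g ((M t *m u) k 0).
Proof.
set N := #|_|.
pose S (dl : {ffun 'I_T * 'I_e -> bool}) := \sum_(tk : 'I_T * 'I_e) (-1) ^+ dl tk *: row
    tk.2 (M tk.1).
have -> : N%:R * (p ^ e)%:R = \sum_dl \sum_(u : 'cV['F_p]_e) psi (((S dl - c) *m u) 0 0).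
  under eq_bigr do rewrite psi_orthogonality subr_eq0.
  rewrite mulr_natl sumrMnr; congr (_ *+ _).
  by rewrite /N -sum1_card big_mkcond; apply: eq_bigr => dl _; rewrite inE; case: ifP.
rewrite exchange_big /=.
have E (u : 'cV['F_p]_e) : \sum_dl psi (((S dl - c) *m u) 0 0) =
    psi (- (c *m u) 0 0) * \prod_(tk : 'I_T * 'I_e)
      (psi ((M tk.1 *m u) tk.2 0) + psi (- (M tk.1 *m u) tk.2 0)).
  transitivity (\sum_(dl : {ffun 'I_T * 'I_e -> bool}) psi (- (c *m u) 0 0) *
     \prod_tk psi ((-1) ^+ dl tk * (M tk.1 *m u) tk.2 0)).
    apply: eq_bigr => dl _.
    have -> : ((S dl - c) *m u) 0 0 = - (c *m u) 0 0 + (S dl *m u) 0 0.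
      by rewrite mulmxBl !mxE addrC.
    rewrite psiD; congr (_ * _); rewrite /S mulmx_suml summxE psi_sum.
    apply: eq_bigr => tk _; rewrite -scalemxAl mxE; congr (psi (_ * _)).
    by rewrite -row_mul mxE.
  rewrite -mulr_sumr -(bigA_distr_bigA (fun (tk : 'I_T * 'I_e) (b : bool) => psi ((-1) ^+
      b * (M tk.1 *m u) tk.2 0))).
  congr (_ * _); apply: eq_bigr => tk _.
  by rewrite big_bool /= expr1 expr0 mulN1r mul1r addrC.
(* This sum is N p^e, hence equal to its modulus; the triangle inequality then drops the phase
   depending on c. *)
have -> : \sum_(u : 'cV['F_p]_e) \sum_dl psi (((S dl - c) *m u) 0 0) = `|\sum_(u :
    'cV['F_p]_e) \sum_dl psi (((S dl - c) *m u) 0 0)|.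
  rewrite exchange_big ger0_norm //; apply: sumr_ge0 => dl _.
  by rewrite psi_orthogonality mulrn_wge0 ?ler0n.
apply: le_trans (ler_norm_sum _ _ _) _; apply: ler_sum => u _.
rewrite E normrM psi_norm mul1r normr_prod.
by rewrite (pair_big xpredT xpredT (fun t k => g ((M t *m u) k 0))).
Qed.

Lemma sum_cV_prod e (h : 'F_p -> algC) :
  \sum_(u : 'cV['F_p]_e) \prod_k h (u k 0) = (\sum_x h x) ^+ e.
Proof.
rewrite -[in RHS](card_ord e) -prodr_const (bigA_distr_bigA (fun (_ : 'I_e) x => h x)).
pose toM (f : {ffun 'I_e -> 'F_p}) : 'cV['F_p]_e := \col_k f k.
rewrite (reindex toM) /=; last first.
  exists (fun u : 'cV['F_p]_e => [ffun k => u k 0]) => u _.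
    by apply/ffunP => k; rewrite ffunE mxE.
  by apply/matrixP => k j; rewrite mxE ffunE ord1.
by apply: eq_bigr => f _; apply: eq_bigr => k _; rewrite mxE.
Qed.

Lemma sign_sums_hoelder (T e : nat) (M : 'I_T -> 'M['F_p]_e) : (0 < T)%N ->
  (forall t, M t \in unitmx) ->
  \sum_(u : 'cV['F_p]_e) \prod_t \prod_k g ((M t *m u) k 0) <= (\sum_x g x ^+ T) ^+ e.
Proof.
move=> T0 Mu; have T0' : 0 < T%:R :> algC by rewrite ltr0n.
pose H t (u : 'cV['F_p]_e) : algC := \prod_k g ((M t *m u) k 0).
have H0 t u : 0 <= H t u by apply: prodr_ge0 => k _; exact: normr_ge0.
(* Hoelder's inequality for T factors, from the AM-GM inequality for the T-th
   powers; the sum over u of each of these does not depend on t. *)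
have agm u : \prod_t H t u <= (\sum_t H t u ^+ T) / T%:R.
  rewrite -(@ler_pXn2r _ T) ?nnegrE //; last 2 first.
  - by apply: prodr_ge0.
  - by rewrite divr_ge0 ?ler0n // sumr_ge0 // => t _; rewrite exprn_ge0.
  rewrite -prodrXl.
  have := @leif_AGM _ 'I_T predT (fun t => H t u ^+ T) (fun t _ => exprn_ge0 _ (H0 t u)).
  by rewrite card_ord => /leifP; case: ifP => [_ /eqP ->//|_ /ltW].
apply: le_trans (ler_sum _ (fun u _ => agm u)) _.
rewrite -mulr_suml exchange_big /= ler_pdivrMr // mulr_natr.
rewrite -[X in _ *+ X](card_ord T) -sumr_const; apply: ler_sum => t _.
rewrite -(sum_cV_prod e (fun x => g x ^+ T)).
rewrite [leRHS](reindex_inj (can_inj (mulKmx (Mu t)))) /=.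
by apply: ler_sum => u _; rewrite /H -prodrXl.
Qed.
End Characters.

Lemma sign_sums_le (p : nat) (T e m kappa : nat) (M : 'I_T -> 'M['F_p]_e) (c :
    'rV['F_p]_e) :
  prime p -> odd p -> (0 < m)%N -> T = m.*2 -> (p ^ 2 <= kappa ^ 2 * m.*2.+1)%N ->
  (forall t, M t \in unitmx) ->
  (#|[pred dl : {ffun 'I_T * 'I_e -> bool} |
      \sum_(tk : 'I_T * 'I_e) (-1) ^+ dl tk *: row tk.2 (M tk.1) == c]%R| * p ^ e
   <= kappa.+1 ^ e * 2 ^ (T * e))%N.
Proof.
move=> p_pr p_odd m0 Tm pm Mu.
have [z z_prim] := C_prim_root_exists (prime_gt0 p_pr).
rewrite -(ler_nat algC) natrM; apply: le_trans (sign_sums_psi p_pr z_prim M c) _.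
apply: le_trans (sign_sums_hoelder _ _ Mu) _; first by rewrite Tm double_gt0.
rewrite expnM -expnMn natrX lerXn2r ?nnegrE ?ler0n //.
  by apply: sumr_ge0 => x _; rewrite exprn_ge0.
by rewrite Tm -mul2n expnM mul2n; exact: psi_moment_le.
Qed.

(** * Algebraic dependence of polynomial functions *)

Lemma linear_dependence (F : fieldType) (G H : finType) (C : G -> H -> F) :
  (#|H| < #|G|)%N ->
  exists phi : G -> F, (exists g, phi g != 0) /\ forall h, \sum_g phi g * C g h = 0.
Proof.
move=> HG; pose A := \matrix_(i < #|G|, j < #|H|) C (enum_val i) (enum_val j).
have kn0 : kermx A != 0.
  rewrite -mxrank_eq0 mxrank_ker subn_eq0 -ltnNge.
  exact: leq_ltn_trans (rank_leq_col A) HG.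
have [i0 ri0] : exists i, row i (kermx A) != 0.
  apply/existsP; rewrite -negb_forall; apply: contraNN kn0 => /forallP k0.
  by apply/eqP/row_matrixP => i; rewrite row0; apply/eqP; exact: k0.
exists (fun g => kermx A i0 (enum_rank g)); split.
  have /existsP[j kj] : [exists j, kermx A i0 j != 0].
    rewrite -negb_forall; apply: contraNN ri0 => /forallP k0.
    by apply/eqP/rowP => j; apply/eqP; move: (k0 j); rewrite !mxE.
  by exists (enum_val j); rewrite enum_valK.
move=> h; have : (kermx A *m A) i0 (enum_rank h) = 0 by rewrite mulmx_ker mxE.
rewrite mxE (reindex (@enum_rank G)) /=; last first.
  by exists enum_val => x _; rewrite ?enum_rankK ?enum_valK.
by move=> E; rewrite -[RHS]E; apply: eq_bigr => g _; congr (_ * _); rewrite mxE !enum_rankK.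
Qed.

Section PolynomialFunctions.
Variables (F : fieldType) (r : nat).
Implicit Types (y : 'I_r -> F) (f g : ('I_r -> F) -> F).

(** Only values matter, so a polynomial is represented by its function. D bounds the exponent of
    each variable separately, not the total degree. *)
Definition polyfun D f := exists C : {ffun 'I_r -> 'I_D.+1} -> F,
  forall y, f y = \sum_m C m * \prod_i y i ^+ m i.

Lemma polyfun_sum_monomials D (I : finType) (c : I -> F) (a : I -> 'I_r -> nat) :
  (forall k i, a k i <= D)%N ->
  polyfun D (fun y => \sum_k c k * \prod_i y i ^+ a k i).
Proof.
move=> aD; pose s k : {ffun 'I_r -> 'I_D.+1} := [ffun i => inord (a k i)].
exists (fun m => \sum_(k | s k == m) c k) => y.
rewrite (partition_big s xpredT) //=; apply: eq_bigr => m _.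
rewrite mulr_suml; apply: eq_bigr => k /eqP <-; congr (_ * _).
by apply: eq_bigr => i _; rewrite ffunE inordK // ltnS.
Qed.

Lemma polyfun_le D D' f : (D <= D')%N -> polyfun D f -> polyfun D' f.
Proof.
move=> DD' [C fC].
have [i m|C' C'P] := @polyfun_sum_monomials D' _ C (fun m i => m i).
  by apply: leq_trans DD'; rewrite -ltnS.
by exists C' => y; rewrite fC C'P.
Qed.

Lemma polyfun1 : polyfun 0 (fun=> 1).
Proof.
have [|C CP] := @polyfun_sum_monomials 0 unit (fun=> 1) (fun _ _ => 0%N); first by [].
by exists C => y; rewrite -CP (big_pred1 tt) /= ?mul1r ?big1 // => -[].
Qed.

Lemma polyfun_var i : polyfun 1 (fun y => y i).
Proof.
have [|C CP] := @polyfun_sum_monomials 1 unit (fun=> 1) (fun _ k => (k == i) : nat).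
  by move=> _ k; case: eqP.
exists C => y; rewrite -CP (big_pred1 tt) /=; last by case.
rewrite mul1r (bigD1 i) //= eqxx expr1 big1 ?mulr1 // => k /negPf ->.
by rewrite expr0.
Qed.

Lemma polyfunM D1 D2 f g : polyfun D1 f -> polyfun D2 g ->
  polyfun (D1 + D2) (fun y => f y * g y).
Proof.
move=> [C fC] [C' gC'].
have [[m m'] i|C'' CP] := @polyfun_sum_monomials (D1 + D2) _
   (fun p => C p.1 * C' p.2) (fun p i => p.1 i + p.2 i)%N.
  by rewrite /= leq_add // -ltnS.
exists C'' => y; rewrite -CP fC gC' big_distrlr /=.
rewrite (pair_big xpredT xpredT (fun m m' => C m * _ * (C' m' * _))) /=.
apply: eq_bigr => p _; rewrite mulrACA -big_split /=; congr (_ * _).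
by apply: eq_bigr => i _; rewrite exprD.
Qed.

Lemma polyfunX D f k : polyfun D f -> polyfun (D * k) (fun y => f y ^+ k).
Proof.
move=> fD; elim: k => [|k IHk]; first by rewrite muln0; exact: polyfun1.
rewrite mulnS; have [C CP] := polyfunM fD IHk.
by exists C => y; rewrite exprS CP.
Qed.

Lemma polyfun_prod (J : Type) (s : seq J) D (f : J -> ('I_r -> F) -> F) :
  (forall j, polyfun D (f j)) ->
  polyfun (D * size s) (fun y => \prod_(j <- s) f j y).
Proof.
move=> fD; elim: s => [|j s IHs].
  rewrite muln0; have [C CP] := polyfun1.
  by exists C => y; rewrite big_nil -CP.
rewrite /= mulnS; have [C CP] := polyfunM (fD j) IHs.
by exists C => y; rewrite big_cons CP.
Qed.

(** With this E, the (D + 1)^r monomials that can occur, where D + 1 <= (r + 2)(d + 1) E, are fewer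
    than the E^(r + 1) unknown coefficients of the relation. *)
Definition perron_bound d := ((r.+2 * d.+1) ^ r).+1.

(* A nonzero polynomial relation between y_j0 and the A_i / y_i; denominators are
   cleared by the factors y_i^E.  It exists because there are more monomials in
   r + 1 variables of exponents < E than monomials in r variables of exponents
   O(d E). *)
Lemma perron_relation d (A : 'I_r -> ('I_r -> F) -> F) (j0 : 'I_r) :
  let E := perron_bound d in
  (forall i, polyfun d (A i)) ->
  exists phi : 'I_E * {ffun 'I_r -> 'I_E} -> F, (exists ga, phi ga != 0) /\
   forall y, \sum_ga phi ga * (y j0 ^+ ga.1 *
     \prod_i (A i y ^+ ga.2 i * y i ^+ (E - ga.2 i))) = 0.
Proof.
move=> E Ad; pose D := (E + (d * E + E) * r)%N.
have PD (ga : 'I_E * {ffun 'I_r -> 'I_E}) : polyfun D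
    (fun y => y j0 ^+ ga.1 * \prod_i (A i y ^+ ga.2 i * y i ^+ (E - ga.2 i))).
  apply: polyfunM.
    by have := polyfunX ga.1 (polyfun_var j0); apply: polyfun_le; rewrite mul1n ltnW.
  have sr : size (index_enum 'I_r) = r by rewrite /index_enum -enumT size_enum_ord.
  rewrite -[X in (_ * X)%N]sr.
  apply: (@polyfun_prod 'I_r _ _ (fun i y => A i y ^+ ga.2 i * y i ^+ (E - ga.2 i))) => i.
  apply: polyfunM.
    have := polyfunX (ga.2 i) (Ad i); apply: polyfun_le.
    by rewrite leq_mul2l ltnW ?orbT.
  by have := polyfunX (E - ga.2 i) (polyfun_var i); apply: polyfun_le; rewrite mul1n
      leq_subr.
have [C CP] := fin_all_exists PD.
have [|phi [phi0 phiC]] := linear_dependence C.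
  rewrite card_prod !card_ffun !card_ord -expnS.
  have DE : (D < r.+2 * d.+1 * E)%N.
    by rewrite /D; have : (0 < E)%N by []; move: (E) => e; nia.
  apply: (@leq_ltn_trans ((r.+2 * d.+1 * E) ^ r)).
    by have [->|r0] := posnP r; rewrite ?expn0 // leq_exp2r.
  by rewrite expnMn expnS ltn_pmul2r ?expn_gt0 //; left.
exists phi; split=> // y; under eq_bigr do rewrite CP mulr_sumr.
rewrite exchange_big big1 //= => m _; under eq_bigr do rewrite mulrA.
by rewrite -mulr_suml phiC mul0r.
Qed.

End PolynomialFunctions.

(** * The Schwartz-Zippel lemma *)

Section FfunCons.
Variables (X : finType) (r : nat).

Definition fcons (x : X) (u : {ffun 'I_r -> X}) : {ffun 'I_r.+1 -> X} :=
  [ffun i => if unlift ord0 i is Some j then u j else x].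

Lemma fcons0 x u : fcons x u ord0 = x.
Proof. by rewrite ffunE unlift_none. Qed.

Lemma fconsS x u j : fcons x u (lift ord0 j) = u j.
Proof. by rewrite ffunE liftK. Qed.

Lemma fcons_split (f : {ffun 'I_r.+1 -> X}) :
  f = fcons (f ord0) [ffun j => f (lift ord0 j)].
Proof.
apply/ffunP => i; case: (unliftP ord0 i) => [j ->|->]; rewrite ?fcons0 //.
by rewrite fconsS ffunE.
Qed.

Lemma sum_fcons (V : nmodType) (G : {ffun 'I_r.+1 -> X} -> V) :
  \sum_f G f = \sum_x \sum_u G (fcons x u).
Proof.
rewrite (pair_big xpredT xpredT (fun x u => G (fcons x u))) /=.
rewrite (reindex (fun p : X * {ffun 'I_r -> X} => fcons p.1 p.2)) //.
exists (fun f : {ffun 'I_r.+1 -> X} => (f ord0, [ffun j => f (lift ord0 j)])) => [[x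
    u]|f] _ /=.
  by rewrite fcons0; congr (_, _); apply/ffunP => j; rewrite ffunE fconsS.
by rewrite -fcons_split.
Qed.
End FfunCons.

(** A uniform u gives a zero with probability at most r E / #|X|. Some coefficient with respect to
    the first variable is a nonzero polynomial in the others and vanishes rarely by induction; where
    it does not vanish, there are fewer than E roots. *)
Lemma schwartz_zippel (A : idomainType) (X : finType) (v : X -> A) (E r : nat)
    (phi : {ffun 'I_r -> 'I_E} -> A) :
  injective v -> (exists g, phi g != 0) ->
  (#|[pred u : {ffun 'I_r -> X} | (\sum_g phi g * \prod_i v (u i) ^+ g i == 0)%R]| * #|X|
    <= r * E * #|X| ^ r)%N.
Proof.
move=> v_inj; elim: r phi => [|r IHr] phi [g0 phig0].
  rewrite !mul0n leqn0 muln_eq0; apply/orP; left; apply/eqP/eq_card0 => u.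
  rewrite !inE; apply/negbTE; have all0 (g : {ffun 'I_0 -> 'I_E}) : g = g0.
    by apply/ffunP => -[].
  rewrite (big_pred1 g0) => [|g]; last by rewrite /= (all0 g) eqxx.
  by rewrite big_ord0 mulr1.
pose k0 := g0 ord0; pose c k (u : {ffun 'I_r -> X}) :=
  \sum_(g : {ffun 'I_r -> 'I_E}) phi (fcons k g) * \prod_i v (u i) ^+ g i.
have cE x u : \sum_g phi g * \prod_i v (fcons x u i) ^+ g i = \sum_k c k u * v x ^+ (k :
    'I_E).
  rewrite sum_fcons; apply: eq_bigr => k _; rewrite mulr_suml; apply: eq_bigr => g _.
  rewrite big_ord_recl !fcons0 [v x ^+ k * _]mulrC mulrA; congr (_ * _ * _).
  by apply: eq_bigr => i _; rewrite !fconsS.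
have IH := IHr (fun g => phi (fcons k0 g)) (ex_intro _ [ffun j => g0 (lift ord0 j)] _).
have {IH} /IH : phi (fcons k0 [ffun j => g0 (lift ord0 j)]) != 0 by rewrite /k0
    -fcons_split.
rewrite -/(c k0 _); set N0 := #|_| => IHN.
set N := #|_|.
have -> : N = (\sum_(u : {ffun 'I_r -> X}) #|[pred x | \sum_k c k u * v x ^+ (k : 'I_E)
    == 0]%R|)%N.
  rewrite /N -sum1_card big_mkcond sum_fcons exchange_big /=; apply: eq_bigr => u _.
  by rewrite -sum1_card [RHS]big_mkcond /=; apply: eq_bigr => x _; rewrite !inE cE.
have Nu u : (#|[pred x | \sum_k c k u * v x ^+ (k : 'I_E) == 0]%R| <= #|X| * (c k0 u ==
    0%R) + E)%N.
  have [c0|cn0] := eqVneq (c k0 u) 0.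
    by rewrite muln1 (leq_trans (max_card _)) // leq_addr.
  rewrite muln0 add0n; pose P := \poly_(k < E) (if insub k is Some k' then c k' u else 0).
  have PE x : P.[v x] = \sum_k c k u * v x ^+ (k : 'I_E).
    by rewrite horner_poly; apply: eq_bigr => k _; rewrite valK.
  have Pn0 : P != 0.
    apply: contraNneq cn0 => P0; have : P`_k0 = 0 by rewrite P0 coef0.
    by rewrite coef_poly ltn_ord valK => ->.
  apply: leq_trans (size_poly E _ : (size P <= E)%N).
  rewrite cardE -(size_map v) ltnW //; apply: max_poly_roots => //.
    by apply/allP => _ /mapP[x + ->]; rewrite mem_enum inE -PE.
  by rewrite map_inj_uniq // enum_uniq.
apply: leq_trans (_ : (\sum_(u : {ffun 'I_r -> X}) (#|X| * (c k0 u == 0%R) + E)) * #|X|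
    <= _)%N.
  by rewrite leq_mul2r leq_sum ?orbT.
rewrite big_split /= -big_distrr /= sum_nat_const card_ffun card_ord.
have -> : (\sum_(u : {ffun 'I_r -> X}) (c k0 u == 0%R) = N0)%N.
  by rewrite /N0 -sum1_card [RHS]big_mkcond /=; apply: eq_bigr => u _; rewrite inE; case:
      ifP.
move: IHN; rewrite expnS; move: (#|X| ^ r)%N (#|X|) => a b; nia.
Qed.

(** * Points of large degree *)

Notation mon r d := {a : {ffun 'I_r -> 'I_d.+1} | (\sum_i a i <= d)%N}.

Section Monomials.
Variables (r d : nat).

Definition expo (m : mon r d) (i : 'I_r) : nat := val m i.

Lemma mon_subproof : (\sum_i ([ffun=> ord0] : {ffun 'I_r -> 'I_d.+1}) i <= d)%N.
Proof. by rewrite big1 // => i _; rewrite ffunE. Qed.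

(* The constant monomial when a has degree larger than d. *)
Definition mon_of (a : 'I_r -> nat) : mon r d :=
  insubd (exist (fun a : {ffun 'I_r -> 'I_d.+1} => is_true (\sum_i a i <= d)%N)
    [ffun=> ord0] mon_subproof) [ffun i => inord (a i)].

Lemma mon_ofE a i : (\sum_i a i <= d)%N -> expo (mon_of a) i = a i.
Proof.
move=> ad; have aid j : (a j <= d)%N by apply: leq_trans ad; rewrite (bigD1 j) //= leq_addr.
rewrite /expo /mon_of insubdK; first by rewrite ffunE inordK // ltnS.
rewrite -[_ \in _]/(_ <= _)%N; apply: leq_trans ad; apply: leq_sum => j _.
by rewrite ffunE inordK // ltnS.
Qed.

Lemma expo_le m i : (expo m i <= d)%N.
Proof. by rewrite -ltnS ltn_ord. Qed.

End Monomials.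

Lemma size_mul_le1 (A : idomainType) (P Q : {poly A}) a b c :
  (size P <= a.+1)%N -> (size Q <= b.+1)%N -> (a + b <= c)%N -> (size (P * Q)%R <= c.+1)%N.
Proof.
move=> sP sQ abc; apply: leq_trans (size_polyMleq _ _) _.
by move: (size P) (size Q) sP sQ => x y; lia.
Qed.

Lemma size_exp_le1 (A : idomainType) (P : {poly A}) a k :
  (size P <= a.+1)%N -> (size (P ^+ k)%R <= (a * k).+1)%N.
Proof.
move=> sP; apply: leq_trans (size_poly_exp_leq _ _) _.
by rewrite ltnS leq_mul2r; apply/orP; right; lia.
Qed.

Lemma size_prod_le1 (A : idomainType) (I : finType) (P : I -> {poly A}) a :
  (forall i, size (P i) <= a.+1)%N -> (size (\prod_i P i)%R <= (#|I| * a).+1)%N.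
Proof.
move=> sP; apply: leq_trans (size_poly_prod_leq _ _) _.
have : (\sum_i size (P i) <= #|I| * a.+1)%N.
  by rewrite -sum_nat_const; apply: leq_sum.
rewrite (_ : #|(fun=> true) : pred I| = #|I|); last exact: eq_card.
by rewrite mulnS; lia.
Qed.

Section Model.
Variables (Om : fieldType) (r d : nat).
Implicit Types (e : {ffun mon r d -> bool}) (y : 'I_r -> Om).

Definition Fval e y : Om := \sum_m (-1) ^+ e m * \prod_i y i ^+ expo m i.

(* The value of y_l d_l F, with which d_l F shares its zeros on the torus. *)
Definition Lval e (l : 'I_r) y : Om :=
  \sum_m (-1) ^+ e m * (expo m l)%:R * \prod_i y i ^+ expo m i.

Definition torus y := forall i, y i != 0.

End Model.

(** * Frobenius, and polynomials with sign coefficients *)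

Section SignSums.
Variables (p : nat) (p_odd : odd p) (Om : fieldType).
Hypothesis pOm : p \in [pchar Om].

Lemma sign_expp (A : comNzRingType) (b : bool) : ((-1) ^+ b : A) ^+ p = (-1) ^+ b.
Proof. by case: b; rewrite ?expr0 ?expr1n // expr1 -signr_odd p_odd expr1. Qed.

Lemma frobenius_sum (A : comNzRingType) (pA : p \in [pchar A]) (I : finType) (F : I -> A) :
  (\sum_i F i) ^+ p = \sum_i F i ^+ p.
Proof.
by rewrite -(pFrobenius_autE pA) rmorph_sum.
Qed.

Lemma frobenius_sign_sum (A : comNzRingType) (pA : p \in [pchar A]) (I : finType)
    (b : I -> bool) (F : I -> A) :
  (\sum_i (-1) ^+ b i * F i) ^+ p = \sum_i (-1) ^+ b i * F i ^+ p.
Proof.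
rewrite frobenius_sum //; apply: eq_bigr => i _.
by rewrite exprMn sign_expp.
Qed.

Lemma frobenius_inj (A : idomainType) : p \in [pchar A] -> injective (fun x : A => x ^+ p).
Proof.
move=> pA x y /= xy; apply/eqP; rewrite -subr_eq0.
have : (x - y) ^+ p = x ^+ p - y ^+ p by rewrite -!(pFrobenius_autE pA) rmorphB.
by rewrite xy subrr => /eqP; rewrite expf_eq0 => /andP[].
Qed.

Lemma two_neq0 : 2%:R != 0 :> Om.
Proof.
rewrite -(dvdn_pcharf pOm); apply: contraL p_odd => /(dvdn_leq (ltn0Sn 1)).
have := prime_gt1 (pcharf_prime pOm); case: (p) => [|[|[|]]] //.
Qed.

Lemma sign_inj (b c : bool) : (-1) ^+ b = (-1) ^+ c :> Om -> b = c.
Proof.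
have n : (-1 : Om) != 1 by rewrite eq_sym -subr_eq0 opprK two_neq0.
by case: b c => [] [] //=; rewrite expr0 expr1 => /eqP; rewrite ?(negPf n) // eq_sym
    (negPf n).
Qed.

Definition sign_poly M (u : {ffun 'I_M -> bool}) : {poly Om} := \poly_(k < M) (if insub k
    is Some k' then (-1) ^+ u k' else 0).

Lemma sign_poly_horner M (u : {ffun 'I_M -> bool}) x :
  (sign_poly u).[x] = \sum_k (-1) ^+ u k * x ^+ (k : 'I_M).
Proof. by rewrite horner_poly; apply: eq_bigr => k _; rewrite valK. Qed.

Lemma sign_poly_inj M : injective (@sign_poly M).
Proof.
move=> u v uv; apply/ffunP => k; apply: sign_inj.
have : (sign_poly u)`_k = (sign_poly v)`_k by rewrite uv.
by rewrite !coef_poly ltn_ord valK.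
Qed.

Lemma size_sign_poly M (u : {ffun 'I_M -> bool}) : (size (sign_poly u) <= M)%N.
Proof. exact: size_poly. Qed.

(** These are the 2^M values fed to the Schwartz-Zippel lemma over the domain Om[X]: its unknowns
    will be the polynomials - g_i^p. *)
Lemma sign_frob_inj M : injective (fun u : {ffun 'I_M -> bool} => - sign_poly u ^+ p).
Proof.
move=> u v /oppr_inj /frobenius_inj; rewrite pchar_poly => /(_ pOm).
exact: sign_poly_inj.
Qed.
End SignSums.

(** * Elimination, and points with a coordinate of large degree *)

Section High.
Variables (R : realFieldType) (p : nat) (p_odd : odd p) (Om : fieldType).
Hypothesis pOm : p \in [pchar Om].
Variables (r d M : nat).
Hypothesis pM : (p * M <= d)%N.

Let p_pr : prime p := pcharf_prime pOm.

(* The exponents of x_i (x_j^k)^p: in characteristic p, this block of coefficients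
   contributes x_i u_i(x_j)^p to F, hence to x_l d_l F only for l = i. *)
Definition line_expo (j i : 'I_r) (k : nat) (l : 'I_r) : nat := ((l == i) + p * k * (l ==
    j))%N.

Lemma line_expo_sum j i (k : 'I_M) : (\sum_l line_expo j i k l <= d)%N.
Proof.
rewrite big_split /= (bigD1 i) //= eqxx big1 => [|l /negPf ->//].
rewrite -big_distrr /= (bigD1 j) //= eqxx big1 => [|l /negPf ->//].
rewrite !addn0 muln1 add1n; apply: leq_trans pM.
apply: (@leq_trans (p * k + p)); first by rewrite -addn1 leq_add2l prime_gt0.
by rewrite addnC -mulnS leq_mul2l ltn_ord orbT.
Qed.

Definition line_mon (j : 'I_r) (ik : 'I_r * 'I_M) : mon r d :=
  mon_of d (line_expo j ik.1 ik.2).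

Lemma line_monE j ik l : expo (line_mon j ik) l = line_expo j ik.1 ik.2 l.
Proof. by rewrite mon_ofE // line_expo_sum. Qed.

Lemma line_mon_inj j : injective (line_mon j).
Proof.
move=> [i k] [i' k'] E.
have H l : line_expo j i k l = line_expo j i' k' l by have := line_monE j (i, k) l;
    rewrite E line_monE.
have ii : i = i'.
  apply/eqP; have := congr1 (modn^~ p) (H i); rewrite /line_expo eqxx.
  have p1 := prime_gt1 p_pr.
  rewrite -!mulnA ![(p * _)%N]mulnC ![(_ + _ * p)%N]addnC !modnMDl.
  rewrite !modn_small //; first by case: (i == i').
  by apply: leq_ltn_trans p1; case: (i == i').
subst i'; congr (_, _); apply/val_inj => /=; have := H j; rewrite /line_expo !eqxx !muln1.
by move=> /addnI /eqP; rewrite eqn_pmul2l ?prime_gt0 // => /eqP.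
Qed.

Lemma Lval_resample_line j e (dl : {ffun 'I_r * 'I_M -> bool}) l (y : 'I_r -> Om) :
  Lval (resample (line_mon j) e dl) l y =
  \sum_(m | m \notin codom (line_mon j)) (-1) ^+ e m * (expo m l)%:R * \prod_i y i ^+
      expo m i
  + y l * (\sum_k (-1) ^+ dl (l, k) * y j ^+ (k : 'I_M)) ^+ p.
Proof.
rewrite /Lval (sum_resample_split (line_mon_inj (j := j))
  (fun b m => (-1) ^+ b * (expo m l)%:R * \prod_i y i ^+ expo m i)).
congr (_ + _); rewrite frobenius_sign_sum // mulr_sumr.
transitivity (\sum_i \sum_k (-1) ^+ dl (i, k) * (expo (line_mon j (i, k)) l)%:R *
   \prod_i0 y i0 ^+ expo (line_mon j (i, k)) i0).
  by rewrite pair_big /=; apply: eq_bigr => -[i k] _.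
rewrite (bigD1 l) //= [X in _ + X]big1 ?addr0 => [|i il].
  apply: eq_bigr => k _; rewrite line_monE /= /line_expo eqxx.
  have -> : (1 + p * k * (l == j))%:R = 1 :> Om.
    by rewrite natrD natrM natrM (pcharf0 pOm) !mul0r addr0.
  rewrite mulr1 mulrCA; congr (_ * _).
  under eq_bigr do rewrite line_monE /= /line_expo exprD.
  rewrite big_split /= (bigD1 l) //= eqxx expr1 big1 ?mulr1 => [|i /negPf ->//].
  congr (_ * _); rewrite (bigD1 j) //= eqxx muln1 big1 ?mulr1 => [|i /negPf ->].
    by rewrite mulnC exprM.
  by rewrite muln0 expr0.
rewrite big1 // => k _; rewrite line_monE /line_expo /= eq_sym (negPf il) add0n.
by rewrite natrM natrM (pcharf0 pOm) !mul0r mulr0 mul0r.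
Qed.

(** One more than a bound for the degree of the eliminating polynomial: the coefficients [Phi g]
    have degree below E, and each of the r factors, a power of exponent below E of some g_i^p, has
    degree at most d E. *)
Definition high_size := (perron_bound r d * (r * d).+1).+1.

(** When no coordinate is bad, each coordinate of the common torus zeros of the derivatives takes at
    most [high_size] values, which leaves at most high_size^r such zeros. *)
Definition bad_coordinate (j : 'I_r) (e : {ffun mon r d -> bool}) :=
  ~ exists q : {poly Om}, [/\ q != 0, (size q <= high_size)%N &
     forall y : 'I_r -> Om, torus y -> (forall l, Lval e l y = 0) -> q.[y j] = 0].

Lemma Pr_bad_coordinate j :
  Pr R (bad_coordinate j) <= (r * perron_bound r d)%:R / 2 ^+ M.
Proof.
set E := perron_bound r d; set q := _ / _.
have q0 : 0 <= q by rewrite divr_ge0 ?ler0n ?exprn_ge0 ?ler0n.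
rewrite -[leRHS]mulr1 -(Pr_True R (mon r d)).
apply: (Pr_conditioning (line_mon_inj (j := j))) => // e _.
(* The part of y_l d_l F that does not involve the resampled signs. *)
pose A l y := \sum_(m | m \notin codom (line_mon j)) (-1) ^+ e m * (expo m l)%:R *
    \prod_i y i ^+ expo m i : Om.
have Ad l : polyfun d (A l).
  have [m i|C CP] := @polyfun_sum_monomials Om r d _ (fun m : mon r d => if m \notin
      codom (line_mon j) then (-1) ^+ e m * (expo m l)%:R else 0) (@expo r d).
    exact: expo_le.
  exists C => y; rewrite -CP /A big_mkcond; apply: eq_bigr => m _.
  by case: ifP => //; rewrite mul0r.
have [phi [[[k0 g0] phi0] phiP]] := perron_relation j Ad.
pose Phi (g : {ffun 'I_r -> 'I_E}) : {poly Om} := \poly_(k < E) (if insub k is Some k'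
    then phi (k', g) else 0).
pose uu (dl : {ffun 'I_r * 'I_M -> bool}) : {ffun 'I_r -> {ffun 'I_M -> bool}} := [ffun i
    => [ffun k => dl (i, k)]].
pose Psi (u : {ffun 'I_r -> {ffun 'I_M -> bool}}) := \sum_g Phi g * \prod_i (- sign_poly
    Om (u i) ^+ p) ^+ (g i : 'I_E).
pose N := #|[pred u | Psi u == 0]|.
have NE : (N * 2 ^ M <= r * E * (2 ^ M) ^ r)%N.
  have := schwartz_zippel (sign_frob_inj p_odd pOm (M := M)) (phi := Phi).
  rewrite card_ffun card_bool card_ord; apply.
  exists g0; apply/eqP => /(congr1 (fun P : {poly Om} => P`_k0)).
  by rewrite coef0 coef_poly ltn_ord valK; apply/eqP.
apply: (Pr_card (k := N)); last first.
  rewrite card_prod !card_ord /q mulrAC ler_pdivlMr ?exprn_gt0 ?ltr0n //.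
  by rewrite -natrX -natrX -!natrM ler_nat mulnC [X in (_ <= _ * 2 ^ X)%N]mulnC expnM mulnC.
have uu_inj : injective uu.
  move=> dl dl' /ffunP E1; apply/ffunP => -[i k].
  by have /ffunP/(_ k) := E1 i; rewrite !ffunE.
rewrite /N -(card_imset _ uu_inj); apply: subset_leq_card; apply/fintype.subsetP => u.
case/imsetP => dl dlbad ->; have [P0|Psi0] := eqVneq (Psi (uu dl)) 0.
  by rewrite !finset.inE P0 eqxx.
suff good : ~ bad_coordinate j (resample (line_mon j) e dl).
  by move: dlbad; rewrite !finset.inE => /asboolP.
apply; exists (Psi (uu dl)); split=> //.
  apply: leq_trans (size_sum _ _ _) _; apply/bigmax_leqP => g _.
  apply: (@size_mul_le1 _ _ _ E (r * (d * E))).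
  - by apply: leq_trans (size_poly _ _) _.
  - rewrite -[X in (X * _)%N](card_ord r); apply: size_prod_le1 => i.
    apply: leq_trans (size_exp_le1 (a := d) _ _) _.
      rewrite size_polyN; apply: leq_trans (size_exp_le1 (a := M) p _) _.
        exact: leq_trans (size_sign_poly _ _) _.
      by rewrite ltnS mulnC.
    by rewrite ltnS leq_mul2l ltnW ?orbT.
  - by rewrite mulnS leq_add2l mulnA mulnC.
move=> y ty Ly.
have := phiP y; pose s l := (sign_poly Om (uu dl l)).[y j].
have As l : A l y = - (y l * s l ^+ p).
  apply/eqP; rewrite -addr_eq0; have := Ly l; rewrite Lval_resample_line => <-.
  apply/eqP; congr (_ + _ * _ ^+ p); rewrite /s sign_poly_horner.
  by apply: eq_bigr => k _; rewrite !ffunE.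
set S := \sum_ga _.
(* Each factor A_i^a y_i^(E - a) equals (- s_i^p)^a y_i^E. The powers y_i^E, nonzero on the torus,
   come out of the relation, and Psi at y_j remains. *)
have -> : S = (\prod_i y i ^+ E) * (Psi (uu dl)).[y j].
  rewrite /S /Psi horner_sum mulr_sumr.
  rewrite (eq_bigr (fun g => \sum_k phi (k, g) * (y j ^+ (k : 'I_E) * \prod_i (A i y ^+
      (g i : 'I_E) * y i ^+ (E - g i))))).
    by rewrite exchange_big pair_big /=; apply: eq_bigr => -[k g] _.
  move=> g _; rewrite hornerM horner_poly.
  rewrite [X in _ * (X * _)](eq_bigr (fun k : 'I_E => phi (k, g) * y j ^+ k)) => [|k _];
      last by rewrite valK.
  rewrite mulr_suml mulr_sumr; apply: eq_bigr => k _.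
  rewrite -mulrA mulrCA; congr (_ * _); rewrite mulrCA; congr (_ * _).
  rewrite horner_prod -big_split /=; apply: eq_bigr => i _.
  rewrite As !(hornerE, horner_exp) -/(s i) -mulrN exprMn mulrAC -exprD subnKC //.
  exact: ltnW.
move/eqP; rewrite mulf_eq0 => /orP[|/eqP //].
by move/prodf_eq0 => [i _]; rewrite expf_eq0 (negPf (ty i)) andbF.
Qed.
Variable iota : {rmorphism 'F_p -> Om}.

(* x has degree at least e0 over F_p. *)
Definition generic_upto e0 (x : Om) := forall a : 'I_e0 -> 'F_p,
  \sum_k iota (a k) * x ^+ (k : 'I_e0) = 0 -> forall k, a k = 0.

(** The difference of two such sums is an F_p-relation of degree below e0, which genericity makes
    trivial; the two signs stay distinct because p is odd. *)
Lemma sign_sum_inj e0 x : generic_upto e0 x ->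
  injective (fun u : {ffun 'I_e0 -> bool} => \sum_k (-1) ^+ u k * x ^+ (k : 'I_e0)).
Proof.
move=> gx u v /eqP; rewrite -subr_eq0 -sumrB => /eqP uv.
have := gx (fun k => (-1) ^+ u k - (-1) ^+ v k).
have iE k : iota ((-1) ^+ u k - (-1) ^+ v k) = (-1) ^+ u k - (-1) ^+ v k.
  by rewrite rmorphB !rmorph_sign.
have -> : \sum_k iota ((-1) ^+ u k - (-1) ^+ v k) * x ^+ k = 0.
  by rewrite -[RHS]uv; apply: eq_bigr => k _; rewrite iE mulrBl.
move=> /(_ erefl) H; apply/ffunP => k; apply: (sign_inj p_odd pOm); apply/eqP.
by rewrite -subr_eq0 -iE H rmorph0.
Qed.

Lemma ex_roots (A : fieldType) (q : {poly A}) : q != 0 ->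
  exists2 rs : seq A, (size rs < size q)%N & forall x, q.[x] = 0 -> x \in rs.
Proof.
move: {2}(size q) (leqnn (size q)) => n; elim: n q => [|n IHn] q.
  by rewrite leqn0 size_poly_eq0 => /eqP ->; rewrite eqxx.
move=> sq qn0; have [[x /factor_theorem[q' qE]]|nroot] := pselect (exists x, root q x).
  have q'n0 : q' != 0 by apply: contraNneq qn0 => q'0; rewrite qE q'0 mul0r.
  have sqE : size q = (size q').+1 by rewrite qE size_Mmonic ?monicXsubC // size_XsubC
      addn2.
  have [|rs srs rsP] := IHn q' _ q'n0; first by rewrite -ltnS -sqE.
  exists (x :: rs) => [|t]; first by rewrite /= sqE ltnS.
  rewrite qE hornerM hornerXsubC => /eqP; rewrite mulf_eq0 inE => /orP[/eqP/rsP ->|].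
    by rewrite orbT.
  by rewrite subr_eq0 => ->.
exists [::] => [|x /eqP qx]; first by rewrite size_poly_gt0.
by case: nroot; exists x.
Qed.

Section GenericPoints.
Variable e0 : nat.
Hypothesis e0M : (e0 <= M)%N.

(** The exponents of (x_j^k)^p: a part of g_0, invisible to the derivatives. *)
Definition axis_expo (j : 'I_r) (k : nat) (l : 'I_r) : nat := (p * k * (l == j))%N.

Definition axis_mon (j : 'I_r) (k : 'I_e0) : mon r d := mon_of d (axis_expo j k).

Lemma axis_monE j k l : expo (axis_mon j k) l = axis_expo j k l.
Proof.
rewrite mon_ofE // -big_distrr /= (bigD1 j) //= eqxx big1 => [|i /negPf ->//].
by rewrite addn0 muln1 (leq_trans _ pM) // leq_mul2l (leq_trans (ltnW (ltn_ord k))) ?orbT.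
Qed.

Lemma axis_mon_inj j : injective (axis_mon j).
Proof.
move=> k k' E; apply/val_inj => /=; have := axis_monE j k j; rewrite E axis_monE
    /axis_expo eqxx !muln1.
by move/eqP; rewrite eqn_pmul2l ?prime_gt0 // => /eqP.
Qed.

Lemma Lval_resample_axis j e dl l (y : 'I_r -> Om) :
  Lval (resample (axis_mon j) e dl) l y = Lval e l y.
Proof.
rewrite /Lval; apply: eq_bigr => m _.
have [/codomP[k ->]|mj] := boolP (m \in codom (axis_mon j)).
  by rewrite axis_monE /axis_expo natrM natrM (pcharf0 pOm) !mul0r !mulr0 !mul0r.
by rewrite resample_out // => k; apply: contraNneq mj => <-; exact: codom_f.
Qed.

Lemma Fval_resample_axis j e dl (y : 'I_r -> Om) :
  Fval (resample (axis_mon j) e dl) y =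
  \sum_(m | m \notin codom (axis_mon j)) (-1) ^+ e m * \prod_i y i ^+ expo m i
  + (\sum_k (-1) ^+ dl k * y j ^+ (k : 'I_e0)) ^+ p.
Proof.
rewrite /Fval (sum_resample_split (axis_mon_inj (j := j))
  (fun b m => (-1) ^+ b * \prod_i y i ^+ expo m i)).
congr (_ + _); rewrite frobenius_sign_sum //; apply: eq_bigr => k _; congr (_ * _).
rewrite (bigD1 j) //= big1 => [|i /negPf ij].
  by rewrite axis_monE /axis_expo eqxx muln1 mulr1 mulnC exprM.
by rewrite axis_monE /axis_expo ij muln0 expr0.
Qed.

Lemma Pr_generic_vanishing j e (y : 'I_r -> Om) : generic_upto e0 (y j) ->
  Pr R (fun dl => Fval (resample (axis_mon j) e dl) y = 0) <= (2 ^+ e0)^-1.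
Proof.
move=> gy; apply: (Pr_card (k := 1)); last by rewrite card_ord mulVf // gt_eqF // exp2_gt0.
apply/card_le1_eqP => u v; rewrite !finset.inE => /asboolP Fu /asboolP Fv.
apply: (sign_sum_inj gy); apply: (frobenius_inj pOm) => /=.
by apply/eqP; rewrite -(inj_eq (addrI (\sum_(m | m \notin codom (axis_mon j)) (-1) ^+ e m
    * \prod_i y i ^+ expo m i))) -!Fval_resample_axis Fu Fv.
Qed.

Definition generic_singular (e : {ffun mon r d -> bool}) :=
  exists y : 'I_r -> Om, [/\ torus y, Fval e y = 0, forall l, Lval e l y = 0 &
    exists j, generic_upto e0 (y j)].

Lemma Pr_generic_singular :
  Pr R generic_singular <= r%:R * ((r * perron_bound r d)%:R / 2 ^+ M)
    + r%:R * ((high_size ^ r)%:R / 2 ^+ e0).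
Proof.
pose bad e := exists j, bad_coordinate j e.
pose good j e := ~ bad e /\ exists y : 'I_r -> Om, [/\ torus y, Fval e y = 0, forall l,
    Lval e l y = 0 &
    generic_upto e0 (y j)].
apply: (le_trans (y := Pr R bad + Pr R (fun e => exists j, good j e))).
  apply: le_trans (Pr_or _ _ _); apply: Pr_le => e [y [ty Fy Ly [j gj]]].
  have [?|nbad] := pselect (bad e); [by left|right; exists j; split=> //; exists y; by
      split].
apply: lerD; apply: Pr_exists_ord => j.
  exact: Pr_bad_coordinate.
rewrite -[leRHS]mulr1 -[X in _ <= _ * X](Pr_True R (mon r d)).
apply: (Pr_conditioning (axis_mon_inj (j := j))) => //.
  by rewrite divr_ge0 ?ler0n ?exprn_ge0 ?ler0n.
move=> e _.
(* Neither the badness of a coordinate nor the list of candidate points depends on the signs being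
   resampled. *)
have [bade|goode] := pselect (exists j', bad_coordinate j' e).
  apply: le_trans (_ : Pr R (fun _ : {ffun 'I_e0 -> bool} => False) <= _).
    apply: Pr_le => dl [[]]; have [j' bj'] := bade; exists j' => -[q [q0 sq qP]].
    apply: bj'; exists q; split=> // y ty Ly; apply: qP => // l.
    by rewrite Lval_resample_axis.
  apply: (Pr_card (k := 0)); last by rewrite mulr_ge0 ?divr_ge0 ?ler0n ?exprn_ge0 ?ler0n.
  by rewrite leqn0; apply/eqP/eq_card0 => dl; rewrite finset.inE; apply/negbTE/asboolP.
have goodq j' : exists rs : seq Om, (size rs <= high_size)%N /\
   forall y : 'I_r -> Om, torus y -> (forall l, Lval e l y = 0) -> y j' \in rs.
  have [[q [q0 sq qP]]|nq] := pselect (exists q : {poly Om}, [/\ q != 0, (size q <=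
      high_size)%N &
     forall y : 'I_r -> Om, torus y -> (forall l, Lval e l y = 0) -> q.[y j'] = 0]); last
         first.
    by case: goode; exists j'.
  have [rs srs rsP] := ex_roots q0.
  exists rs; split=> [|y ty Ly]; first exact: leq_trans (ltnW srs) sq.
  by apply: rsP; exact: qP.
have [rs rsP] := fin_all_exists goodq.
(* Candidates are the points of the product of the root lists; the default 0 pads lists shorter than
   [high_size]. *)
pose pt (k : {ffun 'I_r -> 'I_high_size}) (i : 'I_r) := nth 0 (rs i) (k i).
apply: le_trans (_ : Pr R (fun dl => exists k, generic_upto e0 (pt k j) /\
   Fval (resample (axis_mon j) e dl) (pt k) = 0) <= _).
  apply: Pr_le => dl [_ [y [ty Fy Ly gy]]].
  have yrs i : y i \in rs i.
    by apply: (rsP i).2 => // l; rewrite -(Lval_resample_axis j e dl).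
  have lt i : (index (y i) (rs i) < high_size)%N.
    by apply: leq_trans (rsP i).1; rewrite index_mem.
  exists [ffun i => Ordinal (lt i)].
  have -> : pt [ffun i => Ordinal (lt i)] = y; last by split.
  by apply/funext => i; rewrite /pt ffunE /= nth_index.
apply: le_trans (Pr_exists_const (q := (2 ^+ e0)^-1) _) _.
  move=> k; have [gk|ngk] := pselect (generic_upto e0 (pt k j)).
    apply: le_trans (Pr_generic_vanishing e gk); apply: Pr_le => dl [_ //].
  apply: (Pr_card (k := 0)); last by rewrite mulr_ge0 ?invr_ge0 ?exprn_ge0 ?ler0n.
  by rewrite leqn0; apply/eqP/eq_card0 => dl; rewrite finset.inE; apply/negbTE/asboolP =>
      -[].
by rewrite card_ffun !card_ord.
Qed.
End GenericPoints.
End High.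

(** * Points of small degree *)

Section PrimeFieldSpan.
Variables (p : nat) (p_pr : prime p) (Om : fieldType) (iota : {rmorphism 'F_p -> Om}).

Definition in_span (I : finType) (v : I -> Om) (x : Om) :=
  exists a : I -> 'F_p, x = \sum_i iota (a i) * v i.

Definition lin_free (I : finType) (v : I -> Om) :=
  forall a : I -> 'F_p, \sum_i iota (a i) * v i = 0 -> forall i, a i = 0.

Section Span.
Variables (I : finType) (v : I -> Om).
Local Notation V := (in_span v).

Lemma in_spanD x y : V x -> V y -> V (x + y).
Proof.
move=> [a ->] [b ->]; exists (fun i => a i + b i); rewrite -big_split /=.
by apply: eq_bigr => i _; rewrite rmorphD mulrDl.
Qed.

Lemma in_spanZ c x : V x -> V (iota c * x).
Proof.
move=> [a ->]; exists (fun i => c * a i); rewrite mulr_sumr.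
by apply: eq_bigr => i _; rewrite rmorphM mulrA.
Qed.

Lemma in_span0 : V 0.
Proof. by exists (fun=> 0); rewrite big1 // => i _; rewrite rmorph0 mul0r. Qed.

Lemma in_span_gen i : V (v i).
Proof.
exists (fun j => (j == i)%:R); rewrite (bigD1 i) //= eqxx rmorph1 mul1r.
by rewrite big1 ?addr0 // => j /negPf ->; rewrite rmorph0 mul0r.
Qed.

Lemma in_span_sum (J : finType) (P : pred J) (F : J -> Om) : (forall j, P j -> V (F j))
    -> V (\sum_(j | P j) F j).
Proof.
by move=> VF; elim/big_ind: _ => //; [exact: in_span0|exact: in_spanD].
Qed.

Lemma in_span_stable z : (forall i, V (z * v i)) -> forall x, V x -> V (z * x).
Proof.
move=> Vz x [a ->]; rewrite mulr_sumr; apply: in_span_sum => i _.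
by rewrite mulrCA; exact: in_spanZ.
Qed.
End Span.

Lemma in_span_trans (I J : finType) (v : I -> Om) (w : J -> Om) x :
  (forall i, in_span w (v i)) -> in_span v x -> in_span w x.
Proof.
by move=> vw [a ->]; apply: in_span_sum => i _; apply: in_spanZ.
Qed.

Lemma ex_basis (I : finType) (v : I -> Om) : exists e (s : 'I_e -> I),
  [/\ injective s, lin_free (v \o s) & forall i, in_span (v \o s) (v i)].
Proof.
pose P k := `[< exists s : 'I_k -> I, injective s /\ lin_free (v \o s) >].
have P0 : exists k, P k.
  exists 0; apply/asboolP; have s0 : 'I_0 -> I by case.
  by exists s0; split=> [[]|a _ []].
have Pb k : P k -> (k <= #|I|)%N.
  by move=> /asboolP[s [s_inj _]]; have := leq_card s s_inj; rewrite card_ord.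
have [e /asboolP[s [s_inj sf]] emax] := ex_maxnP P0 Pb.
exists e, s; split=> // i; apply: contrapT => nV.
suff : P e.+1 by move=> /emax; rewrite ltnn.
pose s' (k : 'I_e.+1) := if unlift ord0 k is Some k' then s k' else i.
have s'0 : s' ord0 = i by rewrite /s' unlift_none.
have s'S k : s' (lift ord0 k) = s k by rewrite /s' liftK.
have si k : s k != i by apply: contra_notN nV => /eqP <-; exact: (in_span_gen (v \o s)).
apply/asboolP; exists s'; split.
  move=> k k'; case: (unliftP ord0 k) => [j ->|->]; case: (unliftP ord0 k') => [j' ->|->]
      //;
  rewrite ?s'0 ?s'S.
  - by move=> /s_inj ->.
  - by move=> /eqP; rewrite (negPf (si j)).
  - by move=> /eqP; rewrite eq_sym (negPf (si j')).
move=> a; rewrite big_ord_recl /= s'0.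
under eq_bigr do rewrite s'S.
move=> a0; have [ai|ai] := eqVneq (a ord0) 0.
  move: a0; rewrite ai rmorph0 mul0r add0r => /(sf (fun k => a (lift ord0 k))) aS k.
  by case: (unliftP ord0 k) => [j ->|->].
case: nV; have -> : v i = iota (- (a ord0)^-1) * \sum_(j < e) iota (a (lift ord0 j)) * v
    (s j).
  move/eqP: a0; rewrite addrC addr_eq0 => /eqP ->.
  rewrite mulrN -mulNr -rmorphN opprK mulrA -rmorphM mulVf // rmorph1 mul1r //.
by apply: in_spanZ; exists (fun j => a (lift ord0 j)).
Qed.

Section FreeFamily.
Variables (e : nat) (b : 'I_e -> Om).
Hypothesis b_free : lin_free b.
Local Notation V := (in_span b).

Definition lincomb (a : 'rV['F_p]_e) : Om := \sum_k iota (a 0 k) * b k.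

Lemma lincombB a a' : lincomb (a - a') = lincomb a - lincomb a'.
Proof.
rewrite /lincomb -sumrB; apply: eq_bigr => k _.
by rewrite !mxE rmorphB mulrBl.
Qed.

Lemma lincomb_inj : injective lincomb.
Proof.
move=> a a' /eqP; rewrite -subr_eq0 -lincombB => /eqP /(b_free (a := fun k => (a - a') 0
    k)) E.
by apply/eqP; rewrite -subr_eq0; apply/eqP/rowP => k; rewrite E mxE.
Qed.

Lemma lincombP x : V x -> exists a, x = lincomb a.
Proof.
move=> [a ->]; exists (\row_k a k); apply: eq_bigr => k _; by rewrite mxE.
Qed.

Lemma lincomb_span a : V (lincomb a). Proof. by exists (fun k => a 0 k). Qed.

Lemma lincomb_sum (J : finType) (c : J -> 'F_p) (F : J -> 'rV['F_p]_e) :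
  lincomb (\sum_j c j *: F j) = \sum_j iota (c j) * lincomb (F j).
Proof.
rewrite /lincomb; under [RHS]eq_bigr do rewrite mulr_sumr.
rewrite exchange_big /=; apply: eq_bigr => k _; rewrite summxE rmorph_sum mulr_suml.
by apply: eq_bigr => j _; rewrite mxE rmorphM mulrA.
Qed.

Lemma stable_unitmx w (M : 'M['F_p]_e) : w != 0 ->
  (forall k, w * b k = lincomb (row k M)) -> M \in unitmx.
Proof.
move=> w0 wM; rewrite -row_free_unit -kermx_eq0; apply/eqP/row_matrixP => i.
rewrite row0; set u := row i (kermx M).
have uM : u *m M = 0 by rewrite /u -row_mul mulmx_ker row0.
have : lincomb (u *m M) = w * lincomb u.
  rewrite mulmx_sum_row lincomb_sum mulr_sumr; apply: eq_bigr => k _.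
  by rewrite -wM mulrCA.
rewrite uM; have -> : lincomb 0 = 0 by rewrite /lincomb big1 // => k _; rewrite mxE
    rmorph0 mul0r.
move/esym/eqP; rewrite mulf_eq0 (negPf w0) /= => /eqP u0.
by apply: lincomb_inj; rewrite u0 /lincomb big1 // => k _; rewrite mxE rmorph0 mul0r.
Qed.

(** In the basis b, the family w_t b_k for fixed t becomes the rows of an invertible matrix, that of
    multiplication by w_t. A target c off the span is never reached. *)
Lemma span_sign_sums_le (T m kappa : nat) (w : 'I_T -> Om) (c : Om) :
  odd p -> (0 < m)%N -> T = m.*2 -> (p ^ 2 <= kappa ^ 2 * m.*2.+1)%N ->
  (forall t, w t != 0) -> (forall t k, V (w t * b k)) ->
  (#|[pred dl : {ffun 'I_T * 'I_e -> bool} |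
      \sum_(tk : 'I_T * 'I_e) (-1) ^+ dl tk * (w tk.1 * b tk.2) == c]%R| * p ^ e
   <= kappa.+1 ^ e * 2 ^ (T * e))%N.
Proof.
move=> p_odd m0 Tm pm w0 Vw.
have [M MP] : exists M : 'I_T -> 'M['F_p]_e, forall t k, w t * b k = lincomb (row k (M t)).
  apply: (fin_all_exists (P := fun t Mt => forall k, w t * b k = lincomb (row k Mt))) => t.
  have [F FP] := fin_all_exists (fun k => lincombP (Vw t k)).
  by exists (\matrix_(k, l) F k 0 l) => k; rewrite FP; congr lincomb; apply/rowP => l;
      rewrite !mxE.
have Mu t : M t \in unitmx by apply: stable_unitmx (w0 t) (MP t).
have [/lincombP[a cE]|nVc] := pselect (V c).
  have := sign_sums_le a p_pr p_odd m0 Tm pm Mu.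
  apply: leq_trans; rewrite leq_mul2r; apply/orP; right.
  apply: subset_leq_card; apply/fintype.subsetP => dl; rewrite !finset.inE => /eqP dc.
  apply/eqP; apply: lincomb_inj; rewrite -cE -dc lincomb_sum; apply: eq_bigr => tk _.
  by rewrite MP rmorph_sign.
rewrite eq_card0 ?mul0n // => dl; rewrite finset.inE; apply/eqP => dc; apply: nVc.
rewrite -dc; apply: in_span_sum => tk _; rewrite -(rmorph_sign iota).
exact: in_spanZ.
Qed.

(** As in Fermat's little theorem: multiplication by x != 0 permutes the p^e - 1 nonzero elements of
    the span, and comparing their products gives x^(p^e - 1) = 1. *)
Lemma span_frobenius x : V x -> (forall y z, V y -> V z -> V (y * z)) ->
  x ^+ (p ^ e) = x.
Proof.
move=> Vx VM; have [->|x0] := eqVneq x 0; first by rewrite expr0n gtn_eqF // expn_gt0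
    prime_gt0.
have [f fP] : exists f : 'rV['F_p]_e -> 'rV['F_p]_e, forall a, x * lincomb a = lincomb (f
    a).
  apply: (fin_all_exists (P := fun a b => x * lincomb a = lincomb b)) => a.
  by apply: lincombP; apply: VM => //; exact: lincomb_span.
have l0 : lincomb 0 = 0 by rewrite /lincomb big1 // => k _; rewrite mxE rmorph0 mul0r.
have ln0 a : (lincomb a == 0) = (a == 0).
  by rewrite -l0 (inj_eq lincomb_inj).
have f_inj : injective f.
  move=> a a' faa; apply: lincomb_inj; apply: (mulfI x0).
  by rewrite !fP faa.
have f0 a : (f a != 0) = (a != 0).
  by rewrite -!ln0 -fP mulf_eq0 (negPf x0).
have : \prod_(a | a != 0) lincomb a = x ^+ (p ^ e).-1 * \prod_(a | a != 0) lincomb a.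
  rewrite {1}(reindex_inj f_inj) /= (eq_bigl _ _ f0).
  under eq_bigr do rewrite -fP.
  rewrite big_split /= prodr_const; congr (_ ^+ _ * _).
  rewrite (eq_card (B := predC1 0)); last by move=> a; rewrite !finset.inE.
  by rewrite cardC1 card_mx card_Fp // mul1n.
set Pi := \prod_(a | _) _; have Pi0 : Pi != 0 by apply/prodf_neq0 => a; rewrite ln0.
rewrite -[LHS]mul1r => /(mulIf Pi0) x1.
by rewrite -[(p ^ e)%N]prednK ?expn_gt0 ?prime_gt0 // exprS -x1 mulr1.
Qed.
End FreeFamily.
End PrimeFieldSpan.

(** * Points all of whose coordinates have small degree *)

Section LowDegreePoints.
Variables (p : nat) (Om : fieldType) (iota : {rmorphism 'F_p -> Om}).
Hypothesis p_pr : prime p.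

(** A relation of degree l <= h for x, multiplied by x^(h - l), expresses x^h through lower
    powers. *)
Lemma algebraic_power_span h (x : Om) k : x != 0 -> ~ generic_upto iota h.+1 x -> (k <=
    h)%N ->
  in_span iota (fun j : 'I_h => x ^+ j) (x ^+ k).
Proof.
move=> x0 nx; rewrite leq_eqVlt => /predU1P[->|kh]; last first.
  exact: (in_span_gen iota (fun j : 'I_h => x ^+ j) (Ordinal kh)).
have [a [a0 [k0 ak0]]] : exists a : 'I_h.+1 -> 'F_p, \sum_j iota (a j) * x ^+ j = 0 /\
    exists j, a j != 0.
  apply: contrapT => na; apply: nx => a a0 j; apply: contrapT => /eqP aj.
  by apply: na; exists a; split=> //; exists j.
pose l := [arg max_(i > k0 | a i != 0) i]; have [al lmax] : a l != 0 /\ forall j, a j !=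
    0 -> (j <= l)%N.
  by rewrite /l; case: arg_maxnP.
have lh : (l <= h)%N by rewrite -ltnS.
have -> : x ^+ h = \sum_(j < h.+1 | (j < l)%N) iota (- (a l)^-1 * a j) * x ^+ (j + (h - l)).
  move: a0; rewrite (bigD1 l) //= (bigID (fun j : 'I_h.+1 => (j < l)%N)) /=.
  rewrite [X in _ + (_ + X)]big1 ?addr0 => [|j /andP[jl nj]]; last first.
    have [->|/lmax jle] := eqVneq (a j) 0; first by rewrite rmorph0 mul0r.
    by case/eqP: jl; apply/val_inj => /=; lia.
  rewrite (eq_bigl (fun j : 'I_h.+1 => (j < l)%N)) => [|j]; last first.
    by rewrite andb_idl // => jl; apply: contraTneq jl => ->; rewrite ltnn.
  move/eqP; rewrite addr_eq0 => /eqP E.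
  have xh : x ^+ h = iota (a l)^-1 * (iota (a l) * x ^+ l) * x ^+ (h - l).
    by rewrite mulrA -rmorphM mulVf // rmorph1 mul1r -exprD subnKC.
  rewrite xh E mulrN mulNr mulr_sumr mulr_suml -sumrN; apply: eq_bigr => j _.
  by rewrite rmorphM rmorphN exprD; ring.
apply: in_span_sum => j jl; apply: in_spanZ.
have jlh : (j + (h - l) < h)%N by lia.
exact: (in_span_gen iota (fun j : 'I_h => x ^+ j) (Ordinal jlh)).
Qed.

Section Box.
Variables (r h : nat) (y : 'I_r -> Om).
Hypothesis h0 : (0 < h)%N.
Hypothesis ty : torus y.
Hypothesis y_alg : forall i, ~ generic_upto iota h.+1 (y i).

(** The h^r monomials with exponents below h; they span F_p[y] when the coordinates have degree at
    most h. *)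
Definition box_mon (g : {ffun 'I_r -> 'I_h}) : Om := \prod_i y i ^+ g i.
Local Notation V := (in_span iota box_mon).

Lemma box_var_stable i g : V (y i * box_mon g).
Proof.
pose upd (k : 'I_h) : {ffun 'I_r -> 'I_h} := [ffun l => if l == i then k else g l].
have E : y i * box_mon g = y i ^+ (g i).+1 * \prod_(l | l != i) y l ^+ g l.
  by rewrite /box_mon (bigD1 i) //= mulrA -exprS.
have updE k : box_mon (upd k) = y i ^+ k * \prod_(l | l != i) y l ^+ g l.
  rewrite /box_mon (bigD1 i) //= ffunE eqxx; congr (_ * _).
  by apply: eq_bigr => l /negPf li; rewrite ffunE li.
rewrite E; have [a ->] := algebraic_power_span (ty i) (@y_alg i) (ltn_ord (g i)).
rewrite mulr_suml; apply: in_span_sum => k _; rewrite -mulrA -updE.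
by apply: in_spanZ; exact: in_span_gen.
Qed.

Lemma box_monomial_stable (a : 'I_r -> nat) x : V x -> V ((\prod_i y i ^+ a i) * x).
Proof.
elim: (index_enum 'I_r) => [|i s IHs] Vx; first by rewrite big_nil mul1r.
rewrite big_cons -mulrA; elim: (a i) => [|k IHk]; first by rewrite expr0 mul1r; exact: IHs.
by rewrite exprS -mulrA; apply: in_span_stable IHk => g; exact: box_var_stable.
Qed.

Lemma box_monomial_span (a : 'I_r -> nat) : V (\prod_i y i ^+ a i).
Proof.
rewrite -[X in V X]mulr1; apply: box_monomial_stable.
have -> : 1 = box_mon [ffun=> Ordinal h0].
  by rewrite /box_mon big1 // => i _; rewrite ffunE expr0.
exact: in_span_gen.
Qed.

Lemma box_spanM x z : V x -> V z -> V (x * z).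
Proof.
move=> [a ->] Vz; rewrite mulr_suml; apply: in_span_sum => g _.
by rewrite -mulrA; apply: in_spanZ; exact: box_monomial_stable.
Qed.
End Box.

(* All the coordinates of y have degree at most h over F_p, and F_p[y] has dimension
   e over F_p. *)
Definition low_dim r h e (y : 'I_r -> Om) :=
  [/\ torus y, forall i, ~ generic_upto iota h.+1 (y i) &
      exists s : 'I_e -> {ffun 'I_r -> 'I_h}, [/\ injective s, lin_free iota (@box_mon r
          h y \o s) &
        forall g : {ffun 'I_r -> 'I_h}, in_span iota (@box_mon r h y \o s) (box_mon y g)]].

Lemma ex_low_dim r h (y : 'I_r -> Om) : (0 < h)%N -> torus y ->
  (forall i, ~ generic_upto iota h.+1 (y i)) ->
  exists e, [/\ (0 < e)%N, (e <= h ^ r)%N & low_dim h e y].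
Proof.
move=> h0 ty ya; have [e [s [s_inj sf sV]]] := ex_basis iota (@box_mon r h y).
exists e; split; last by split=> //; exists s.
  case: e s s_inj sf sV => // s _ _ sV.
  have [a /eqP] := sV [ffun=> Ordinal h0].
  by rewrite big_ord0 => /prodf_eq0[i _]; rewrite expf_eq0 (negPf (ty i)) andbF.
by have := leq_card s s_inj; rewrite card_ffun !card_ord.
Qed.

Lemma low_dim_frobenius r h e (y : 'I_r -> Om) : (0 < h)%N -> low_dim h e y ->
  forall i, y i ^+ (p ^ e) = y i.
Proof.
move=> h0 [ty ya [s [s_inj sf sV]]] i.
have VV x : in_span iota (@box_mon r h y) x <-> in_span iota (@box_mon r h y \o s) x.
  split; first exact: in_span_trans.
  by apply: in_span_trans => k; exact: in_span_gen.
apply: (span_frobenius p_pr sf).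
  apply/VV; have := box_monomial_span h0 ty ya (fun l => (l == i) : nat).
  rewrite (bigD1 i) //= eqxx expr1 big1 ?mulr1 // => l /negPf ->.
  by rewrite expr0.
by move=> x z /VV Vx /VV Vz; apply/VV; apply: box_spanM.
Qed.

(** The coordinates are among the roots of X^(p^e) - X, whence p^(e r) candidates. *)
Lemma low_dim_list r h e : (0 < h)%N -> (0 < e)%N ->
  exists pt : {ffun 'I_r -> 'I_(p ^ e)} -> 'I_r -> Om,
    forall y, low_dim h e y -> exists k, pt k = y.
Proof.
move=> h0 e0; pose q : {poly Om} := 'X^(p ^ e) - 'X.
have pe : (1 < p ^ e)%N by rewrite -(expn0 p) ltn_exp2l // prime_gt1.
have sq : size q = (p ^ e).+1.
  by rewrite size_polyDl size_polyXn // size_polyN size_polyX.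
have q0 : q != 0 by rewrite -size_poly_gt0 sq.
have [rs srs rsP] := ex_roots q0.
exists (fun (k : {ffun 'I_r -> 'I_(p ^ e)}) i => nth 0 rs (k i)) => y ly.
have yrs i : y i \in rs.
  by apply: rsP; rewrite !(hornerE, hornerXn) (low_dim_frobenius h0 ly) subrr.
have lt i : (index (y i) rs < p ^ e)%N.
  by rewrite -ltnS -sq (leq_trans _ srs) // ltnS index_mem.
exists [ffun i => Ordinal (lt i)]; apply/funext => i.
by rewrite ffunE /= nth_index.
Qed.

(** * Blocks of signs that act on one condition at a time *)

Section Blocks.
Variable R : realFieldType.
Hypothesis p_odd : odd p.
Variables (r h T m kappa e : nat).
Hypothesis h0 : (0 < h)%N.
Hypotheses (m0 : (0 < m)%N) (Tm : T = m.*2).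
Hypothesis pm : (p ^ 2 <= kappa ^ 2 * m.*2.+1)%N.

Definition low_bound : R := ((kappa.+1)%:R / p%:R) ^+ e.

Lemma low_bound_ge0 : 0 <= low_bound.
Proof. by rewrite exprn_ge0 // divr_ge0 ?ler0n. Qed.

Section PointBlock.
Variables (y : 'I_r -> Om) (s : 'I_e -> {ffun 'I_r -> 'I_h}).
Hypothesis ty : torus y.
Hypothesis y_alg : forall i, ~ generic_upto iota h.+1 (y i).
Hypothesis s_free : lin_free iota (@box_mon r h y \o s).
Hypothesis s_span : forall g : {ffun 'I_r -> 'I_h}, in_span iota (@box_mon r h y \o s)
    (box_mon y g).

Lemma Pr_low_sum (a : 'I_T -> 'I_r -> nat) (c : Om) :
  Pr R (fun dl : {ffun 'I_T * 'I_e -> bool} =>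
    \sum_tk (-1) ^+ dl tk * ((\prod_l y l ^+ a tk.1 l) * box_mon y (s tk.2)) = c) <=
        low_bound.
Proof.
pose w t := \prod_l y l ^+ a t l.
have w0 t : w t != 0 by apply/prodf_neq0 => l _; rewrite expf_neq0.
have Vw t k : in_span iota (@box_mon r h y \o s) (w t * (@box_mon r h y \o s) k).
  apply: (in_span_trans s_span); apply: box_monomial_stable => //.
  exact: in_span_gen.
have := span_sign_sums_le p_pr s_free c p_odd m0 Tm pm w0 Vw.
set N := #|_| => Nle; apply: (Pr_card (k := N)).
  apply: subset_leq_card; apply/fintype.subsetP => dl; rewrite !finset.inE => /asboolP E.
  exact/eqP.
rewrite /low_bound card_prod !card_ord exprMn mulrAC exprVn ler_pdivlMr ?exprn_gt0 ?ltr0n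
    ?prime_gt0 //.
by rewrite -!natrX -!natrM ler_nat.
Qed.
End PointBlock.

Section Translates.
Variables (d : nat) (tau : 'I_T -> 'I_r -> nat).
Hypothesis r0 : (0 < r)%N.
Hypothesis tau_inj : forall t t', (forall l, tau t l = tau t' l) -> t = t'.
Hypothesis tau_d : forall t, (p * (h * \sum_l tau t l + r * h) <= d)%N.

Let pOm : p \in [pchar Om].
Proof.
apply/andP; split=> //; rewrite -(rmorph_nat iota) fmorph_eq0.
by have := pchar_Fp p_pr => /andP[].
Qed.

Section Point.
Variables (y : 'I_r -> Om) (s : 'I_e -> {ffun 'I_r -> 'I_h}).
Hypothesis ty : torus y.
Hypothesis y_alg : forall i, ~ generic_upto iota h.+1 (y i).
Hypothesis s_inj : injective s.
Hypothesis s_free : lin_free iota (@box_mon r h y \o s).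
Hypothesis s_span : forall g : {ffun 'I_r -> 'I_h}, in_span iota (@box_mon r h y \o s)
    (box_mon y g).

(* The exponents of x_i (x^(h tau_t + s_k))^p, or without x_i if i = None.  For
   fixed t, the values of the x^(h tau_t + s_k) form a basis of F_p[y]. *)
Definition low_expo (i : option 'I_r) (tk : 'I_T * 'I_e) (l : 'I_r) : nat :=
  ((Some l == i) + p * (h * tau tk.1 l + s tk.2 l))%N.

Definition low_mon i tk : mon r d := mon_of d (low_expo i tk).

Lemma low_monE i tk l : expo (low_mon i tk) l = low_expo i tk l.
Proof.
rewrite mon_ofE // big_split /= -big_distrr /= big_split /= -big_distrr /=.
have s1 : (\sum_l (Some l == i) <= 1)%N.
  case: i => [i|]; last by rewrite big1.
  by rewrite (bigD1 i) //= eqxx big1 // => l' /negPf; rewrite (inj_eq Some_inj) => ->.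
have s2 : (\sum_l s tk.2 l < r * h)%N.
  apply: (@leq_ltn_trans (\sum_(l < r) h.-1)).
    by apply: leq_sum => l' _; rewrite -ltnS prednK.
  by rewrite sum_nat_const card_ord; move: r0 h0; case: (r) (h) => [|a] [|b] //=; nia.
have p0 := prime_gt0 p_pr.
apply: leq_trans (tau_d tk.1).
(* The sum of s is strictly below r h; multiplied by p, this leaves room for the extra factor
   x_i. *)
apply: (@leq_trans (p * (h * \sum_l tau tk.1 l + \sum_l s tk.2 l).+1)).
  by rewrite mulnS leq_add2r (leq_trans s1).
by rewrite leq_mul2l -addnS leq_add2l s2 orbT.
Qed.

Lemma low_mon_inj i : injective (low_mon i).
Proof.
move=> [t k] [t' k'] E.
have H l : (h * tau t l + s k l = h * tau t' l + s k' l)%N.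
  have := low_monE i (t, k) l; rewrite E low_monE /low_expo /= => /addnI/eqP.
  by rewrite eqn_pmul2l ?prime_gt0 // => /eqP.
(* The entries of s_k are below h: k is read off modulo h, and tau_t from the quotients. *)
have sk : k = k'.
  apply: s_inj; apply/ffunP => l; apply/val_inj => /=; have := congr1 (modn^~ h) (H l).
  by rewrite ![(h * _)%N]mulnC !modnMDl !modn_small.
subst k'; congr (_, _); apply: tau_inj => l; apply/eqP.
by rewrite -(eqn_pmul2l h0) -(eqn_add2r (s k l)) H.
Qed.

Let w t := \prod_l y l ^+ (h * tau t l).

Lemma low_mon_val i tk : \prod_l y l ^+ expo (low_mon i tk) l =
  (if i is Some l then y l else 1) * (w tk.1 * box_mon y (s tk.2)) ^+ p.
Proof.
under eq_bigr do rewrite low_monE /low_expo exprD.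
rewrite big_split /=; congr (_ * _).
  case: i => [i|]; last by rewrite big1.
  rewrite (bigD1 i) //= eqxx expr1 big1 ?mulr1 // => l /negPf; rewrite (inj_eq Some_inj)
      => ->.
  by rewrite expr0.
rewrite /w /box_mon -big_split /= -prodrXl; apply: eq_bigr => l _.
by rewrite mulnC exprM exprD.
Qed.

Lemma low_expo_natr i tk l : (low_expo i tk l)%:R = (Some l == i)%:R :> Om.
Proof. by rewrite natrD natrM (pcharf0 pOm) mul0r addr0. Qed.

Lemma Lval_low i ep dl l : Lval (resample (low_mon (Some i)) ep dl) l y =
  \sum_(a | a \notin codom (low_mon (Some i))) (-1) ^+ ep a * (expo a l)%:R * \prod_i y i
      ^+ expo a i
  + (l == i)%:R * y i * (\sum_tk (-1) ^+ dl tk * (w tk.1 * box_mon y (s tk.2))) ^+ p.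
Proof.
rewrite /Lval (sum_resample_split (low_mon_inj (i := Some i))
  (fun b a => (-1) ^+ b * (expo a l)%:R * \prod_i y i ^+ expo a i)).
congr (_ + _); rewrite frobenius_sign_sum // mulr_sumr; apply: eq_bigr => tk _.
rewrite low_mon_val low_monE low_expo_natr (inj_eq Some_inj).
by ring.
Qed.

Lemma Lval_low_other i ep dl l : Some l != i -> Lval (resample (low_mon i) ep dl) l y =
    Lval ep l y.
Proof.
move=> li; rewrite /Lval; apply: eq_bigr => a _.
have [/codomP[tk ->]|mj] := boolP (a \in codom (low_mon i)).
  by rewrite low_monE low_expo_natr (negPf li) !mulr0 !mul0r.
by rewrite resample_out // => k; apply: contraNneq mj => <-; exact: codom_f.
Qed.

Lemma Fval_low ep dl : Fval (resample (low_mon None) ep dl) y =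
  \sum_(a | a \notin codom (low_mon None)) (-1) ^+ ep a * \prod_i y i ^+ expo a i
  + (\sum_tk (-1) ^+ dl tk * (w tk.1 * box_mon y (s tk.2))) ^+ p.
Proof.
rewrite /Fval (sum_resample_split (low_mon_inj (i := None))
  (fun b a => (-1) ^+ b * \prod_i y i ^+ expo a i)).
congr (_ + _); rewrite frobenius_sign_sum //; apply: eq_bigr => tk _.
by rewrite low_mon_val mul1r.
Qed.

(** If c + u c'^p = 0, injectivity of Frobenius forces the signed sum to be c'; without such a c'
    the event is empty. *)
Lemma Pr_low_block (c u : Om) : u != 0 ->
  Pr R (fun dl : {ffun 'I_T * 'I_e -> bool} =>
    c + u * (\sum_tk (-1) ^+ dl tk * (w tk.1 * box_mon y (s tk.2))) ^+ p = 0) <= low_bound.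
Proof.
move=> u0; have [[c' c'P]|nc] := pselect (exists c', c + u * c' ^+ p = 0); last first.
  apply: (Pr_card (k := 0)); last by apply: mulr_ge0; [exact: low_bound_ge0|apply:
      exprn_ge0; exact: ler0n].
  rewrite leqn0; apply/eqP/eq_card0 => dl; rewrite finset.inE; apply/negbTE/asboolP => E.
  by apply: nc; eexists; exact: E.
apply: le_trans (Pr_low_sum ty y_alg s_free s_span (fun t l => (h * tau t l)%N) c');
    apply: Pr_le => dl E.
apply: (frobenius_inj pOm) => /=; apply: (mulfI u0); apply: (addrI c).
by rewrite c'P E.
Qed.

(** The conditions are imposed in turn: the block [Some i] affects no derivative but the i-th, and
    the block [None], used last for F, affects none. Each of the r + 1 conditions costs a factor
    [low_bound]. *)
Lemma Pr_low_point : Pr R (fun ep : {ffun mon r d -> bool} => Fval ep y = 0 /\ forall l,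
    Lval ep l y = 0)
   <= low_bound ^+ r.+1.
Proof.
pose E k (ep : {ffun mon r d -> bool}) := forall l : 'I_r, (l < k)%N -> Lval ep l y = 0.
have PE k : (k <= r)%N -> Pr R (E k) <= low_bound ^+ k.
  elim: k => [|k IHk] kr; first by rewrite expr0 Pr_le1.
  apply: (le_trans (y := low_bound * Pr R (E k))); last first.
    by rewrite exprS ler_wpM2l ?low_bound_ge0 // IHk // ltnW.
  pose i := Ordinal kr; apply: (Pr_conditioning (low_mon_inj (i := Some i))); first
      exact: low_bound_ge0.
    move=> ep dl El l lk; rewrite -(Lval_low_other (i := Some i) ep dl) ?El //; first
        exact: ltnW.
    by rewrite (inj_eq Some_inj) -val_eqE /= neq_ltn lk.
  move=> ep _; apply: le_trans (Pr_low_block (\sum_(a | a \notin codom (low_mon (Some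
      i))) (-1) ^+ ep a * (expo a i)%:R * \prod_i y i ^+ expo a i) (ty i)).
  apply: Pr_le => dl /(_ i (ltnSn _)); rewrite Lval_low eqxx mul1r //.
apply: (le_trans (y := low_bound * Pr R (E r))); last first.
  by rewrite exprS ler_wpM2l ?low_bound_ge0 // PE.
apply: (Pr_conditioning (low_mon_inj (i := None))); first exact: low_bound_ge0.
  by move=> ep dl [_ El] l _; rewrite -(Lval_low_other (i := None) ep dl) ?El.
move=> ep _; apply: le_trans (Pr_low_block (\sum_(a | a \notin codom (low_mon None)) (-1)
    ^+ ep a * \prod_i y i ^+ expo a i) (oner_neq0 _)).
by apply: Pr_le => dl [+ _]; rewrite Fval_low mul1r.
Qed.
End Point.

Lemma Pr_low_dim : (0 < e)%N ->
  Pr R (fun ep : {ffun mon r d -> bool} => exists y : 'I_r -> Om,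
    [/\ low_dim h e y, Fval ep y = 0 & forall l, Lval ep l y = 0])
   <= ((p ^ e) ^ r)%:R * low_bound ^+ r.+1.
Proof.
move=> e0; have [pt ptP] := low_dim_list r h0 e0.
apply: le_trans (_ : Pr R (fun ep : {ffun mon r d -> bool} => exists k,
    low_dim h e (pt k) /\ (Fval ep (pt k) = 0 /\ forall l, Lval ep l (pt k) = 0)) <= _).
  apply: Pr_le => ep [y [ly Fy Ly]]; have [k kP] := ptP y ly.
  by exists k; rewrite kP.
apply: le_trans (Pr_exists_const (q := low_bound ^+ r.+1) _) _.
  move=> k; have [[ty ya [s [s_inj sf sV]]]|nl] := pselect (low_dim h e (pt k)).
    apply: le_trans (Pr_low_point ty ya s_inj sf sV).
    by apply: Pr_le => ep [].
  apply: (Pr_card (k := 0)); last by apply: mulr_ge0; apply: exprn_ge0; [exact: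
      low_bound_ge0|exact: ler0n].
  by rewrite leqn0; apply/eqP/eq_card0 => dl; rewrite finset.inE; apply/negbTE/asboolP =>
      -[].
by rewrite card_ffun !card_ord.
Qed.
End Translates.
End Blocks.
End LowDegreePoints.

(** * Binary forms *)

Section BinaryForms.
Variables (p : nat) (Om : fieldType) (iota : {rmorphism 'F_p -> Om}).
Hypothesis p_pr : prime p.
Variable R : realFieldType.
Hypothesis p_odd : odd p.
Variable d : nat.

Let pOm : p \in [pchar Om].
Proof.
apply/andP; split=> //; rewrite -(rmorph_nat iota) fmorph_eq0.
by have := pchar_Fp p_pr => /andP[].
Qed.

Implicit Types (x : Om).

(* One sample space for a pair of independent forms, of degrees d and d - 1 and
   dehomogenized: the index inl k carries the coefficient of x^k in the first one,
   and inr k that in the second one. *)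
Definition valF x (i : 'I_d.+1 + 'I_d) : Om := if i is inl k then x ^+ k else 0.
Definition valG x (i : 'I_d.+1 + 'I_d) : Om := if i is inr k then x ^+ k else 0.
Definition signed_sum (v : 'I_d.+1 + 'I_d -> Om) (e : {ffun 'I_d.+1 + 'I_d -> bool}) :=
    \sum_i (-1) ^+ e i * v i.

Lemma signed_sum_resample (J : finType) (f : J -> 'I_d.+1 + 'I_d) v e dl : injective f ->
  signed_sum v (resample f e dl) =
  \sum_(i | i \notin codom f) (-1) ^+ e i * v i + \sum_j (-1) ^+ dl j * v (f j).
Proof.
by move=> f_inj; rewrite /signed_sum (sum_resample_split f_inj (fun b i => (-1) ^+ b * v
    i)).
Qed.

Lemma signed_sum_resample_other (J : finType) (f : J -> 'I_d.+1 + 'I_d) v e dl :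
  (forall j, v (f j) = 0) -> signed_sum v (resample f e dl) = signed_sum v e.
Proof.
move=> vf; apply: eq_bigr => i _; have [/codomP[k ->]|mj] := boolP (i \in codom f).
  by rewrite vf !mulr0.
by rewrite resample_out // => k; apply: contraNneq mj => <-; exact: codom_f.
Qed.

Definition common_zero x e := signed_sum (valF x) e = 0 /\ signed_sum (valG x) e = 0.

Lemma signed_sumF x e : signed_sum (valF x) e = (sign_poly Om [ffun k => e (inl k)]).[x].
Proof.
rewrite sign_poly_horner /signed_sum big_sumType /= [X in _ + X]big1 ?addr0 => [|i _];
    last by rewrite mulr0.
by apply: eq_bigr => k _; rewrite ffunE.
Qed.

Lemma Pr_generic_common_zero e0 : (e0 <= d)%N ->
  Pr R (fun e => exists x, generic_upto iota e0 x /\ common_zero x e) <= d%:R / 2 ^+ e0.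
Proof.
move=> e0d; pose f (k : 'I_e0) : 'I_d.+1 + 'I_d := inr (widen_ord e0d k).
have f_inj : injective f by move=> k k' [] kk; apply/val_inj.
rewrite -[leRHS]mulr1 -[X in _ <= _ * X](Pr_True R ('I_d.+1 + 'I_d)%type).
apply: (Pr_conditioning f_inj) => //; first by rewrite divr_ge0 ?ler0n ?exprn_ge0 ?ler0n.
move=> e _; pose q := sign_poly Om [ffun k => e (inl k)].
have q0 : q != 0.
  apply/eqP => /(congr1 (fun P : {poly Om} => P`_0)); rewrite coef0 coef_poly /=.
  by case: insubP => //= k _ _ /eqP; rewrite signr_eq0.
have [rs srs rsP] := ex_roots q0.
have srs' : (size rs <= d)%N by rewrite -ltnS (leq_trans srs) // size_sign_poly.
apply: le_trans (_ : (size rs)%:R * (2 ^+ e0)^-1 <= _); last first.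
  by rewrite ler_wpM2r ?ler_nat // invr_ge0 exprn_ge0 ?ler0n.
apply: le_trans (Pr_mem_const (s := rs) (P := fun x dl => generic_upto iota e0 x /\
    signed_sum (valG x) (resample f e dl) = 0) _).
  apply: Pr_le => dl [x [gx [Fx Gx]]]; exists x; last by [].
  by apply: rsP; rewrite -signed_sumF -(@signed_sum_resample_other _ f (valF x) e dl).
move=> x _; have [gx|ngx] := pselect (generic_upto iota e0 x); last first.
  apply: (Pr_card (k := 0)); last by rewrite mulr_ge0 ?invr_ge0 ?exprn_ge0 ?ler0n.
  by rewrite leqn0; apply/eqP/eq_card0 => dl; rewrite finset.inE; apply/negbTE/asboolP =>
      -[].
apply: (Pr_card (k := 1)); last by rewrite card_ord mulVf // gt_eqF // exp2_gt0.
apply/card_le1_eqP => u v; rewrite !finset.inE => /asboolP[_ Gu] /asboolP[_ Gv].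
apply: (sign_sum_inj p_odd pOm gx) => /=.
apply: (addrI (\sum_(i | i \notin codom f) (-1) ^+ e i * valG x i)).
have := signed_sum_resample (valG x) e u f_inj; rewrite Gu /= => <-.
by have := signed_sum_resample (valG x) e v f_inj; rewrite Gv /= => <-.
Qed.

Section LowCommonZero.
Variables (h T m kappa e1 : nat).
Hypotheses (h0 : (0 < h)%N) (hT : (h * T <= d)%N).
Hypotheses (m0 : (0 < m)%N) (Tm : T = m.*2).
Hypothesis pm : (p ^ 2 <= kappa ^ 2 * m.*2.+1)%N.

(** All exponents are available here, not only multiples of p, so a single variable provides T
    translates x^(h t), up to T = d / h. The two forms use disjoint signs, whence the square. *)
Lemma Pr_low_common_zero_point (y : 'I_1 -> Om) : low_dim iota h e1 y ->
  Pr R (common_zero (y ord0)) <= low_bound p R kappa e1 ^+ 2.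
Proof.
move=> [ty ya [s [s_inj sf sV]]].
have lt (tk : 'I_T * 'I_e1) : (h * tk.1 + s tk.2 ord0 < d)%N.
  apply: leq_trans hT; apply: (@leq_trans (h * tk.1 + h)); first by rewrite ltn_add2l.
  by rewrite addnC -mulnS leq_mul2l ltn_ord orbT.
pose f tk : 'I_d := Ordinal (lt tk).
have f_inj : injective f.
  move=> [t k] [t' k'] /(congr1 val) /= H.
  have sk : k = k'.
    apply: s_inj; apply/ffunP => l; apply/val_inj; rewrite (ord1 l) /=; have := congr1
        (modn^~ h) H.
    by rewrite ![(h * _)%N]mulnC !modnMDl !modn_small.
  subst k'; congr (_, _); apply/val_inj/eqP => /=.
  by rewrite -(eqn_pmul2l h0) -(eqn_add2r (s k ord0)) H.
pose fF tk : 'I_d.+1 + 'I_d := inl (widen_ord (leqnSn d) (f tk)).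
pose fG tk : 'I_d.+1 + 'I_d := inr (f tk).
have fF_inj : injective fF by move=> u v [] uv; apply: f_inj; apply/val_inj.
have fG_inj : injective fG by move=> u v [] uv; apply: f_inj; apply/val_inj.
have block c : Pr R (fun dl : {ffun 'I_T * 'I_e1 -> bool} =>
    c + \sum_tk (-1) ^+ dl tk * y ord0 ^+ f tk = 0) <= low_bound p R kappa e1.
  apply: le_trans (Pr_low_sum p_pr R p_odd m0 Tm pm ty ya sf sV (fun t l => (h * t)%N) (-
      c)).
  apply: Pr_le => dl /eqP; rewrite addrC addr_eq0 => /eqP <-; apply: eq_bigr => tk _.
  by rewrite /box_mon !big_ord1 -exprD.
apply: (le_trans (y := low_bound p R kappa e1 * Pr R (fun e => signed_sum (valF (y ord0))
    e = 0))).
  apply: (Pr_conditioning fG_inj); first exact: low_bound_ge0.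
    by move=> e dl [+ _]; rewrite signed_sum_resample_other.
  move=> e _; apply: le_trans (block (\sum_(i | i \notin codom fG) (-1) ^+ e i * valG (y
      ord0) i)).
  by apply: Pr_le => dl [_]; rewrite signed_sum_resample.
rewrite expr2 ler_wpM2l ?low_bound_ge0 //.
rewrite -[leRHS]mulr1 -[X in _ <= _ * X](Pr_True R ('I_d.+1 + 'I_d)%type).
apply: (Pr_conditioning fF_inj) => //; first exact: low_bound_ge0.
move=> e _; apply: le_trans (block (\sum_(i | i \notin codom fF) (-1) ^+ e i * valF (y
    ord0) i)).
by apply: Pr_le => dl; rewrite signed_sum_resample.
Qed.

Lemma Pr_low_common_zero : (0 < e1)%N ->
  Pr R (fun e => exists y : 'I_1 -> Om, low_dim iota h e1 y /\ common_zero (y ord0) e)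
   <= ((p ^ e1) ^ 1)%:R * low_bound p R kappa e1 ^+ 2.
Proof.
move=> e10; have [pt ptP] := low_dim_list iota p_pr 1 h0 e10.
apply: le_trans (_ : Pr R (fun ep => exists k,
    low_dim iota h e1 (pt k) /\ common_zero (pt k ord0) ep) <= _).
  by apply: Pr_le => ep [y [ly Fy]]; have [k kP] := ptP y ly; exists k; rewrite kP.
apply: le_trans (Pr_exists_const (q := low_bound p R kappa e1 ^+ 2) _) _.
  move=> k; have [lk|nl] := pselect (low_dim iota h e1 (pt k)).
    by apply: le_trans (Pr_low_common_zero_point lk); apply: Pr_le => ep [].
  apply: (Pr_card (k := 0)); last by apply: mulr_ge0; apply: exprn_ge0; [exact:
      low_bound_ge0|exact: ler0n].
  by rewrite leqn0; apply/eqP/eq_card0 => dl; rewrite finset.inE; apply/negbTE/asboolP =>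
      -[].
by rewrite card_ffun !card_ord.
Qed.
End LowCommonZero.
End BinaryForms.

(** * Probability of a singular point *)

Section Assembly.
Variables (p : nat) (Om : fieldType) (iota : {rmorphism 'F_p -> Om}).
Hypothesis p_pr : prime p.
Variable R : realFieldType.
Hypothesis p_odd : odd p.

Lemma low_dim1_prime_field r h (y : 'I_r -> Om) : (0 < h)%N -> low_dim iota h 1 y ->
  forall i, ~ generic_upto iota 2 (y i).
Proof.
move=> h0 ly i gy; have := low_dim_frobenius p_pr h0 ly i; rewrite expn1 => yp.
have : (map_poly iota ('X^p - 'X)).[y i] = 0.
  by rewrite rmorphB /= map_polyXn map_polyX !(hornerE, hornerXn) yp subrr.
have -> : 'X^p - 'X = \prod_x ('X - x%:P) :> {poly 'F_p}.
  by rewrite -finField_genPoly card_Fp.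
rewrite rmorph_prod horner_prod => /eqP/prodf_eq0[c _].
rewrite rmorphB /= map_polyX map_polyC !hornerE subr_eq0 => /eqP yc.
pose a (k : 'I_2) : 'F_p := if k == ord0 then - c else 1.
have /(_ ord_max) : forall k, a k = 0.
  by apply: gy; rewrite !big_ord_recl big_ord0 /a /= rmorphN rmorph1 expr0 expr1 yc; ring.
by rewrite /a /= => /eqP; rewrite oner_eq0.
Qed.

Section LowSum.
Variables (I : finType) (r h : nat) (E : ('I_r -> Om) -> {ffun I -> bool} -> Prop).
Hypothesis r0 : (0 < r)%N.
Hypothesis hp : ((9 * h) ^ (3 * r + 2) <= p)%N.
Hypothesis PE : forall h' e, (0 < h')%N -> (h' <= h)%N -> (0 < e)%N ->
  Pr R (fun ep => exists y, low_dim iota h' e y /\ E y ep) <=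
    ((p ^ e) ^ r)%:R * low_bound p R (8 * h') e ^+ r.+1.

Lemma low_bound_total h' e : (0 < h')%N -> 
  ((p ^ e) ^ r)%:R * low_bound p R (8 * h') e ^+ r.+1 = (((8 * h').+1 ^ r.+1)%:R / p%:R)
      ^+ e :> R.
Proof.
move=> h'0; have p0 : p%:R != 0 :> R by rewrite pnatr_eq0 -lt0n prime_gt0.
rewrite /low_bound exprAC !natrX (exprAC _ e r) -exprMn; congr (_ ^+ e).
rewrite exprMn mulrCA; congr (_ * _); rewrite exprVn exprS invfM mulrCA mulfV ?mulr1 //.
by rewrite expf_neq0.
Qed.

(** For e = 1 the point is over F_p, and h' = 1 gives 9^(r+1) / p without any power of h. For e >= 2
    the bound is at most X^2 with X = (8h + 1)^(r+1) / p, and e ranges over at most h^r + 1 values: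
    the total is at most (9h)^(3r+2) / p^2 <= 1 / p. *)
Lemma Pr_low_total : (0 < h)%N ->
  Pr R (fun ep => exists y, [/\ torus y, forall i, ~ generic_upto iota h.+1 (y i) & E y ep])
  <= 9%:R ^+ r.+1 / p%:R + p%:R^-1.
Proof.
move=> h0; have p0 : 0 < p%:R :> R by rewrite ltr0n prime_gt0.
pose A ep := exists y, low_dim iota 1 1 y /\ E y ep.
pose B (e : 'I_(h ^ r).+1) ep := (2 <= e)%N /\ exists y, low_dim iota h e y /\ E y ep.
apply: (le_trans (y := Pr R A + Pr R (fun ep => exists e, B e ep))).
  apply: le_trans (Pr_or _ _ _); apply: Pr_le => ep [y [ty ya Ey]].
  have [y2|y2] := pselect (forall i, ~ generic_upto iota 2 (y i)).
    left; have [e [e0 e1 le]] := ex_low_dim (ltn0Sn 0) ty y2.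
    have e11 : e = 1%N by apply/eqP; rewrite eqn_leq e0 andbT -(exp1n r).
    by exists y; rewrite e11 in le.
  right; have [e [e0 eh le]] := ex_low_dim h0 ty ya.
  have ehl : (e < (h ^ r).+1)%N by [].
  exists (Ordinal ehl); split=> /=; last by exists y.
  rewrite ltn_neqAle e0 andbT; apply: contra_not_neq y2 => e1.
  by move: le; rewrite -e1; exact: low_dim1_prime_field.
apply: lerD.
  apply: le_trans (PE (ltn0Sn 0) h0 (ltn0Sn 0)) _.
  by rewrite low_bound_total // expr1 natrX.
pose X : R := ((8 * h).+1 ^ r.+1)%:R / p%:R.
have hX : ((8 * h).+1 ^ r.+1 <= (9 * h) ^ r.+1)%N by rewrite leq_exp2r //; lia.
have X1 : X <= 1.
  rewrite ler_pdivrMr // mul1r ler_nat; apply: leq_trans hX _; apply: leq_trans hp.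
  by rewrite leq_pexp2l //; lia.
have X0 : 0 <= X by rewrite divr_ge0 ?ler0n.
apply: le_trans (Pr_exists_ord (q := X ^+ 2) _) _.
  move=> e; have [e2|e2] := leqP 2 e; last first.
    apply: (Pr_card (k := 0)); last by rewrite mulr_ge0 ?exprn_ge0 ?ler0n.
    rewrite leqn0; apply/eqP/eq_card0 => dl; rewrite finset.inE; apply/negbTE/asboolP =>
        -[].
    by rewrite leqNgt e2.
  apply: le_trans (_ : Pr R (fun ep => exists y, low_dim iota h e y /\ E y ep) <= _).
    by apply: Pr_le => ep [].
  apply: le_trans (PE h0 (leqnn h) (ltnW e2)) _; rewrite low_bound_total //.
  by rewrite -/X -(subnKC e2) exprD ler_piMr ?exprn_ge0 // exprn_ile1.
rewrite /X exprMn exprVn mulrA ler_pdivrMr ?exprn_gt0 //.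
rewrite [_^-1 * _]mulrC (expr2 p%:R) mulfK ?gt_eqF //.
rewrite -natrX -natrM ler_nat; apply: leq_trans hp.
apply: (@leq_trans ((9 * h) ^ r * ((9 * h) ^ r.+1) ^ 2)).
  apply: leq_mul; last by rewrite leq_exp2r.
  by rewrite ltn_exp2r //; lia.
by rewrite -expnM -expnD leq_pexp2l //; lia.
Qed.
End LowSum.

(** Here a is about p / (2h'). The translates (t div a, t mod a) in two coordinates have degree
    below 2a, so h' (2a + r) <= p lets their p-th powers fit in degree p^2 <= d; and p <= 8 h' a
    gives kappa = 8 h' for about a^2 translates. *)
Lemma ex_translate_range r h h' : (0 < r)%N -> (0 < h')%N -> (h' <= h)%N ->
  ((9 * h) ^ (3 * r + 2) <= p)%N ->
  exists a, [/\ (1 < a)%N, (h' * (2 * a + r) <= p)%N & (p <= 8 * h' * a)%N].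
Proof.
move=> r0 h'0 hh hp.
have p1 : (h' * (3 * r + 6) <= p)%N.
  apply: leq_trans hp; rewrite -[(3 * r + 2)%N]prednK ?addn2 // expnS.
  have : ((3 * r).+1 < (9 * h) ^ (3 * r).+1)%N by rewrite ltn_expl //; lia.
  move: ((9 * h) ^ (3 * r).+1)%N => w; nia.
have q1 : (3 * r + 6 <= p %/ h')%N by rewrite leq_divRL // mulnC.
have q2 := ltn_ceil p h'0; have q3 := leq_trunc_div p h'.
exists ((p %/ h' - r) %/ 2)%N; move: (p %/ h')%N q1 q2 q3 => q q1 q2 q3.
have := divn_eq (q - r) 2; have := ltn_pmod (q - r) (ltn0Sn 1).
move: ((q - r) %/ 2)%N ((q - r) %% 2)%N => a b b2 qa.
by split; nia.
Qed.

(** The number of translates has to be even, so a^2 is rounded down. *)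
Lemma half_sqr_bounds a : (1 < a)%N ->
  [/\ (0 < (a ^ 2) %/ 2)%N, (((a ^ 2) %/ 2).*2 <= a ^ 2)%N & (a ^ 2 <= ((a ^ 2) %/
      2).*2.+1)%N].
Proof.
move=> a1; have : (4 <= a ^ 2)%N by rewrite -[4%N]/(2 ^ 2)%N leq_exp2r.
by move: (a ^ 2)%N => b b4; split; lia.
Qed.

(** The bound adds up 9^(r+1) / p for the points over F_p, 1 / p for the others with coordinates of
    degree below e0, and 1 / p for those with a coordinate of degree at least e0. *)
Lemma Pr_singular_torus r d e0 : (2 <= r)%N -> (p ^ 2 <= d)%N -> (1 < e0)%N -> (e0 <=
    p)%N ->
  ((9 * e0.-1) ^ (3 * r + 2) <= p)%N -> (p * (2 * r ^ 2 * high_size r d ^ r) <= 2 ^ e0)%N ->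
  Pr R (fun ep : {ffun mon r d -> bool} => exists y : 'I_r -> Om,
    [/\ torus y, Fval ep y = 0 & forall l, Lval ep l y = 0]) <= (9 ^ r.+1 + 2)%:R / p%:R.
Proof.
move=> r2 pd e01 e0p hp high; set h := e0.-1 in hp.
have p0 := prime_gt0 p_pr; have r0 : (0 < r)%N by exact: ltnW.
have h0 : (0 < h)%N by rewrite /h -ltnS prednK // ltnW.
have he0 : e0 = h.+1 by rewrite /h prednK // ltnW.
have pOm : p \in [pchar Om].
  by apply/andP; split=> //; rewrite -(rmorph_nat iota) fmorph_eq0; have := pchar_Fp p_pr
      => /andP[].
have dM : (p * (d %/ p) <= d)%N by rewrite mulnC leq_trunc_div.
have e0M : (e0 <= d %/ p)%N by rewrite leq_divRL // (leq_trans _ pd) // leq_mul2r e0p orbT.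
have d0 : (0 < d)%N by apply: leq_trans pd; rewrite expn_gt0 p0.
pose E (y : 'I_r -> Om) (ep : {ffun mon r d -> bool}) := Fval ep y = 0 /\ forall l, Lval
    ep l y = 0.
apply: (le_trans (y := Pr R (@generic_singular p Om r d iota e0) +
  Pr R (fun ep => exists y, [/\ torus y, forall i, ~ generic_upto iota h.+1 (y i) & E y
      ep]))).
  apply: le_trans (Pr_or _ _ _); apply: Pr_le => ep [y [ty Fy Ly]].
  have [[j gj]|ng] := pselect (exists j, generic_upto iota e0 (y j)).
    by left; exists y; split=> //; exists j.
  by right; exists y; split=> // i gi; apply: ng; exists i; rewrite he0.
have p0' : 0 < p%:R :> R by rewrite ltr0n.
have -> : (9 ^ r.+1 + 2)%:R / p%:R = p%:R^-1 + (9%:R ^+ r.+1 / p%:R + p%:R^-1) :> R.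
  by rewrite natrD natrX; field; rewrite gt_eqF.
apply: lerD.
  apply: le_trans (Pr_generic_singular R p_odd pOm r dM iota e0M) _.
  have Eh : (perron_bound r d <= high_size r d ^ r)%N.
    apply: (@leq_trans (high_size r d)); last by rewrite -{1}[high_size r d]expn1
        leq_pexp2l.
    by rewrite /high_size mulnS; apply: leqW; exact: leq_addr.
  have -> : p%:R^-1 = (2 ^ e0)%:R / p%:R / 2 ^+ e0 :> R.
    by rewrite natrX mulrAC divff ?mul1r // gt_eqF // exp2_gt0.
  apply: (@le_trans _ _ ((2 * r ^ 2 * high_size r d ^ r)%:R / 2 ^+ e0)); last first.
    rewrite ler_pM2r ?invr_gt0 ?exp2_gt0 // ler_pdivlMr // mulrC -natrM ler_nat //.
  have -> : (2 * r ^ 2 * high_size r d ^ r)%:R / 2 ^+ e0 =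
      r%:R * ((r * high_size r d ^ r)%:R / 2 ^+ e0) + r%:R * ((r * high_size r d ^ r)%:R
          / 2 ^+ e0) :> R.
    rewrite -mulrDr -mulrDl mulrA; congr (_ / _); rewrite -natrD -natrM; congr (_%:R).
    by rewrite -mulnn; ring.
  apply: lerD; rewrite ler_pM2l ?ltr0n //.
    apply: ler_pM; rewrite ?ler0n ?invr_ge0 ?exprn_ge0 ?ler0n ?ler_nat ?leq_mul2l ?Eh
        ?orbT //.
    by rewrite lef_pV2 ?posrE ?exp2_gt0 // ler_weXn2l // ler1n.
  by rewrite ler_pM2r ?invr_gt0 ?exp2_gt0 // ler_nat leq_pmull.
apply: (Pr_low_total r0 hp) => // h' e h'0 hh e1.
have [a [a1 ha pa]] := ex_translate_range r0 h'0 hh hp.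
have [m0 ma am] := half_sqr_bounds a1; set m := ((a ^ 2) %/ 2)%N in m0 ma am.
have pm : (p ^ 2 <= (8 * h') ^ 2 * m.*2.+1)%N.
  apply: (@leq_trans ((8 * h' * a) ^ 2)); first by rewrite leq_exp2r.
  by rewrite expnMn leq_mul2l am orbT.
(* Here r >= 2 is essential: a single coordinate would give only about p / h' translates. *)
have [i0 [i1 i01]] : exists i0 i1 : 'I_r, i0 != i1 by exists (Ordinal r0), (Ordinal r2).
pose tau (t : 'I_(m.*2)) (l : 'I_r) : nat :=
  ((l == i0) * (t %/ a) + (l == i1) * (t %% a))%N.
have a0 : (0 < a)%N by exact: ltnW.
have ta (t : 'I_(m.*2)) : (t %/ a < a)%N.
  by rewrite ltn_divLR // mulnn (leq_trans (ltn_ord t)).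
apply: le_trans (Pr_low_dim iota p_pr R p_odd h'0 m0 (erefl _) pm (tau := tau) r0 _ _ e1).
- by apply: Pr_le => ep [y [ly [Fy Ly]]]; exists y.
- move=> t t' tt; apply/val_inj => /=.
  have := tt i0; have := tt i1; rewrite /tau !eqxx !mul1n.
  rewrite [i1 == i0]eq_sym (negPf i01).
  by rewrite !mul0n !add0n !addn0 => e1' e2'; rewrite (divn_eq t a) (divn_eq t' a) e1' e2'.
move=> t; apply: leq_trans pd; rewrite -mulnn leq_mul2l; apply/orP; right.
apply: leq_trans ha; rewrite mulnDr [(r * h')%N]mulnC leq_add2r leq_mul2l; apply/orP; right.
rewrite big_split /= (bigD1 i0) //= eqxx big1 => [|l /negPf -> //].
rewrite (bigD1 i1) //= eqxx big1 => [|l /negPf -> //].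
by rewrite !mul1n !addn0 mul2n -[X in (_ <= X)%N]addnn leq_add // ltnW // ltn_mod.
Qed.

Lemma Pr_common_zero d e0 : (p ^ 2 <= d)%N -> (1 < e0)%N -> (e0 <= p)%N ->
  ((9 * e0.-1) ^ (3 * 1 + 2) <= p)%N -> (p * d <= 2 ^ e0)%N ->
  Pr R (fun ep => exists2 x : Om, x != 0 & @common_zero Om d x ep) <= (9 ^ 2 + 2)%:R / p%:R.
Proof.
move=> pd e01 e0p hp high; set h := e0.-1 in hp.
have p0 := prime_gt0 p_pr.
have h0 : (0 < h)%N by rewrite /h -ltnS prednK // ltnW.
have he0 : e0 = h.+1 by rewrite /h prednK // ltnW.
have pd' : (p <= d)%N by apply: leq_trans pd; rewrite -mulnn leq_pmulr.
pose E (y : 'I_1 -> Om) ep := @common_zero Om d (y ord0) ep.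
apply: (le_trans (y := Pr R (fun ep => exists x, generic_upto iota e0 x /\ @common_zero
    Om d x ep) +
  Pr R (fun ep => exists y, [/\ torus y, forall i, ~ generic_upto iota h.+1 (y i) & E y
      ep]))).
  apply: le_trans (Pr_or _ _ _); apply: Pr_le => ep [x x0 zx].
  have [gx|ng] := pselect (generic_upto iota e0 x); first by left; exists x.
  by right; exists (fun=> x); split=> // i; rewrite -he0.
have p0' : 0 < p%:R :> R by rewrite ltr0n.
have -> : (9 ^ 2 + 2)%:R / p%:R = p%:R^-1 + (9%:R ^+ 2 / p%:R + p%:R^-1) :> R.
  by rewrite natrD natrX; field; rewrite gt_eqF.
apply: lerD.
  apply: le_trans (Pr_generic_common_zero iota p_pr R p_odd (leq_trans e0p pd')) _.
  rewrite ler_pdivrMr ?exp2_gt0 // mulrC ler_pdivlMr // mulrC -natrX -natrM ler_nat //.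
apply: (Pr_low_total (ltn0Sn 0) hp) => // h' e h'0 hh e1.
have [a [a1 ha pa]] := ex_translate_range (ltn0Sn 0) h'0 hh hp.
have dh : (2 <= d %/ h')%N.
  rewrite leq_divRL //; apply: leq_trans pd'; apply: leq_trans ha; nia.
(* T = 2m is about d / h'. The value 8 h' of kappa is generous here, and is the one expected by
   [Pr_low_total]. *)
pose m := ((d %/ h') %/ 2)%N.
have m0 : (0 < m)%N by rewrite divn_gt0.
have hT : (h' * m.*2 <= d)%N.
  apply: leq_trans (leq_trunc_div d h'); rewrite mulnC leq_mul2r; apply/orP; right; lia.
have pm : (p ^ 2 <= (8 * h') ^ 2 * m.*2.+1)%N.
  apply: leq_trans pd _; have := ltn_ceil d h'0.
  have : (d %/ h' <= m.*2.+1)%N by lia.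
  move: (d %/ h')%N (m.*2.+1)%N => x z xz dx; nia.
apply: le_trans (Pr_low_common_zero iota p_pr R p_odd h'0 hT m0 (erefl _) pm e1).
exact: Pr_le.
Qed.
End Assembly.

(** * Signed forms over the complex numbers *)

Notation hom n d := {a : {ffun 'I_n.+1 -> 'I_d.+1} | (\sum_i a i == d)%N}.

Section HomogeneousForms.
Variables (n d : nat).

Definition hexpo (a : hom n d) (i : 'I_n.+1) : nat := val a i.

Lemma hexpo_sum a : (\sum_i hexpo a i = d)%N.
Proof. exact/eqP/(valP a). Qed.

Section Values.
Variable K : fieldType.
Implicit Types (e : {ffun hom n d -> bool}) (Y : 'I_n.+1 -> K).

Definition hval e Y : K := \sum_a (-1) ^+ e a * \prod_i Y i ^+ hexpo a i.
(* The truncated subtraction is harmless: hexpo a k = 0 kills the term. *)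
Definition hder e k Y : K :=
  \sum_a (-1) ^+ e a * (hexpo a k)%:R * \prod_i Y i ^+ (hexpo a i - (i == k)).

Lemma hder_mul e k Y :
  Y k * hder e k Y = \sum_a (-1) ^+ e a * (hexpo a k)%:R * \prod_i Y i ^+ hexpo a i.
Proof.
rewrite mulr_sumr; apply: eq_bigr => a _; rewrite mulrCA.
have [->|ak] := posnP (hexpo a k); first by rewrite mulr0 !mul0r.
congr (_ * _); rewrite (bigD1 k) //= [RHS](bigD1 k) //= eqxx mulrA -exprS subn1 prednK //.
by congr (_ * _); apply: eq_bigr => i /negPf ->; rewrite subn0.
Qed.

(** In a chart, Euler's relation yields the vanishing of the one derivative that the Jacobian
    criterion there does not see. *)
Lemma hder_euler e Y : \sum_k Y k * hder e k Y = d%:R * hval e Y.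
Proof.
under eq_bigr do rewrite hder_mul; rewrite exchange_big mulr_sumr; apply: eq_bigr => a _ /=.
by rewrite -mulr_suml -mulr_sumr -natr_sum hexpo_sum -mulrA [RHS]mulrCA.
Qed.
End Values.

(** The field is arbitrary because [affine_smooth] tests points in all extension fields; the
    reduction to characteristic p asks nothing of K but characteristic 0. *)
Definition singular_form (e : {ffun hom n d -> bool}) :=
  exists K : fieldType, [pchar K] =i pred0 /\ exists Y : 'I_n.+1 -> K,
   [/\ exists i, Y i != 0, hval e Y = 0 & forall k, hder e k Y = 0].

Lemma card_hom : #|{: hom n d}| = 'C(n + d, n).
Proof.
rewrite card_sig -card_ord_partitions.
pose f (t : n.+1.-tuple 'I_d.+1) : {ffun 'I_n.+1 -> 'I_d.+1} := [ffun i => tnth t i].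
have f_inj : injective f.
  by move=> t t' /ffunP tt; apply: eq_from_tnth => i; have := tt i; rewrite !ffunE.
rewrite -(card_imset _ f_inj); apply: eq_card => a; apply/idP/imsetP => [sa|[t st ->]].
  exists [tuple a i | i < n.+1]; last by apply/ffunP => i; rewrite ffunE tnth_mktuple.
  rewrite finset.inE big_tuple; under eq_bigr do rewrite tnth_mktuple.
  exact: sa.
move: st; rewrite finset.inE big_tuple; rewrite -[f t \in _]/(\sum_i f t i == d)%N.
by under [X in _ -> is_true (X == _)]eq_bigr do rewrite ffunE.
Qed.
End HomogeneousForms.

(** * Comparison with multivariate polynomials and their charts *)

Module HypersurfaceForms.
Import mpoly Hypersurface.
Section Forms.
Variables (n d : nat).

Lemma bmon_subproof (a : hom n d) : (mdeg [multinom hexpo a i | i < n.+1] < d.+1)%N.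
Proof.
by rewrite mdegE ltnS; under eq_bigr do rewrite mnmE; rewrite hexpo_sum.
Qed.

Definition bmon (a : hom n d) : 'X_{1..n.+1 < d.+1} := BMultinom (bmon_subproof a).

Lemma bmonE a i : bmon a i = hexpo a i. Proof. exact: mnmE. Qed.

Lemma bmon_inj : injective bmon.
Proof.
move=> a b ab; apply/val_inj/ffunP => i; apply/val_inj.
have H : hexpo a i = hexpo b i by rewrite -!bmonE ab.
exact: H.
Qed.

Lemma bmon_codom (m : 'X_{1..n.+1 < d.+1}) : (mdeg m == d) = (m \in codom bmon).
Proof.
apply/idP/codomP => [/eqP md|[a ->]]; last first.
  by rewrite /= mdegE; under eq_bigr do rewrite mnmE; rewrite hexpo_sum.
have mi i : (m i <= d)%N by rewrite -[X in (_ <= X)%N]md mdegE (bigD1 i) //= leq_addr.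
have Pa : (\sum_i [ffun i => inord (m i) : 'I_d.+1] i == d)%N.
  rewrite -[X in _ == X]md mdegE; apply/eqP; apply: eq_bigr => i _.
  by rewrite ffunE inordK // ltnS.
exists (exist (fun a : {ffun 'I_n.+1 -> 'I_d.+1} => is_true (\sum_i a i == d)%N) _ Pa).
by apply/val_inj/mnmP => i; rewrite mnmE /hexpo /= ffunE inordK // ltnS.
Qed.

Lemma sum_bmon (V : nmodType) (G : 'X_{1..n.+1 < d.+1} -> V) :
  \sum_(m : 'X_{1..n.+1 < d.+1} | mdeg m == d) G m = \sum_(a : hom n d) G (bmon a).
Proof.
rewrite (eq_bigl (fun m => m \in (bmon @: finset (fun=> true)))) => [|m]; last first.
  rewrite bmon_codom; apply/codomP/imsetP => [[a ->]|[a _ ->]]; last by exists a.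
  by exists a; rewrite ?finset.in_set.
rewrite big_imset /=; last by move=> a b _ _; exact: bmon_inj.
by apply: eq_bigl => a; rewrite finset.in_set.
Qed.

Section Singularity.
Variables (C K : fieldType) (phi : {rmorphism C -> K}) (i0 : 'I_n.+1) (y : 'I_n -> K).

Definition chart_point (k : 'I_n.+1) : K := if unlift i0 k is Some j then y j else 1.

Lemma chart_point0 : chart_point i0 = 1. Proof. by rewrite /chart_point unlift_none. Qed.
Lemma chart_pointS j : chart_point (lift i0 j) = y j. Proof. by rewrite /chart_point
    liftK. Qed.

Lemma dehomogenizeX (m : 'X_{1..n.+1}) :
  dehomogenize i0 ('X_[m] : {mpoly C[n.+1]}) = 'X_[[multinom m (lift i0 j) | j < n]].
Proof.
rewrite /dehomogenize comp_mpolyX (bigD1_ord i0) //= tnth_mktuple unlift_none expr1n mul1r.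
rewrite mpolyXE_id; apply: eq_bigr => j _.
by rewrite tnth_mktuple liftK mnmE.
Qed.

Lemma mmap_dehomogenizeX (m : 'X_{1..n.+1}) :
  mmap phi y (dehomogenize i0 'X_[m]) = \prod_i chart_point i ^+ m i.
Proof.
rewrite dehomogenizeX mmapX /mmap1 (bigD1_ord i0) //= chart_point0 expr1n mul1r.
by apply: eq_bigr => j _; rewrite mnmE chart_pointS.
Qed.

Lemma mmap_deriv_dehomogenizeX (m : 'X_{1..n.+1}) j :
  mmap phi y (dehomogenize i0 'X_[m])^`M(j) =
  (m (lift i0 j))%:R * \prod_i chart_point i ^+ (m i - (i == lift i0 j)).
Proof.
rewrite dehomogenizeX mderivX mmapZ mmapX rmorph_nat mnmE; congr (_ * _).
rewrite /mmap1 [RHS](bigD1_ord i0) //= chart_point0 expr1n mul1r.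
apply: eq_bigr => l _; rewrite mnmBE mnmE mnm1E chart_pointS.
by rewrite (inj_eq lift_inj) eq_sym.
Qed.

Variable eps : {ffun 'X_{1..n.+1 < d.+1} -> bool}.
Let e : {ffun hom n d -> bool} := [ffun a => eps (bmon a)].

Lemma dehomogenize_form : dehomogenize i0 (signed_form C eps) =
  \sum_(a : hom n d) (-1) ^+ e a *: dehomogenize i0 'X_[bmon a].
Proof.
rewrite /signed_form sum_bmon /dehomogenize raddf_sum; apply: eq_bigr => a _.
by rewrite /= comp_mpolyZ ffunE.
Qed.

Lemma mmap_form : mmap phi y (dehomogenize i0 (signed_form C eps)) = hval e chart_point.
Proof.
rewrite dehomogenize_form raddf_sum /hval; apply: eq_bigr => a _.
rewrite /= mmapZ rmorph_sign mmap_dehomogenizeX; congr (_ * _).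
by apply: eq_bigr => i _; rewrite bmonE.
Qed.

Lemma mmap_deriv_form j :
  mmap phi y (dehomogenize i0 (signed_form C eps))^`M(j) = hder e (lift i0 j) chart_point.
Proof.
rewrite dehomogenize_form linear_sum (raddf_sum (mmap phi y)) /hder; apply: eq_bigr => a _.
rewrite /= mderivZ mmapZ rmorph_sign mmap_deriv_dehomogenizeX mulrA bmonE; congr (_ * _).
by apply: eq_bigr => i _; rewrite bmonE.
Qed.
End Singularity.

Lemma nonsmooth_singular (C : fieldType) (eps : {ffun 'X_{1..n.+1 < d.+1} -> bool}) :
  [pchar C] =i pred0 -> ~ projective_smooth (signed_form C eps) ->
  singular_form [ffun a : hom n d => eps (bmon a)].
Proof.
move=> C0 ns.
have [i0 [K [phi [y [fy dy]]]]] : exists i0 (K : fieldType) (phi : {rmorphism C -> K}) (y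
    : 'I_n -> K),
   mmap phi y (dehomogenize i0 (signed_form C eps)) = 0 /\
   forall j, mmap phi y (dehomogenize i0 (signed_form C eps))^`M(j) = 0.
  apply: contrapT => nex; apply: ns => i0 K phi y fy; apply: contrapT => nj; apply: nex.
  exists i0, K, phi, y; split=> // j; apply: contrapT => /eqP dj; apply: nj.
  by exists j.
exists K; split; first by move=> q; rewrite (fmorph_pchar phi).
exists (chart_point i0 y).
have hv : hval [ffun a : hom n d => eps (bmon a)] (chart_point i0 y) = 0 by rewrite
    -(mmap_form phi).
have hd j : hder [ffun a : hom n d => eps (bmon a)] (lift i0 j) (chart_point i0 y) = 0.
  by rewrite -(mmap_deriv_form phi).
split=> // [|k]; first by exists i0; rewrite chart_point0 oner_neq0.
case: (unliftP i0 k) => [j ->|->]; first exact: hd.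
have := hder_euler [ffun a : hom n d => eps (bmon a)] (chart_point i0 y).
rewrite hv mulr0 (bigD1_ord i0) //= chart_point0 mul1r => <-.
by rewrite big1 ?addr0 // => j _; rewrite hd mulr0.
Qed.

Section Counting.
Variable C : fieldType.
Hypothesis C0 : [pchar C] =i pred0.

Definition extend_signs (e : {ffun hom n d -> bool}) : {ffun 'X_{1..n.+1 < d.+1} -> bool} :=
  [ffun m => [exists a, (bmon a == m) && e a]].

Lemma extend_signsK e a : extend_signs e (bmon a) = e a.
Proof.
rewrite ffunE; apply/existsP/idP => [[b /andP[/eqP/bmon_inj -> //]]|ea].
by exists a; rewrite eqxx.
Qed.

Definition hform (e : {ffun hom n d -> bool}) := signed_form C (extend_signs e).

Lemma hform_restrict eps : signed_form C eps = hform [ffun a => eps (bmon a)].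
Proof.
by rewrite /hform /signed_form !sum_bmon; apply: eq_bigr => a _; rewrite extend_signsK
    ffunE.
Qed.

(** Coefficients are signs and 1 != -1 in characteristic 0. Hence the set of forms is counted by the
    sign families on the monomials of degree d. *)
Lemma hform_inj : injective hform.
Proof.
move=> e e' ee; apply/ffunP => a.
have cE u : (hform u)@_(bmon a) = (-1) ^+ u a.
  rewrite /hform /signed_form sum_bmon raddf_sum (bigD1 a) //= big1 ?addr0 => [|b ba].
    by rewrite mcoeffZ mcoeffX eqxx mulr1 extend_signsK.
  rewrite mcoeffZ mcoeffX (_ : (_ == _) = false) ?mulr0 //.
  by apply: contraNF ba => /eqP ba; apply/eqP/bmon_inj/val_inj.
have := cE e; rewrite ee cE => /eqP.
have n1 : (1 == -1 :> C) = false.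
  by rewrite -subr_eq0 opprK ((pcharf0P C).1 C0 2).
by case: (e a) (e' a) => [] []; rewrite ?expr0 ?expr1 // ?n1 // eq_sym n1.
Qed.

Lemma hform_singular e : ~ projective_smooth (hform e) -> singular_form e.
Proof.
move=> /(nonsmooth_singular C0); suff -> : [ffun a : hom n d => extend_signs e (bmon a)]
    = e by [].
by apply/ffunP => a; rewrite ffunE extend_signsK.
Qed.

Lemma count_smooth_forms :
  let s := #|` [fset f in signed_forms C d n | `[< projective_smooth f >] ]%fset| in
  (s <= 2 ^ 'C(n + d, n))%N /\
  (2 ^ 'C(n + d, n) <= s + #|[pred e : {ffun hom n d -> bool} | `[< singular_form e >]]|)%N.
Proof.
set S := [fset f in _ | _]%fset; have cT : #|{ffun hom n d -> bool}| = (2 ^ 'C(n + d, n))%N.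
  by rewrite card_ffun card_bool card_hom.
split.
  rewrite -cT cardT -(size_map hform); apply: uniq_leq_size; first exact: fset_uniq.
  move=> f; rewrite !inE /= => /andP[/imfsetP[eps _ ->] _].
  by rewrite hform_restrict map_f // mem_enum.
pose E := [pred e | `[< projective_smooth (hform e) >]].
have -> : (2 ^ 'C(n + d, n) = #|E| + #|[predC E]|)%N by rewrite cardC cT.
apply: leq_add.
  rewrite cardE -(size_map hform); apply: uniq_leq_size.
    by rewrite map_inj_uniq ?enum_uniq //; exact: hform_inj.
  move=> f /mapP[e]; rewrite mem_enum => Ee ->; rewrite !inE /=; apply/andP; split=> //.
  by apply/imfsetP; exists (extend_signs e).
apply: subset_leq_card; apply/fintype.subsetP => e; rewrite !finset.inE => /asboolPn ns.
by apply/asboolP; exact: hform_singular.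
Qed.
End Counting.
End Forms.
End HypersurfaceForms.

(** * Stratification by support *)

Lemma sum_codom (A B : finType) (V : nmodType) (f : A -> B) (F : B -> V) :
  injective f -> (forall b, b \notin codom f -> F b = 0) ->
  \sum_b F b = \sum_a F (f a).
Proof.
move=> f_inj F0; rewrite (bigID (fun b => b \in codom f)) /= [X in _ + X]big1 // addr0.
rewrite (eq_bigl (fun b => b \in (f @: finset (fun=> true)))) => [|b]; last first.
  apply/codomP/imsetP => [[a ->]|[a _ ->]]; last by exists a.
  by exists a; rewrite ?finset.in_set.
rewrite big_imset /=; last by move=> a b _ _; exact: f_inj.
by apply: eq_bigl => a; rewrite finset.in_set.
Qed.

Section HomOf.
Variables (n d : nat).

Lemma hom_subproof : (\sum_i ([ffun i => if i == ord0 then ord_max else ord0] :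
  {ffun 'I_n.+1 -> 'I_d.+1}) i == d)%N.
Proof.
rewrite (bigD1 ord0) //= ffunE eqxx big1 ?addn0 // => i /negPf i0.
by rewrite ffunE i0.
Qed.

(* An arbitrary monomial when the sum of a is not d. *)
Definition hom_of (a : 'I_n.+1 -> nat) : hom n d :=
  insubd (exist (fun a : {ffun 'I_n.+1 -> 'I_d.+1} => is_true (\sum_i a i == d)%N) _
      hom_subproof)
    [ffun i => inord (a i)].

Lemma hom_ofE a i : (\sum_i a i = d)%N -> hexpo (hom_of a) i = a i.
Proof.
move=> ad; have aid j : (a j <= d)%N by rewrite -ad (bigD1 j) //= leq_addr.
rewrite /hexpo /hom_of insubdK; first by rewrite ffunE inordK // ltnS.
rewrite -[_ \in _]/(\sum_i [ffun i => inord (a i) : 'I_d.+1] i == d)%N -[X in _ == X]ad;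
    apply/eqP.
by apply: eq_bigr => j _; rewrite ffunE inordK // ltnS.
Qed.

Lemma hom_eq (a b : hom n d) : (forall i, hexpo a i = hexpo b i) -> a = b.
Proof. by move=> ab; apply/val_inj/ffunP => i; apply/val_inj; exact: ab. Qed.

Lemma sum_delta (j : 'I_n.+1) k : (\sum_(i < n.+1) (i == j) * k = k)%N.
Proof. by rewrite (bigD1 j) //= eqxx mul1n big1 ?addn0 // => i /negPf ->. Qed.

Lemma prod_delta (K : fieldType) (z : 'I_n.+1 -> K) (j : 'I_n.+1) k :
  \prod_i z i ^+ ((i == j) * k) = z j ^+ k.
Proof.
rewrite (bigD1 j) //= eqxx mul1n big1 ?mulr1 // => i /negPf ->.
by rewrite expr0.
Qed.

Section Reduction.
Variable Om : fieldType.
Hypothesis closedOm : forall P : {poly Om}, size P != 1 -> exists w, root P w.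

(** [None] indexes the form and [Some k] its derivatives. The form has to be kept, since in
    characteristic p Euler's relation does not recover it from the derivatives when p divides d. *)
Lemma singular_form_reduction (e : {ffun hom n d -> bool}) : singular_form e ->
  exists z : 'I_n.+1 -> Om, [/\ exists s, z s = 1, hval e z = 0 & forall k, hder e k z = 0].
Proof.
move=> [K [K0 [Y [Y0 fY dY]]]].
pose c (t : option 'I_n.+1) (a : hom n d) : int :=
  (-1) ^+ e a * (if t is Some k then (hexpo a k)%:Z else 1).
pose M (t : option 'I_n.+1) (a : hom n d) (i : 'I_n.+1) : nat :=
  if t is Some k then (hexpo a i - (i == k))%N else hexpo a i.
pose dg (t : option 'I_n.+1) : nat := if t is Some k then d.-1 else d.
have cM (F : fieldType) (w : 'I_n.+1 -> F) t :
  \sum_a (c t a)%:~R * \prod_i w i ^+ M t a i = if t is Some k then hder e k w else hval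
      e w.
  case: t => [k|]; apply: eq_bigr => a _; rewrite /c rmorphM rmorph_sign //=.
  by rewrite mulr1.
have [||z [zs zP]] := @integer_point_reduction K Om 'I_n.+1 (hom n d) (option 'I_n.+1) c
    M dg Y K0 closedOm Y0.
- case=> [k|] a ca; last exact: hexpo_sum.
  have ak : (0 < hexpo a k)%N.
    by rewrite lt0n; apply: contraNneq ca => ak; rewrite /c ak mulr0.
  rewrite /M /dg -{2}(hexpo_sum a) (bigD1 k) //= [X in _ = X.-1](bigD1 k) //= eqxx.
  rewrite (eq_bigr (fun i => hexpo a i)) => [|i /negPf ->]; last by rewrite subn0.
  by move: ak; case: (hexpo a k) => // b _; rewrite subn1 addSn.
- by move=> t; rewrite cM; case: t.
by exists z; split=> // [|k]; [have := zP None|have := zP (Some k)]; rewrite cM.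
Qed.

(** * Restriction to a coordinate subspace *)

Section Face.
Variables (r : nat) (s : 'I_n.+1) (sg : 'I_r -> 'I_n.+1).
Hypothesis sg_inj : injective sg.
Hypothesis sg_s : forall l, sg l != s.

(** The homogenization of m: x_s takes the degree that is missing. *)
Definition face_expo (m : mon r d) (i : 'I_n.+1) : nat :=
  ((i == s) * (d - \sum_l expo m l) + \sum_l (i == sg l) * expo m l)%N.

Definition face_hom m := hom_of (face_expo m).

Lemma face_homE m i : hexpo (face_hom m) i = face_expo m i.
Proof.
rewrite hom_ofE // big_split /= sum_delta exchange_big /=.
under [X in (_ + X)%N]eq_bigr do rewrite sum_delta.
by rewrite subnK //; exact: (valP m).
Qed.

Lemma face_expo_sg m l : face_expo m (sg l) = expo m l.
Proof.
rewrite /face_expo (negPf (sg_s l)) mul0n add0n (bigD1 l) //= eqxx mul1n big1 ?addn0 //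
    => k kl.
by rewrite (inj_eq sg_inj) eq_sym (negPf kl).
Qed.

Lemma face_hom_inj : injective face_hom.
Proof.
move=> a b ab; apply/val_inj/ffunP => l; apply/val_inj.
have H : expo a l = expo b l by rewrite -!face_expo_sg -!face_homE ab.
exact: H.
Qed.

Lemma face_prod (z : 'I_n.+1 -> Om) m : z s = 1 ->
  \prod_i z i ^+ hexpo (face_hom m) i = \prod_l z (sg l) ^+ expo m l.
Proof.
move=> zs; under eq_bigr do rewrite face_homE /face_expo exprD.
rewrite big_split /= prod_delta zs expr1n mul1r.
under eq_bigr do rewrite -prodrXr.
by rewrite exchange_big /=; apply: eq_bigr => l _; rewrite prod_delta.
Qed.

(** A monomial of degree d off the image involves a variable outside the face, and z vanishes
    there. *)
Lemma face_codom (z : 'I_n.+1 -> Om) a :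
  (forall i, z i != 0 -> i = s \/ exists l, i = sg l) ->
  a \notin codom face_hom -> \prod_i z i ^+ hexpo a i = 0.
Proof.
move=> zS na; apply: contraNeq na => az.
have a0 i : i != s -> (forall l, i != sg l) -> hexpo a i = 0%N.
  move=> is_ il; have zi : z i = 0.
    apply/eqP; apply: contraT => /zS[ii|[l ll]]; first by rewrite ii eqxx in is_.
    by have := il l; rewrite ll eqxx.
  apply/eqP; rewrite -leqn0 leqNgt; apply: contra az => ai.
  by rewrite (bigD1 i) //= zi expr0n gtn_eqF // mul0r.
have S : (hexpo a s + \sum_l hexpo a (sg l) = d)%N.
  rewrite -[RHS](hexpo_sum a) (bigD1 s) //=; congr (_ + _)%N.
  rewrite (bigID (fun i => i \in codom sg)) /= [X in (_ + X)%N]big1 ?addn0; last first.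
    move=> i /andP[is_ nc]; apply: a0 => // l; apply: contraNneq nc => ->; exact: codom_f.
  rewrite (eq_bigl (fun i => i \in (sg @: finset (fun=> true)))) => [|i].
    rewrite big_imset /=; last by move=> u v _ _; exact: sg_inj.
    by apply: eq_bigl => l; rewrite finset.in_set.
  apply/andP/imsetP => [[_ /codomP[l ->]]|[l _ ->]]; first by exists l; rewrite
      ?finset.in_set.
  by rewrite codom_f sg_s.
have Sd : (\sum_l hexpo a (sg l) <= d)%N by rewrite -[X in (_ <= X)%N]S leq_addl.
apply/codomP; exists (mon_of d (fun l => hexpo a (sg l))); apply: hom_eq => i.
have E l : expo (mon_of d (fun l => hexpo a (sg l))) l = hexpo a (sg l) by exact: mon_ofE.
rewrite face_homE; have [->|is_] := eqVneq i s.
  rewrite /face_expo eqxx mul1n [X in (_ + X)%N]big1 ?addn0.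
    by under eq_bigr do rewrite E; rewrite -[X in (X - _)%N]S addnK.
  by move=> l _; rewrite eq_sym (negPf (sg_s l)).
have [[l ->]|nl] := pselect (exists l, i = sg l); first by rewrite face_expo_sg E.
rewrite a0 //; last by move=> l; apply: contra_notN nl => /eqP; exists l.
rewrite /face_expo (negPf is_) mul0n add0n big1 // => l _.
by case: eqP => // il; case: nl; exists l.
Qed.

Lemma face_values (z : 'I_n.+1 -> Om) (e : {ffun hom n d -> bool}) : z s = 1 ->
  (forall i, z i != 0 -> i = s \/ exists l, i = sg l) ->
  hval e z = 0 -> (forall k, hder e k z = 0) ->
  Fval [ffun m => e (face_hom m)] (fun l => z (sg l)) = 0 /\
  forall l, Lval [ffun m => e (face_hom m)] l (fun l => z (sg l)) = 0.
Proof.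
move=> zs zS fz dz; split.
  rewrite -[RHS]fz /hval (sum_codom face_hom_inj) => [|a na].
    by apply: eq_bigr => m _; rewrite ffunE face_prod.
  by rewrite face_codom // mulr0.
move=> l; transitivity (z (sg l) * hder e (sg l) z); last by rewrite dz mulr0.
rewrite hder_mul (sum_codom face_hom_inj) => [|a na].
  by apply: eq_bigr => m _; rewrite ffunE face_prod // face_homE face_expo_sg.
by rewrite face_codom // mulr0.
Qed.
End Face.

(** * Restriction to a line, and a transverse derivative *)

Section Line.
Variables (s t c : 'I_n.+1).
Hypotheses (st : s != t) (sc : s != c) (tc : t != c).

(* inl k is the monomial x_s^(d-k) x_t^k, and inr k the monomial
   x_s^(d-1-k) x_t^k x_c, seen by the derivative along x_c. *)
Definition edge_expo (u : 'I_d.+1 + 'I_d) (i : 'I_n.+1) : nat :=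
  match u with
  | inl k => ((i == s) * (d - k) + (i == t) * k)%N
  | inr k => ((i == s) * (d - k.+1) + (i == t) * k + (i == c) * 1)%N
  end.

Definition edge_hom u := hom_of (edge_expo u).

Lemma edge_homE u i : hexpo (edge_hom u) i = edge_expo u i.
Proof.
rewrite hom_ofE //; case: u => k /=; rewrite !big_split /= !sum_delta.
  by rewrite subnK // -ltnS.
by rewrite -addnA addn1 subnK.
Qed.

Lemma edge_expo_t u : edge_expo u t = match u with inl k => k : nat | inr k => k end.
Proof.
by case: u => k /=; rewrite eqxx [t == s]eq_sym (negPf st) ?(negPf tc) !mul0n mul1n ?addn0.
Qed.

Lemma edge_expo_c u : edge_expo u c = if u is inr _ then 1%N else 0%N.
Proof.
by case: u => k /=; rewrite [c == s]eq_sym [c == t]eq_sym (negPf sc) (negPf tc) ?eqxx.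
Qed.

Lemma edge_hom_inj : injective edge_hom.
Proof.
move=> u v uv; have H i : edge_expo u i = edge_expo v i by rewrite -!edge_homE uv.
have := H t; have := H c; rewrite !edge_expo_t !edge_expo_c.
by case: u v {uv H} => k [] l //= _ kl; congr (_ _); apply/val_inj.
Qed.

(** On the line x_c = 0, so the derivative along x_c only sees monomials of degree 1 in x_c. Their
    signs are disjoint from those of the restriction of f, which makes the two forms independent. *)
Lemma edge_values (z : 'I_n.+1 -> Om) (e : {ffun hom n d -> bool}) : z s = 1 ->
  (forall i, z i != 0 -> i = s \/ i = t) ->
  hval e z = 0 -> hder e c z = 0 ->
  common_zero (z t) [ffun u => e (edge_hom u)].
Proof.
move=> zs zS fz dz.
have z0 i : i != s -> i != t -> z i = 0.
  by move=> is_ it; apply/eqP; apply: contraT => /zS[] ii; [rewrite ii eqxx in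
      is_|rewrite ii eqxx in it].
have zc : z c = 0 by apply: z0; rewrite eq_sym.
have vanish (M : 'I_n.+1 -> nat) : \prod_i z i ^+ M i != 0 -> forall i, i != s -> i != t
    -> M i = 0%N.
  move=> Mz i is_ it; apply/eqP; rewrite -leqn0 leqNgt; apply: contra Mz => Mi.
  by rewrite (bigD1 i) //= (z0 i is_ it) expr0n gtn_eqF // mul0r.
split.
  rewrite -[RHS]fz /signed_sum big_sumType /= [X in _ + X]big1 ?addr0 => [|k _]; last by
      rewrite mulr0.
  have inl_inj : injective (edge_hom \o inl) by move=> k l /edge_hom_inj[].
  rewrite /hval (sum_codom inl_inj) => [|a na].
    apply: eq_bigr => k _; rewrite ffunE; congr (_ * _).
    under eq_bigr do rewrite edge_homE /= exprD.
    by rewrite big_split /= !prod_delta zs expr1n mul1r.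
  suff -> : \prod_i z i ^+ hexpo a i = 0 by rewrite mulr0.
  apply: contraNeq na => /vanish a0.
  have S : (hexpo a s + hexpo a t = d)%N.
    rewrite -[RHS](hexpo_sum a) (bigD1 s) //= (bigD1 t) //= 1?eq_sym //.
    by rewrite [X in (_ + (_ + X))%N]big1 ?addn0 // => i /andP[is_ it]; exact: a0.
  have kd : (hexpo a t < d.+1)%N by rewrite ltnS -[X in (_ <= X)%N]S leq_addl.
  apply/codomP; exists (Ordinal kd); apply: hom_eq => i; rewrite edge_homE /=.
  have [->|is_] := eqVneq i s.
    by rewrite (negPf st) mul1n mul0n addn0 -[X in (X - _)%N]S addnK.
  by have [->|it] := eqVneq i t; [rewrite mul0n mul1n|rewrite a0].
rewrite -[RHS]dz /signed_sum big_sumType /= [X in X + _]big1 ?add0r => [|k _]; last by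
    rewrite mulr0.
have inr_inj : injective (edge_hom \o inr) by move=> k l /edge_hom_inj[].
rewrite /hder (sum_codom inr_inj) => [|a na].
  apply: eq_bigr => k _; rewrite ffunE -mulrA; congr (_ * _).
  rewrite edge_homE edge_expo_c mul1r.
  transitivity (\prod_i z i ^+ ((i == s) * (d - k.+1) + (i == t) * k)).
    by under eq_bigr do rewrite exprD; rewrite big_split /= !prod_delta zs expr1n mul1r.
  apply: eq_bigr => i _; congr (_ ^+ _); rewrite edge_homE /= muln1 addnK //.
have [ac|ac] := posnP (hexpo a c); first by rewrite ac mulr0 mul0r.
suff -> : \prod_i z i ^+ (hexpo a i - (i == c)) = 0 by rewrite mulr0.
apply: contraNeq na => /vanish a0.
have ac1 : hexpo a c = 1%N.
  have := a0 c; rewrite eqxx eq_sym sc eq_sym tc => /(_ isT isT); lia.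
have a0' i : i != s -> i != t -> i != c -> hexpo a i = 0%N.
  by move=> is_ it /negPf ic; have := a0 i is_ it; rewrite ic subn0.
have S : (hexpo a s + hexpo a t + 1 = d)%N.
  rewrite -[RHS](hexpo_sum a) (bigD1 s) //= (bigD1 t) //= 1?eq_sym //.
  rewrite (bigD1 c) /=; last by rewrite ![c == _]eq_sym sc tc.
  by rewrite ac1 [X in (_ + (_ + (_ + X)))%N]big1 ?addn0 ?addnA // => i /andP[/andP[is_
      it] ic]; exact: a0'.
have kd : (hexpo a t < d)%N by rewrite -[X in (_ < X)%N]S addn1 ltnS leq_addl.
apply/codomP; exists (Ordinal kd); apply: hom_eq => i; rewrite edge_homE /=.
have [->|is_] := eqVneq i s.
  rewrite (negPf st) (negPf sc) mul1n !mul0n !addn0; lia.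
have [->|it] := eqVneq i t; first by rewrite (negPf tc) mul0n mul1n mul0n addn0.
by have [->|ic] := eqVneq i c; [rewrite ac1|rewrite a0'].
Qed.
End Line.

(** The support of z consists of s, where z is 1, and of the image of sg. The configurations range
    over finite types whose size depends only on n, ready for a union bound. *)
Lemma singular_form_cases (e : {ffun hom n d -> bool}) : (2 <= n)%N -> singular_form e ->
  (exists stc : 'I_n.+1 * 'I_n.+1 * 'I_n.+1,
     [/\ stc.1.1 != stc.1.2, stc.1.1 != stc.2, stc.1.2 != stc.2 &
      exists2 x : Om, x != 0 & common_zero x [ffun u => e (edge_hom stc.1.1 stc.1.2 stc.2
          u)]])
  \/ (exists r : 'I_n.+1, exists ss : 'I_n.+1 * {ffun 'I_r -> 'I_n.+1},
     [/\ (2 <= r)%N, injective ss.2, forall l, ss.2 l != ss.1 &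
      exists y : 'I_r -> Om, [/\ torus y, Fval [ffun m => e (face_hom ss.1 ss.2 m)] y = 0 &
        forall l, Lval [ffun m => e (face_hom ss.1 ss.2 m)] l y = 0]]).
Proof.
move=> n2 /singular_form_reduction [z [[s zs] fz dz]].
pose S := finset (fun i => (z i != 0) && (i != s)).
pose sg (l : 'I_#|S|) : 'I_n.+1 := enum_val l.
have sgS l : (z (sg l) != 0) && (sg l != s) by have := enum_valP l; rewrite finset.inE.
have sg_inj : injective sg by exact: enum_val_inj.
have sg_s l : sg l != s by have /andP[] := sgS l.
have zS i : z i != 0 -> i = s \/ exists l, i = sg l.
  move=> zi; have [->|is_] := eqVneq i s; [by left|right].
  have iS : i \in S by rewrite finset.inE zi.
  by exists (enum_rank_in iS i); rewrite /sg enum_rankK_in.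
have Sn : (#|S| < n.+1)%N.
  rewrite -[X in (_ < X)%N](card_ord n.+1) -cardsT; apply: proper_card; apply/properP.
  by split; [exact: finset.subsetT|exists s; rewrite !finset.inE ?eqxx ?andbF].
have [F0 L0] := face_values sg_inj sg_s zs zS fz dz.
have [r2|] := leqP 2 #|S|.
  right; exists (Ordinal Sn), (s, [ffun l => sg l]) => /=; split=> //.
  - by move=> l l'; rewrite !ffunE => /sg_inj.
  - by move=> l; rewrite ffunE.
  exists (fun l => z (sg l)); split.
  - by move=> l; have /andP[] := sgS l.
  - rewrite -[RHS]F0; congr Fval; apply/ffunP => m; rewrite !ffunE; congr (e (hom_of _)).
    by apply/funext => i; rewrite /face_expo; congr (_ + _)%N; apply: eq_bigr => l' _;
        rewrite ffunE.
  - move=> l; rewrite -[RHS](L0 l); congr Lval; apply/ffunP => m; rewrite !ffunE; congr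
      (e (hom_of _)).
    by apply/funext => i; rewrite /face_expo; congr (_ + _)%N; apply: eq_bigr => l' _;
        rewrite ffunE.
rewrite ltnS leq_eqVlt ltnS leqn0 => /orP[S1|S0].
  left; have l0 : 'I_#|S| by rewrite (eqP S1); exact: ord0.
  have all1 (l : 'I_#|S|) : nat_of_ord l = 0%N.
    by have := ltn_ord l; rewrite [X in (_ < X)%N](eqP S1); case: (nat_of_ord l).
  pose t := sg l0; have tS i : z i != 0 -> i = s \/ i = t.
    move=> /zS[->|[l ->]]; [by left|right; congr sg; apply/val_inj].
    by rewrite /= !all1.
  have st : s != t by rewrite eq_sym sg_s.
  (* A third coordinate exists because n >= 2. *)
  have [c [sc tc]] : exists c : 'I_n.+1, s != c /\ t != c.
    have : (0 < #|~: [set s; t]|)%N.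
      by rewrite cardsCs finset.setCK cards2 st card_ord; lia.
    move=> /card_gt0P[c]; rewrite !finset.inE negb_or => /andP[cs ct].
    by exists c; rewrite ![_ == c]eq_sym.
  exists (s, t, c) => /=; split=> //; exists (z t); first by have /andP[] := sgS l0.
  exact: edge_values.
exfalso; move: F0; rewrite /Fval.
have no (l : 'I_#|S|) : False by have := ltn_ord l; rewrite [X in (_ < X)%N](eqP S0).
rewrite (big_pred1 (mon_of d (fun=> 0%N))) => [|m]; last first.
  by apply/esym/eqP/val_inj/ffunP => l; case: (no l).
rewrite big1 ?mulr1; last by move=> l; case: (no l).
by move/eqP; rewrite signr_eq0.
Qed.
End Reduction.
End HomOf.

(** * Choice of the prime *)

Section SingularProbability.
Variables (R : realFieldType) (p : nat).
Hypotheses (p_pr : prime p) (p_odd : odd p).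

Lemma ex_closed_field : exists (Om : fieldType) (iota : {rmorphism 'F_p -> Om}),
  forall P : {poly Om}, size P != 1%N -> exists w, root P w.
Proof.
have [Om [iota _]] := countable_algebraic_closure 'F_p.
by exists Om, iota => P sP; apply/closed_rootP.
Qed.

Lemma Pr_singular_form n d e0 : (2 <= n)%N -> (p ^ 2 <= d)%N -> (1 < e0)%N -> (e0 <= p)%N ->
  ((9 * e0.-1) ^ (3 * n + 2) <= p)%N -> (p * d <= 2 ^ e0)%N ->
  (forall r, (2 <= r <= n)%N -> (p * (2 * r ^ 2 * high_size r d ^ r) <= 2 ^ e0)%N) ->
  Pr R (@singular_form n d) <= (n.+1 ^ 3 * (9 ^ n.+1 + 2) + n.+1 * (n.+1 ^ n.+1 * (9 ^
      n.+1 + 2)))%:R / p%:R.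
Proof.
move=> n2 pd e01 e0p hp pd2 high.
have [Om [iota closedOm]] := ex_closed_field.
have p0 : 0 < p%:R :> R by rewrite ltr0n prime_gt0.
have hp' r : (1 <= r <= n)%N -> ((9 * e0.-1) ^ (3 * r + 2) <= p)%N.
  move=> /andP[r1 rn]; apply: leq_trans hp; rewrite leq_pexp2l //; last lia.
  by rewrite muln_gt0 /=; lia.
apply: le_trans (Pr_le _ (fun e => singular_form_cases closedOm n2)) _.
apply: le_trans (Pr_or _ _ _) _; rewrite natrD mulrDl; apply: lerD.
  apply: le_trans (Pr_exists_const (q := (9 ^ n.+1 + 2)%:R / p%:R) _) _.
    move=> [[s t] c] /=; have [/and3P[st sc tc]|nd] := boolP [&& s != t, s != c & t !=
        c]; last first.
      apply: (Pr_card (k := 0)); last by rewrite mulr_ge0 ?divr_ge0 ?ler0n ?exprn_ge0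
          ?ler0n.
      rewrite leqn0; apply/eqP/eq_card0 => e; rewrite finset.inE; apply/negbTE/asboolP =>
          -[st sc tc _].
      by case/negP: nd; apply/and3P.
    apply: le_trans (_ : Pr R (fun e : {ffun hom n d -> bool} => exists2 x : Om, x != 0 &
        common_zero x [ffun u => e (edge_hom s t c u)]) <= _).
      by apply: Pr_le => e [].
    apply: le_trans (Pr_pullback R (edge_hom_inj (d := d) st sc tc) (fun e => exists2 x :
        Om, x != 0 & common_zero x e)) _.
    apply: le_trans (Pr_common_zero iota p_pr R p_odd pd e01 e0p (hp' 1%N _) pd2) _;
        first by apply/andP; split=> //; exact: ltnW.
    by rewrite ler_pM2r ?invr_gt0 // ler_nat leq_add2r leq_pexp2l // ltnW.
  by rewrite !card_prod card_ord mulrA -natrM (_ : (n.+1 ^ 3 = n.+1 * n.+1 * n.+1)%N) //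
      !expnS expn0 muln1 mulnA.
apply: le_trans (Pr_exists_ord (q := (n.+1 ^ n.+1 * (9 ^ n.+1 + 2))%:R / p%:R) _) _.
  move=> r; have rn : (r <= n)%N by rewrite -ltnS.
  have [r2|r2] := leqP 2 r; last first.
    apply: (Pr_card (k := 0)); last by rewrite mulr_ge0 ?divr_ge0 ?ler0n ?exprn_ge0 ?ler0n.
    rewrite leqn0; apply/eqP/eq_card0 => e; rewrite finset.inE; apply/negbTE/asboolP =>
        -[ss []] //.
  apply: le_trans (Pr_exists_const (q := (9 ^ n.+1 + 2)%:R / p%:R) _) _.
    move=> [s sg] /=; have [[sg_inj sg_s]|nd] := pselect (injective sg /\ forall l, sg l
        != s); last first.
      apply: (Pr_card (k := 0)); last by rewrite mulr_ge0 ?divr_ge0 ?ler0n ?exprn_ge0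
          ?ler0n.
      rewrite leqn0; apply/eqP/eq_card0 => e; rewrite finset.inE; apply/negbTE/asboolP =>
          -[_ i1 i2 _].
      by case: nd.
    apply: le_trans (_ : Pr R (fun e : {ffun hom n d -> bool} => exists y : 'I_r -> Om,
        [/\ torus y, Fval [ffun m => e (face_hom s sg m)] y = 0 &
        forall l, Lval [ffun m => e (face_hom s sg m)] l y = 0]) <= _).
      by apply: Pr_le => e [].
    apply: le_trans (Pr_pullback R (face_hom_inj (d := d) sg_inj sg_s) (fun e => exists y
        : 'I_r -> Om, [/\ torus y, Fval e y = 0 &
        forall l, Lval e l y = 0])) _.
    apply: le_trans (Pr_singular_torus iota p_pr R p_odd r2 pd e01 e0p (hp' r _) (high r
        _)) _.
    - by rewrite rn ltnW.
    - by rewrite rn r2.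
    by rewrite ler_pM2r ?invr_gt0 // ler_nat leq_add2r leq_pexp2l.
  rewrite card_prod card_ffun !card_ord mulrA -natrM ler_pM2r ?invr_gt0 // ler_nat.
  by rewrite leq_mul2r -expnS leq_pexp2l ?orbT.
by rewrite mulrA -natrM.
Qed.
End SingularProbability.

(** * Growth estimates *)

Section Numerics.
Local Open Scope nat_scope.

(** With q = floor (L / 2k), C L <= 2k C (q + 1) <= 2^q 2^q once q > 2k C, because q < 2^q. *)
Lemma power_le_exp2 C k : exists L0, forall L, L0 <= L -> (C * L) ^ k <= 2 ^ L.
Proof.
have [->|k0] := posnP k; first by exists 0 => L _; rewrite expn0 expn_gt0.
exists (2 * k * (2 * k * C).+1) => L LL.
set q := L %/ (2 * k).
have k20 : 0 < 2 * k by rewrite muln_gt0.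
have q1 : 2 * k * C < q by rewrite leq_divRL // mulnC.
apply: (@leq_trans ((2 ^ (2 * q)) ^ k)).
  rewrite leq_exp2r // mul2n -addnn expnD.
  have L1 : L < q.+1 * (2 * k) by exact: ltn_ceil.
  have qe : q < 2 ^ q by exact: ltn_expl.
  move: (2 ^ q) qe => w qw.
  apply: (@leq_trans (2 * k * C * q.+1)); first by nia.
  by apply: leq_mul => //; lia.
by rewrite -expnM leq_exp2l // mulnAC mulnC leq_trunc_div.
Qed.

Lemma high_size_le n r d p : 2 <= r -> r <= n -> 16 * p ^ 2 >= d -> 0 < d -> n.+2 <= p ->
    16 <= p ->
  p * (2 * r ^ 2 * high_size r d ^ r) <= p ^ ((5 * n + 7) * n + 4).
Proof.
move=> r2 rn dp d0 np p16.
have p0 : 0 < p by lia.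
have d3 : d <= p ^ 3 by apply: leq_trans dp _; rewrite [p ^ 3]expnS leq_mul2r p16 orbT.
have d4 : d.+1 <= p ^ 4.
  rewrite expnS; move: (p ^ 3) d3 => w; nia.
have pb : perron_bound r d <= p ^ (5 * n + 1).
  rewrite /perron_bound.
  apply: (@leq_ltn_trans (p ^ (5 * n))); last by rewrite ltn_exp2l; lia.
  apply: (@leq_trans ((p ^ 5) ^ r)).
    rewrite leq_exp2r; last lia.
    by rewrite expnS; apply: leq_mul => //; lia.
  by rewrite -expnM leq_pexp2l // leq_mul2l rn.
have hs : high_size r d <= p ^ (5 * n + 7).
  rewrite /high_size; apply: (@leq_ltn_trans (p ^ (5 * n + 6))); last by rewrite
      ltn_exp2l; lia.
  rewrite (_ : 5 * n + 6 = 5 * n + 1 + 5); last lia.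
  rewrite [p ^ (_ + 5)]expnD; apply: leq_mul => //.
  by rewrite [p ^ 5]expnS; move: (p ^ 4) d4 => w; nia.
rewrite (_ : (5 * n + 7) * n + 4 = 1 + (3 + (5 * n + 7) * n)); last lia.
rewrite [p ^ (1 + _)]expnD expn1 leq_mul2l [p ^ (3 + _)]expnD; apply/orP; right; apply:
    leq_mul.
  by rewrite [p ^ 3]expnS; apply: leq_mul; [lia|rewrite leq_exp2r; lia].
apply: (@leq_trans ((p ^ (5 * n + 7)) ^ r)); first by rewrite leq_exp2r; lia.
by rewrite -expnM leq_pexp2l // leq_mul2l rn orbT.
Qed.

Lemma ex_int_sqrt d : exists s, s ^ 2 <= d < s.+1 ^ 2.
Proof.
elim: d => [|d [s /andP[sd ds]]]; first by exists 0.
have [h|h] := ltnP d.+1 (s.+1 ^ 2); first by exists s; rewrite h leqW.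
exists s.+1; rewrite h; apply: leq_ltn_trans ds _.
by rewrite ltn_exp2r.
Qed.

(** If s is the integer square root of d, a prime between s / 4 and s satisfies both p^2 <= d and d
    <= 16 p^2. The threshold e0 = K L, with L about log2 p, makes 2^e0 at least p^K while e0 stays
    logarithmic in p. *)
Lemma ex_good_prime n : exists d0, forall d, d0 <= d -> exists p e0,
  [/\ prime p, odd p, p ^ 2 <= d, d <= 16 * p ^ 2 &
    [/\ 1 < e0, e0 <= p, (9 * e0.-1) ^ (3 * n + 2) <= p, p * d <= 2 ^ e0 &
     forall r, 2 <= r <= n -> p * (2 * r ^ 2 * high_size r d ^ r) <= 2 ^ e0]].
Proof.
have [x0 x0P] := exists_prime_between.
pose K := (5 * n + 7) * n + 4.
(* 18 = 2 * 9: the additional factor 2^(3n + 2) compensates for passing from 2^L to p, which is only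
   known to exceed 2^(L - 1). *)
have [L0 L0P] := power_le_exp2 (18 * K) (3 * n + 2).
pose P0 := maxn (maxn n.+2 16) (2 ^ L0.+1).
pose X := maxn x0 P0.
exists ((4 * X.+1) ^ 2) => d dX.
have [s /andP[sd ds]] := ex_int_sqrt d.
have Xs : 4 * X.+1 <= s.
  by rewrite -ltnS -(@ltn_exp2r _ _ 2) //; apply: leq_ltn_trans dX ds.
have Xx : X <= s %/ 4 by lia.
have [p [pp xp p4]] := x0P _ (leq_trans (leq_maxl _ _) Xx).
have pX : X < p by exact: leq_ltn_trans xp.
have ps : p <= s by lia.
have sp : s.+1 <= 4 * p by lia.
have pP0 : P0 <= p by apply: leq_trans (ltnW pX); exact: leq_maxr.
have [pn p16 pL] : [/\ n.+2 <= p, 16 <= p & 2 ^ L0.+1 <= p].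
  by move: pP0; rewrite /P0 !geq_max => /andP[/andP[-> ->] ->].
have p_odd : odd p by case: (even_prime pp) => // p2; rewrite p2 in p16.
have pd : p ^ 2 <= d by apply: leq_trans sd; rewrite leq_exp2r.
have d0 : 0 < d by apply: leq_trans pd; rewrite expn_gt0; lia.
have dp : d <= 16 * p ^ 2.
  apply: ltnW; apply: leq_trans ds _; rewrite -[16]/(4 ^ 2) -expnMn leq_exp2r //.
have p1 : 1 < p by lia.
have /andP[pL1 pL2] := up_log_bounds (isT : 1 < 2) p1.
set L := up_log 2 p in pL1 pL2.
have LL0 : L0.+1 <= L by rewrite -(@leq_exp2l 2) //; apply: leq_trans pL pL2.
have K4 : 4 <= K by rewrite /K; lia.
exists p, (K * L).
have pK a : a <= p ^ K -> a <= 2 ^ (K * L).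
  by move=> aK; apply: leq_trans aK _; rewrite mulnC expnM leq_exp2r //; lia.
have e01 : 1 < K * L by nia.
have hp : (9 * (K * L).-1) ^ (3 * n + 2) <= p.
  have H := L0P L (ltnW LL0).
  apply: leq_trans (ltnW pL1).
  have L1 : L = L.-1.+1 by rewrite prednK //; lia.
  rewrite -(@leq_pmul2l 2) // -expnS -L1; apply: leq_trans H.
  apply: (@leq_trans (2 ^ (3 * n + 2) * (9 * (K * L).-1) ^ (3 * n + 2))).
    rewrite leq_mul2r; apply/orP; right; rewrite -[X in (X <= _)]expn1 leq_exp2l //; lia.
  by rewrite -expnMn leq_exp2r; lia.
split=> //; split=> //.
- apply: leq_trans hp; apply: (@leq_trans ((9 * (K * L).-1) ^ 1)); first by rewrite
    expn1; lia.
  by rewrite leq_pexp2l; lia.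
- apply: pK; apply: (@leq_trans (p * (16 * p ^ 2))); first by rewrite leq_mul2l dp orbT.
  apply: (@leq_trans (p ^ 4)); last by rewrite leq_pexp2l //; lia.
  by rewrite [p ^ 4]expnS [p ^ 3]expnS leq_mul2l leq_mul2r p16 !orbT.
by move=> r /andP[r2 rn]; apply: pK; apply: high_size_le.
Qed.
End Numerics.

(** * Conclusion *)

From mathcomp Require Import all_classical all_reals all_analysis.
From mathcomp Require Import complex.

Import numFieldNormedType.Exports.

Local Open Scope classical_set_scope.
Local Open Scope ring_scope.

Lemma smooth_proportion_bounds (R : realType) (n d : nat) :
  1 - Pr R (@singular_form n d) <= smooth_proportion R d n <= 1.
Proof.
have C0 : [pchar R[i]] =i pred0 by exact: pchar_num.
have [s1 s2] := HypersurfaceForms.count_smooth_forms n d C0.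
rewrite /smooth_proportion /Pr card_hom.
have p2 : 0 < 2 ^+ 'C(n + d, n) :> R by rewrite exprn_gt0 ?ltr0n.
apply/andP; split; last by rewrite ler_pdivrMr // mul1r -natrX ler_nat.
rewrite lerBlDr -mulrDl ler_pdivlMr // mul1r -natrX -natrD ler_nat.
exact: s2.
Qed.

Lemma smooth_proportion_rate (R : realType) (n : nat) : (2 <= n)%N ->
  exists C : R, 0 < C /\ \forall d \near \oo,
    `|smooth_proportion R d n - 1| <= C * d%:R `^ (- 2^-1).
Proof.
move=> n2; have [d0 d0P] := ex_good_prime n.
set K := (n.+1 ^ 3 * (9 ^ n.+1 + 2) + n.+1 * (n.+1 ^ n.+1 * (9 ^ n.+1 + 2)))%N.
have K0 : (0 < K)%N by rewrite addn_gt0 muln_gt0 expn_gt0 /= addn_gt0 orbT.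
(* The 4 comes from d <= 16 p^2, that is 1 / p <= 4 / sqrt d. *)
exists (4 * K%:R); split; first by rewrite mulr_gt0 // ltr0n.
near=> d.
have dd0 : (d0 <= d)%N by near: d; exists d0.
have [p [e0 [p_pr p_odd pd dp [e01 e0p hp pd2 high]]]] := d0P d dd0.
have /andP[lo up] := smooth_proportion_bounds R n d.
have HP := Pr_singular_form R p_pr p_odd n2 pd e01 e0p hp pd2 high.
rewrite distrC ger0_norm ?subr_ge0 //; apply: (@le_trans _ _ (K%:R / p%:R)).
  by apply: le_trans HP; rewrite lerBlDr addrC -lerBlDr.
have p0 : 0 < p%:R :> R by rewrite ltr0n prime.prime_gt0.
have d1 : 0 < d%:R :> R.
  by rewrite ltr0n; apply: leq_trans pd; rewrite expn_gt0 prime.prime_gt0.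
rewrite powRN powR12_sqrt ?(ltW d1) //.
have sd : 0 < Num.sqrt (d%:R : R) by rewrite sqrtr_gt0.
rewrite ler_pdivrMr // mulrAC ler_pdivlMr // [4 * _]mulrC -mulrA ler_pM2l ?ltr0n //.
rewrite -(@ler_pXn2r _ 2) ?nnegrE ?sqrtr_ge0 ?mulr_ge0 ?ler0n //.
rewrite sqr_sqrtr ?(ltW d1) // exprMn -!natrX -natrM ler_nat.
exact: dp.
Unshelve. all: by end_near. Qed.

Theorem corollary1p2 (R : realType) (n : nat) (hn : (2 <= n)%N) :
  (smooth_proportion R d n @[d --> \oo] --> (1 : R)) /\
  (fun d : nat => smooth_proportion R d n - 1)
    =O_\oo (fun d : nat => d%:R `^ (- 2^-1)).
Proof.
have [C [C0 CP]] := smooth_proportion_rate R hn.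
split; last first.
  apply/eqO_exP; exists C => //; near=> d.
  rewrite [X in _ <= C * X]ger0_norm ?powR_ge0 //.
  by near: d.
apply/cvgrPdist_le => e e0; near=> d.
rewrite distrC; apply: (@le_trans _ _ (C * d%:R `^ (- 2^-1))); first by near: d.
have d0 : 0 < d%:R :> R by rewrite ltr0n; near: d; exists 1%N.
rewrite powRN powR12_sqrt ?(ltW d0) //.
have sd : 0 < Num.sqrt (d%:R : R) by rewrite sqrtr_gt0.
rewrite ler_pdivrMr // mulrC -ler_pdivrMr //.
have Ce : 0 < C / e by rewrite divr_gt0.
rewrite -(@ler_pXn2r _ 2) ?nnegrE ?(ltW Ce) ?sqrtr_ge0 // sqr_sqrtr ?(ltW d0) //.
near: d; exact: nbhs_infty_ger.
Unshelve. all: by end_near. Qed.
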